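(* Let $1<p<\infty$, let $(a,b)$ be a matching pair with subordinated pair $(c,d)$, and suppose that $T(c)$ and $T(d)$ are Fredholm on $H^p$ with indices $\kappa_c=\mathrm{ind}\,T(c)\le0$ and $\kappa_d=\mathrm{ind}\,T(d)\le0$. Let $c_-,d_-$ be the factorization factors in the Wiener--Hopf factorizations (in $H^p$) of $c$ and $d$, respectively. If $f\in H^p$ satisfies the conditions $$\int_{\mathbb{T}}\overline{d_-^{-1}(t)}\,t^j\,\overline{f(t)}\,|dt|=0,\qquad j=0,1,\dots,-\kappa_d-1,$$ $$\int_{\mathbb{T}}T_r^{-1}(\overline d)\,T(\overline{\widetilde a^{-1}})\big(\overline{c_-^{-1}(t)}\,t^j\big)\,\overline{f(t)}\,|dt|=0,\qquad j=0,1,\dots,-\kappa_c-1,$$ then the equation $(T(a)+H(b))\varphi=f$ is uniquely solvable in $H^p$ and its solution $\varphi_0$ has the form $$\varphi_0=T_l^{-1}(c)T(\widetilde a^{-1})T_l^{-1}(d)f-JQc\,T_l^{-1}(c)T(\widetilde a^{-1})T_l^{-1}(d)f+JQ\widetilde a^{-1}T_l^{-1}(d)f .$$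
   Context: Let $\mathbb{T}$ be the unit circle, $1<p<\infty$, $1/p+1/q=1$, $L^p=L^p(\mathbb{T})$, $H^p=\{f\in L^p:\widehat f_n=0\ \forall n<0\}$, $\overline{H^p}=\{f\in L^p:\widehat f_n=0\ \forall n>0\}$. $P:\sum_{n\in\mathbb{Z}}\widehat f_nt^n\mapsto\sum_{n\ge0}\widehat f_nt^n$ is the Riesz projection on $L^p$, $Q=I-P$, and $(Jf)(t)=t^{-1}f(t^{-1})$. For $g\in L^\infty$: $\widetilde g(t)=g(1/t)$; $T(g)=PgP$ and $H(g)=PgQJ$ are the Toeplitz and Hankel operators on $H^p$ (and likewise on $H^q$). Matching pair: $a,b\in L^\infty$, $a$ (and hence $b$) invertible in $L^\infty$, with $a\widetilde a=b\widetilde b$ on $\mathbb{T}$. Its subordinated pair is $(c,d)$ with $c=ab^{-1}=\widetilde b\,\widetilde a^{-1}$ and $d=b\,\widetilde a^{-1}=\widetilde b^{-1}a$; one has $c\widetilde c=1=d\widetilde d$. Wiener--Hopf factorization in $H^p$: for $g\in L^\infty$ with $T(g)$ Fredholm on $H^p$, there is a unique factorization $g=g_-t^ng_+$ with $n=-\mathrm{ind}\,T(g)$, $g_+\in H^q$, $g_+^{-1}\in H^p$, $g_-\in\overline{H^p}$, $g_-^{-1}\in\overline{H^q}$, $g_-(\infty)=1$ (zeroth Fourier coefficient of $g_-$ equal to $1$), such that $g_+^{-1}Pg_-^{-1}I$, defined on polynomials, extends to a bounded operator on $H^p$, denoted $T(g_+^{-1})T(g_-^{-1})$. If $n\ge0$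 (i.e. $\mathrm{ind}\,T(g)\le0$), $T_l^{-1}(g):=T(t^{-n})T(g_+^{-1})T(g_-^{-1})$, a left inverse of $T(g)$. If $n\le0$, $T_r^{-1}(g):=T(g_+^{-1})T(g_-^{-1})T(t^{-n})$, a right inverse of $T(g)$. The operator $T(\overline d)$ acts on $H^q$ (it is the adjoint of $T(d)$ and has index $-\kappa_d\ge0$), and $T_r^{-1}(\overline d)$ is the right inverse just defined, formed on $H^q$ from the Wiener--Hopf factorization of $\overline d$ in $H^q$. A list of conditions indexed by $j=0,\dots,-\kappa-1$ with $\kappa=0$ is empty. *)

(* Defs.v *)
From HB Require Import structures.
From mathcomp Require Import all_boot all_order all_algebra.
From mathcomp Require Import all_classical all_reals all_analysis.
From mathcomp Require Import complex.

Set Implicit Arguments.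
Unset Strict Implicit.
Unset Printing Implicit Defensive.
Import Order.TTheory GRing.Theory Num.Theory.
Import numFieldNormedType.Exports.

Local Open Scope classical_set_scope.
Local Open Scope ring_scope.

(** A function on the unit circle is represented by a total function
    [R[i] -> R[i]] of which only the values [f (expi x)], [0 <= x <= 2 pi],
    matter. Elements of L^p are not quotiented: equality in L^p is [circ_eq]. *)

Section Circle.
Context {R : realType}.
Local Notation C := R[i].
Local Notation F := (C -> C).

Definition expi (x : R) : C := Complex (cos x) (sin x).

(** The measure |dt| on the circle, in the coordinate t = expi x. *)
Definition arc_length : {measure set (measurableTypeR R) -> \bar R} :=
  mrestr lebesgue_measure (measurable_itv `[0 : R, 2 * pi]).

Definition circ_eq (f g : F) : Prop :=
  {ae arc_length, forall x, f (expi x) = g (expi x)}.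

Definition circ_neq0 (f : F) : Prop := {ae arc_length, forall x, f (expi x) != 0}.

Definition circ_int (f : F) : C :=
  Complex (\int[arc_length]_(x in setT) complex.Re (f (expi x)))
          (\int[arc_length]_(x in setT) complex.Im (f (expi x))).

Definition fourier (f : F) (n : int) : C :=
  (Complex (2 * pi) 0)^-1 * circ_int (fun t => f t * t ^ (- n)).

Definition Lpnorm (p : \bar R) (f : F) : \bar R :=
  Lnorm arc_length p (fun x => (ComplexField.Normc.normc (f (expi x)))%:E).

Definition Lp (p : \bar R) (f : F) : Prop :=
  [/\ measurable_fun [set: measurableTypeR R] (fun x => complex.Re (f (expi x))),
      measurable_fun [set: measurableTypeR R] (fun x => complex.Im (f (expi x)))
    & (Lpnorm p f < +oo)%E].

Definition Hp (p : R) (f : F) : Prop :=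
  Lp p%:E f /\ forall n : int, n < 0 -> fourier f n = 0.

Definition Hpbar (p : R) (f : F) : Prop :=
  Lp p%:E f /\ forall n : int, 0 < n -> fourier f n = 0.

Definition circ_inv (f : F) : F := fun t => (f t)^-1.
Definition circ_conj (f : F) : F := fun t => conjc (f t).
Definition circ_tilde (f : F) : F := fun t => f t^-1.
Definition circ_mul (f g : F) : F := fun t => f t * g t.
Definition circ_pow (n : int) : F := fun t => t ^ n.

Definition Linf_invertible (g : F) : Prop :=
  [/\ Lp +oo%E g, circ_neq0 g & Lp +oo%E (circ_inv g)].

(** The function with Fourier series \sum_(n >= 0) (fourier f n) t^n. An
    integrable function is determined a.e. by its Fourier coefficients, so on
    every L^p, 1 < p < oo, this is the Riesz projection of L^p. *)
Definition projP (f : F) : F :=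
  xget (fun=> 0)
    [set h : F | Lp 1%:E h /\
      forall n : int, fourier h n = if 0 <= n then fourier f n else 0].

Definition projQ (f : F) : F := fun t => f t - projP f t.

Definition flipJ (f : F) : F := fun t => t^-1 * f t^-1.

Definition toeplitz (g : F) (f : F) : F := projP (circ_mul g (projP f)).

Definition hankel (g : F) (f : F) : F := projP (circ_mul g (projQ (flipJ f))).

Definition lincomb (k : nat) (z : 'I_k -> C) (u : 'I_k -> F) : F :=
  fun t => \sum_(i < k) z i * u i t.

Definition ker_dim (p : R) (A : F -> F) (k : nat) : Prop :=
  exists u : 'I_k -> F,
    [/\ forall i, Hp p (u i) /\ circ_eq (A (u i)) (fun=> 0),
        forall z, circ_eq (lincomb z u) (fun=> 0) -> forall i, z i = 0
      & forall f, Hp p f -> circ_eq (A f) (fun=> 0) ->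
          exists z, circ_eq f (lincomb z u)].

Definition coker_dim (p : R) (A : F -> F) (m : nat) : Prop :=
  exists v : 'I_m -> F,
    [/\ forall i, Hp p (v i),
        forall z g, Hp p g -> circ_eq (lincomb z v) (A g) -> forall i, z i = 0
      & forall f, Hp p f -> exists z g,
          Hp p g /\ circ_eq f (fun t => lincomb z v t + A g t)].

(** The bounded linear operator [A] is Fredholm on H^p with index [kappa].
    Closedness of the range is automatic when the codimension is finite. *)
Definition fredholm_index (p : R) (A : F -> F) (kappa : int) : Prop :=
  exists k m : nat, [/\ ker_dim p A k, coker_dim p A m & kappa = k%:Z - m%:Z].

Definition bounded_linear_Hp (p : R) (B : F -> F) : Prop :=
  [/\ forall f, Hp p f -> Hp p (B f),
      forall (z : C) f g, Hp p f -> Hp p g ->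
        circ_eq (B (fun t => z * f t + g t)) (fun t => z * B f t + B g t)
    & exists M : R, forall f, Hp p f ->
        (Lpnorm p%:E (B f) <= M%:E * Lpnorm p%:E f)%E].

(** [B] is the bounded extension to H^p of g_+^{-1} P g_-^{-1} I, that is,
    T(g_+^{-1}) T(g_-^{-1}). *)
Definition wh_extension (p : R) (gm gp : F) (B : F -> F) : Prop :=
  bounded_linear_Hp p B /\
  forall u : {poly C},
    circ_eq (B (fun t => u.[t]))
            (circ_mul (circ_inv gp) (projP (circ_mul (circ_inv gm) (fun t => u.[t])))).

(** g = g_- t^n g_+ is the Wiener--Hopf factorization of [g] in H^p, with [q]
    the exponent conjugate to [p]. *)
Definition wh_factorization (p q : R) (g : F) (n : int) (gm gp : F) : Prop :=
  [/\ circ_eq g (circ_mul gm (circ_mul (circ_pow n) gp)),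
      [/\ circ_neq0 gp, Hp q gp & Hp p (circ_inv gp)],
      [/\ circ_neq0 gm, Hpbar p gm & Hpbar q (circ_inv gm)],
      fourier gm 0 = 1
    & exists B, wh_extension p gm gp B].

(** The factorization and the extension are unique (up to [circ_eq]), hence so
    are the one-sided inverses. *)
Definition Tlinv (p q : R) (g : F) : F -> F :=
  xget (fun f : F => f)
    [set A : F -> F | exists n gm gp B,
      [/\ 0 <= n, wh_factorization p q g n gm gp, wh_extension p gm gp B
        & A = fun f => toeplitz (circ_pow (- n)) (B f)]].

Definition Trinv (p q : R) (g : F) : F -> F :=
  xget (fun f : F => f)
    [set A : F -> F | exists n gm gp B,
      [/\ n <= 0, wh_factorization p q g n gm gp, wh_extension p gm gp B
        & A = fun f => B (toeplitz (circ_pow (- n)) f)]].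

(** Invertibility of [b] follows from that of [a]. *)
Definition matching_pair (a b : F) : Prop :=
  [/\ Linf_invertible a, Lp +oo%E b
    & circ_eq (circ_mul a (circ_tilde a)) (circ_mul b (circ_tilde b))].

Definition sub_c (a b : F) : F := circ_mul a (circ_inv b).
Definition sub_d (a b : F) : F := circ_mul b (circ_inv (circ_tilde a)).

End Circle.

(* Main.v *)
Require Import Defs.
From HB Require Import structures.
From mathcomp Require Import all_boot all_order all_algebra.
From mathcomp Require Import all_classical all_reals all_analysis.
From mathcomp Require Import complex.
From mathcomp Require Import measurable_realfun ess_sup_inf zify ring lra.

(** Let g and h solve the Toeplitz equations T(d) g = f and T(c) h = T(a~^-1) g, where a~ stands
    for a(1/t), and put phi0 = h - J(c h - a~^-1 g). The matching relation a a~ = b b~ gives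
    a phi0 + b J phi0 = J g + d g. Since J g has negative frequencies only, projecting yields
    (T(a) + H(b)) phi0 = P(d g) = f (T_plus_H_solution); the formula of the theorem is phi0 with
    the Hankel part written out. For uniqueness, if psi = a phi + b J phi has negative
    frequencies only, the same relation reads psi = d J psi with J psi in H^p; T(d) is injective,
    so psi = 0, and then c phi = - J phi vanishes because T(c) is injective
    (T_plus_H_injective).

    What has to be seen is that the one-sided inverses do solve the two equations. If
    g = gm t^n gp with n >= 0, the extension B of gp^-1 P gm^-1 is a right inverse of T(g t^-n)
    (wh_right), and t^-n B f solves T(g) w = f as soon as B f lies in t^n H^p, that is, as soon as
    the first n coefficients of gm^-1 f vanish (Tlinv_solves). For the symbol d this is the first
    family of conditions. For the symbol c the coefficients in question are pairings of
    T(a~^-1) g with conj(cm)^-1 t^j, and a right inverse of T(conj d), the adjoint of T(d), moves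
    them from g to T(d) g = f, where they become the second family (cokernel_condition). Such a
    right inverse exists because conj d inherits a factorization from d, whose operator is the
    adjoint of the one for d (adjoint_factorization).

    The underlying analysis is the L^p theory of the Riesz projection P. It is defined by its
    Fourier coefficients, so it requires that these determine a function (fourier_inj), that
    trigonometric polynomials are dense (teval_dense), and the theorem of M. Riesz (riesz). For
    the latter let F = u + i v be an analytic polynomial with u > 0 on the circle and F(0) real.
    For s > 0 the function 1/(1 + s F) is again analytic, so that its mean is 1/(1 + s F(0));
    comparing real parts pointwise, the integral of (s v)^2 / (1 + (s v)^2) is at most 24 times
    that of (s u)^2 / (1 + s u) (conjugate_scale). Weighting by s^(-p) and summing over dyadic s
    bounds the integral of |v|^p by that of u^p for 1 < p < 2 (conjugate_pos). A real
    trigonometric polynomial is a difference of positive ones of comparable size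
    (conj_bound_lt2), the case p = 2 is read off the mean of F^2 (conj_bound2), and p > 2 follows
    by duality (proj_bound_gt1). *)

Set Implicit Arguments.
Unset Strict Implicit.
Unset Printing Implicit Defensive.
Import Order.TTheory GRing.Theory Num.Theory.
Import numFieldNormedType.Exports.
Local Open Scope classical_set_scope.
Local Open Scope ring_scope.
Arguments arc_length : simpl never.

(** * Complex numbers and the arc-length measure *)

Notation nc := ComplexField.Normc.normc.

Section ComplexNumbers.
Context {R : realType}.
Local Notation C := R[i].
Implicit Types (z w : C).

Lemma ReD z w : complex.Re (z + w) = complex.Re z + complex.Re w.
Proof. by case: z; case: w. Qed.
Lemma ImD z w : complex.Im (z + w) = complex.Im z + complex.Im w.
Proof. by case: z; case: w. Qed.
Lemma ReN z : complex.Re (- z) = - complex.Re z.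
Proof. by case: z. Qed.
Lemma ImN z : complex.Im (- z) = - complex.Im z.
Proof. by case: z. Qed.
Lemma ReM z w : complex.Re (z * w) =
  complex.Re z * complex.Re w - complex.Im z * complex.Im w.
Proof. by case: z; case: w. Qed.
Lemma ImM z w : complex.Im (z * w) =
  complex.Re z * complex.Im w + complex.Im z * complex.Re w.
Proof. by case: z; case: w => a b c d; rewrite /= . Qed.

Lemma complex_ext z w : complex.Re z = complex.Re w -> complex.Im z = complex.Im w -> z = w.
Proof. by case: z; case: w => a b c d /= -> ->. Qed.

Lemma normc_ge0 z : 0 <= nc z.
Proof. by case: z => a b; apply: sqrtr_ge0. Qed.

Lemma normc_sqr z : nc z ^+ 2 = complex.Re z ^+ 2 + complex.Im z ^+ 2.
Proof. by case: z => a b /=; rewrite sqr_sqrtr// addr_ge0// sqr_ge0. Qed.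

Lemma normcE_sqrt z : nc z = Num.sqrt (complex.Re z ^+ 2 + complex.Im z ^+ 2).
Proof. by case: z. Qed.

Lemma normcD z w : nc (z + w) <= nc z + nc w.
Proof. exact: le_normcD. Qed.

Lemma normc_opp z : nc (- z) = nc z.
Proof. exact: normcN. Qed.

Lemma normc_conj z : nc (conjc z) = nc z.
Proof. by case: z => a b /=; rewrite sqrrN. Qed.

Lemma normcX z n : nc (z ^+ n) = nc z ^+ n.
Proof.
by elim: n => [|n IH]; rewrite ?expr0 ?Normc.normc1// !exprS Normc.normcM IH.
Qed.

Lemma normc_Re z : `|complex.Re z| <= nc z.
Proof. by rewrite normcE_sqrt -sqrtr_sqr ler_wsqrtr// lerDl sqr_ge0. Qed.

Lemma normc_Im z : `|complex.Im z| <= nc z.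
Proof. by rewrite normcE_sqrt -sqrtr_sqr ler_wsqrtr// lerDr sqr_ge0. Qed.

Lemma normc_le_ReIm z : nc z <= `|complex.Re z| + `|complex.Im z|.
Proof.
rewrite normcE_sqrt -[leRHS]ger0_norm ?addr_ge0// -sqrtr_sqr ler_wsqrtr//.
rewrite sqrrD !real_normK ?num_real// -addrA lerD2l lerDr.
by rewrite mulrn_wge0// mulr_ge0.
Qed.

Lemma normc_real (x : R) : nc (x%:C)%C = `|x|.
Proof. by rewrite normcE_sqrt/= expr0n/= addr0 sqrtr_sqr. Qed.

Lemma normc_gt0 z : z != 0 -> 0 < nc z.
Proof.
move=> z0; rewrite lt_neqAle normc_ge0 andbT eq_sym.
by apply: contra_neq z0 => /Normc.eq0_normc.
Qed.

Lemma mul_conjc z : z * conjc z = ((nc z ^+ 2)%:C)%C.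
Proof.
rewrite normc_sqr; apply: complex_ext; case: z => a b /=; ring.
Qed.

Lemma conjcM z w : conjc (z * w) = conjc z * conjc w.
Proof. exact: rmorphM. Qed.
Lemma conjcD z w : conjc (z + w) = conjc z + conjc w.
Proof. exact: rmorphD. Qed.
Lemma conjcV z : conjc z^-1 = (conjc z)^-1.
Proof. exact: conjc_inv. Qed.

Lemma Re_conj z : complex.Re (conjc z) = complex.Re z.
Proof. by case: z. Qed.
Lemma Im_conj z : complex.Im (conjc z) = - complex.Im z.
Proof. by case: z. Qed.

Lemma expi0 : expi (0 : R) = 1.
Proof. by rewrite /expi cos0 sin0. Qed.

Lemma expiD (x y : R) : expi (x + y) = expi x * expi y.
Proof. by apply: complex_ext; rewrite /= ?cosD ?sinD; ring. Qed.

Lemma normc_expi (x : R) : nc (expi x) = 1.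
Proof. by rewrite normcE_sqrt /= cos2Dsin2 sqrtr1. Qed.

Lemma expi_neq0 (x : R) : expi x != 0.
Proof.
apply/eqP => e; have := normc_expi x; rewrite e Normc.normc0 => /esym/eqP.
by rewrite oner_eq0.
Qed.

Lemma expiN (x : R) : expi (- x) = (expi x)^-1.
Proof.
by apply: (mulfI (expi_neq0 x)); rewrite divff ?expi_neq0// -expiD subrr expi0.
Qed.

Lemma conj_expi (x : R) : conjc (expi x) = (expi x)^-1.
Proof. by rewrite -expiN /expi cosN sinN. Qed.

Lemma expi2pi : expi (2 * pi : R) = 1.
Proof. by rewrite /expi mulr_natl cos2pi sin2pi. Qed.

Lemma expiX (x : R) n : expi x ^+ n = expi (n%:R * x).
Proof.
elim: n => [|n IH]; first by rewrite mul0r expi0 expr0.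
by rewrite exprS IH -expiD mulrSr mulrDl mul1r addrC.
Qed.

Lemma expiXz (x : R) (n : int) : expi x ^ n = expi (n%:~R * x).
Proof.
case: n => n; first by rewrite -exprnP expiX.
by rewrite NegzE -exprnN expiX -expiN mulrNz mulNr.
Qed.

End ComplexNumbers.

Section CircleMeasure.
Context {R : realType}.
Local Notation C := R[i].
Local Notation F := (C -> C).
Local Notation T := (measurableTypeR R).
Local Notation mu := (@arc_length R).
Local Notation leb := (@lebesgue_measure R).
Local Notation D := (`[0 : R, 2 * pi]%classic).

Lemma pi2_gt0 : 0 < 2 * pi :> R.
Proof. by rewrite mulr_gt0// pi_gt0. Qed.

Lemma arc_lengthT : mu setT = (2 * pi)%:E.
Proof.
rewrite /arc_length /= /mrestr setTI lebesgue_measure_itv/= lte_fin pi2_gt0.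
by rewrite -EFinD subr0.
Qed.

Lemma arc_length_lty : (mu setT < +oo)%E.
Proof. by rewrite arc_lengthT ltry. Qed.

Lemma arc_length_setC : mu (~` D) = 0%E.
Proof. by rewrite /arc_length /= /mrestr setICl measure0. Qed.

(** The measure lives on [0, 2 pi], so angles outside this interval form a null set. *)
Lemma arc_length_ae (P : R -> Prop) : (forall x, 0 <= x <= 2 * pi -> P x) ->
  {ae mu, forall x, P x}.
Proof.
move=> h; exists (~` D); split.
- by apply: measurableC; exact: measurable_itv.
- exact: arc_length_setC.
- move=> x /= nP /= xD; apply: nP; apply: h.
  by move: xD; rewrite /= in_itv.
Qed.

Lemma bounded_integrable (u : T -> R) (M : R) : measurable_fun setT u ->
  (forall x, `|u x| <= M) -> mu.-integrable setT (EFin \o u).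
Proof.
move=> mu_ uM; apply: measurable_bounded_integrable => //.
- exact: arc_length_lty.
- exists M; split; first exact: num_real.
  by move=> y My x _ /=; rewrite (le_trans (uM x))// ltW.
Qed.

Lemma integral_arc_length (u : T -> \bar R) : mu.-integrable setT u ->
  (\int[mu]_(x in setT) u x = \int[leb]_(x in D) u x)%E.
Proof.
move=> iu.
have mD : measurable (D : set T) by exact: measurable_itv.
transitivity (\int[mu]_(x in D) u x)%E.
  rewrite (@negligible_integral _ _ _ mu setT (~` D))//.
  - by rewrite setDE setCK setTI.
  - exact: measurableC.
  - exact: arc_length_setC.
apply: eq_measure_integral => A mA AD.
by rewrite /arc_length /= /mrestr setIidl.
Qed.

End CircleMeasure.

(** * L^p spaces on the circle *)

Section LebesgueSpaces.
Context {R : realType}.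
Local Notation C := R[i].
Local Notation F := (C -> C).
Local Notation T := (measurableTypeR R).
Local Notation mu := (@arc_length R).
Implicit Types (f g h : F) (p q : R).

Lemma ae_imp (P Q : T -> Prop) : (forall x, P x -> Q x) ->
  {ae mu, forall x, P x} -> {ae mu, forall x, Q x}.
Proof. by move=> PQ h; apply: filterS h. Qed.

Lemma ae_imp2 (P Q S : T -> Prop) : (forall x, P x -> Q x -> S x) ->
  {ae mu, forall x, P x} -> {ae mu, forall x, Q x} -> {ae mu, forall x, S x}.
Proof. by move=> PQ h k; apply: filterS2 h k. Qed.

Definition cmeas f :=
  measurable_fun [set: T] (fun x => complex.Re (f (expi x))) /\
  measurable_fun [set: T] (fun x => complex.Im (f (expi x))).

Definition mag f : T -> R := fun x => nc (f (expi x)).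

Lemma mag_ge0 f x : 0 <= mag f x. Proof. exact: normc_ge0. Qed.

Lemma measurable_mag f : cmeas f -> measurable_fun setT (mag f).
Proof.
move=> [mr mi].
have -> : mag f = (fun x => powR x 2^-1) \o
   (fun x => complex.Re (f (expi x)) ^+ 2 + complex.Im (f (expi x)) ^+ 2).
  apply/funext => x /=; rewrite powR12_sqrt ?addr_ge0 ?sqr_ge0//.
  by rewrite /mag normcE_sqrt.
apply: measurableT_comp; first exact: measurable_powR.
by apply: measurable_funD; apply: measurable_funX.
Qed.

Lemma cmeasD f g : cmeas f -> cmeas g -> cmeas (fun t => f t + g t).
Proof.
move=> [fr fi] [gr gi]; split.
- by under eq_fun do rewrite ReD; exact: measurable_funD.
- by under eq_fun do rewrite ImD; exact: measurable_funD.
Qed.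

Lemma cmeasN f : cmeas f -> cmeas (fun t => - f t).
Proof.
move=> [fr fi]; split.
- by under eq_fun do rewrite ReN; exact: measurableT_comp.
- by under eq_fun do rewrite ImN; exact: measurableT_comp.
Qed.

Lemma cmeasM f g : cmeas f -> cmeas g -> cmeas (fun t => f t * g t).
Proof.
move=> [fr fi] [gr gi]; split.
- by under eq_fun do rewrite ReM; apply: measurable_funB; exact: measurable_funM.
- by under eq_fun do rewrite ImM; apply: measurable_funD; exact: measurable_funM.
Qed.

Lemma cmeas_cst (c : C) : cmeas (fun=> c).
Proof. by split; exact: measurable_cst. Qed.

Lemma cmeas_conj f : cmeas f -> cmeas (circ_conj f).
Proof.
move=> [fr fi]; split; rewrite /circ_conj.
- by under eq_fun do rewrite Re_conj.
- by under eq_fun do rewrite Im_conj; exact: measurableT_comp.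
Qed.

Lemma measurable_inv_ge0 (u : T -> R) : measurable_fun setT u -> (forall x, 0 <= u x) ->
  measurable_fun setT (fun x => (u x)^-1).
Proof.
move=> mu_ u0.
have -> : (fun x => (u x)^-1) = (fun x => powR x (-1)) \o u.
  by apply/funext => x /=; rewrite powR_inv1.
by apply: measurableT_comp; first exact: measurable_powR.
Qed.

Lemma complex_inv (z : C) :
  z^-1 = conjc z * (((nc z ^+ 2)^-1)%:C)%C.
Proof.
have [->|z0] := eqVneq z 0; first by rewrite invr0 conjc0 mul0r.
apply: (mulfI z0); rewrite divff// mulrA mul_conjc -rmorphM /= divff//.
by rewrite sqrf_eq0 gt_eqF// normc_gt0.
Qed.

Lemma cmeas_inv f : cmeas f -> cmeas (circ_inv f).
Proof.
move=> mf.
have -> : circ_inv f = (fun t => circ_conj f t * (((nc (f t) ^+ 2)^-1)%:C)%C).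
  by apply/funext => t; rewrite /circ_inv complex_inv.
apply: cmeasM; first exact: cmeas_conj.
split => /=; last exact: measurable_cst.
apply: measurable_inv_ge0 => [|x]; last exact: sqr_ge0.
by apply: measurable_funX; exact: measurable_mag.
Qed.

Lemma cmeas_circ_mul f g : cmeas f -> cmeas g -> cmeas (circ_mul f g).
Proof. exact: cmeasM. Qed.

Lemma continuous_cos_sin_comp (k : R) :
  measurable_fun [set: T] (fun x => cos (k * x)) /\
  measurable_fun [set: T] (fun x => sin (k * x)).
Proof.
split; apply: continuous_measurable_fun => x;
  apply: continuous_comp; first [exact: mulrl_continuous | exact: continuous_cos | exact: continuous_sin].
Qed.

Lemma cmeas_pow (n : int) : cmeas (circ_pow n).
Proof.
rewrite /cmeas /circ_pow.
split; under eq_fun do rewrite expiXz.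
- exact: (continuous_cos_sin_comp _).1.
- exact: (continuous_cos_sin_comp _).2.
Qed.

Lemma LpnormE (p : \bar R) f : Lpnorm p f = Lnorm mu p (EFin \o mag f).
Proof. by []. Qed.

Lemma LpP (p : \bar R) f : Lp p f <-> cmeas f /\ (Lpnorm p f < +oo)%E.
Proof. by split => [[? ? ?]|[[? ?] ?]]. Qed.

Lemma Lp_cmeas (p : \bar R) f : Lp p f -> cmeas f.
Proof. by move/LpP => []. Qed.

Definition nrm p f : R := fine (Lpnorm p%:E f).

Lemma nrm_ge0 p f : 0 <= nrm p f.
Proof. by rewrite fine_ge0// Lnorm_ge0. Qed.

Lemma nrmE p f : Lp p%:E f -> ((nrm p f)%:E = Lpnorm p%:E f)%E.
Proof.
move=> [_ _ h]; rewrite fineK// ge0_fin_numE//; exact: Lnorm_ge0.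
Qed.

Lemma Lpnorm_le_ae p f g : 0 < p -> cmeas f -> cmeas g ->
  {ae mu, forall x, mag f x <= mag g x} -> (Lpnorm p%:E f <= Lpnorm p%:E g)%E.
Proof.
move=> p0 mf mg fg; rewrite !LpnormE unlock.
have mpow (h : F) : cmeas h -> measurable_fun [set: T] (fun x => (`|(EFin \o mag h) x| `^ p)%E).
  move=> mh; apply: (measurableT_comp (measurable_poweR _)) => //.
  by apply: measurableT_comp => //; apply/measurable_EFinP; exact: measurable_mag.
have i0 (h : F) : (0 <= \int[mu]_x (`|(EFin \o mag h) x| `^ p))%E.
  by apply: integral_ge0 => x _; exact: poweR_ge0.
apply: gt0_ler_poweR.
- by rewrite invr_ge0 ltW.
- by rewrite in_itv/= i0 leey.
- by rewrite in_itv/= i0 leey.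
rewrite /=; apply: ae_ge0_le_integral => //.
- exact: mpow.
- exact: mpow.
apply: ae_imp fg => x fg _.
rewrite lee_fin !ger0_norm ?mag_ge0//.
by apply: ge0_ler_powR; rewrite ?nnegrE ?mag_ge0 ?(ltW p0).
Qed.

Lemma Lp_le p f g : 0 < p -> cmeas f -> Lp p%:E g ->
  {ae mu, forall x, mag f x <= mag g x} -> Lp p%:E f /\ nrm p f <= nrm p g.
Proof.
move=> p0 mf Lg fg; have h := Lpnorm_le_ae p0 mf (Lp_cmeas Lg) fg.
have Lf : Lp p%:E f.
  by apply/LpP; split => //; apply: le_lt_trans h _; case: Lg.
by split=> //; rewrite -lee_fin !nrmE.
Qed.

Lemma LpnormZ p f (k : R) g : 0 < p -> 0 <= k -> cmeas f ->
  (forall x, mag g x = k * mag f x) -> (Lpnorm p%:E g = k%:E * Lpnorm p%:E f)%E.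
Proof.
move=> p0 k0 mf gE; rewrite !LpnormE unlock.
have -> : (\int[mu]_x (`|(EFin \o mag g) x| `^ p) =
   (k `^ p)%:E * \int[mu]_x (`|(EFin \o mag f) x| `^ p))%E.
  rewrite -ge0_integralZl//; last 3 first.
  - apply: (measurableT_comp (measurable_poweR _)) => //.
    by apply: measurableT_comp => //; apply/measurable_EFinP; exact: measurable_mag.
  - by move=> x _; exact: poweR_ge0.
  - by rewrite lee_fin powR_ge0.
  apply: eq_integral => x _ /=; rewrite gE.
  by rewrite !ger0_norm ?mulr_ge0 ?mag_ge0// powRM ?mag_ge0// EFinM.
rewrite poweRM ?lee_fin ?powR_ge0//; last first.
  by apply: integral_ge0 => x _; exact: poweR_ge0.
by rewrite poweR_EFin -powRrM divff ?gt_eqF// powRr1.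
Qed.

Lemma Lp_scale p f (k : R) g : 0 < p -> 0 <= k -> Lp p%:E f -> cmeas g ->
  (forall x, mag g x = k * mag f x) -> Lp p%:E g /\ nrm p g = k * nrm p f.
Proof.
move=> p0 k0 Lf mg gE.
have h := LpnormZ p0 k0 (Lp_cmeas Lf) gE.
have Lg : Lp p%:E g.
  apply/LpP; split => //; rewrite h -(nrmE Lf) -EFinM; exact: ltry.
by split => //; apply: EFin_inj; rewrite EFinM !nrmE.
Qed.

Lemma LpZ p f (c : C) : 0 < p -> Lp p%:E f ->
  Lp p%:E (fun t => c * f t) /\ nrm p (fun t => c * f t) = nc c * nrm p f.
Proof.
move=> p0 Lf; apply: Lp_scale => //; first exact: normc_ge0.
- by apply: cmeasM; [exact: cmeas_cst | exact: Lp_cmeas Lf].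
- by move=> x; rewrite /mag Normc.normcM.
Qed.

Lemma LpN p f : 0 < p -> Lp p%:E f ->
  Lp p%:E (fun t => - f t) /\ nrm p (fun t => - f t) = nrm p f.
Proof.
move=> p0 Lf; rewrite -[nrm p f]mul1r; apply: Lp_scale => //.
- by apply: cmeasN; exact: Lp_cmeas Lf.
- by move=> x; rewrite /mag normc_opp mul1r.
Qed.

Lemma LpnormD p f g : 1 <= p -> cmeas f -> cmeas g ->
  (Lpnorm p%:E (fun t => f t + g t)%R <= Lpnorm p%:E f + Lpnorm p%:E g)%E.
Proof.
move=> p1 mf mg.
apply: le_trans (minkowski_EFin mu (measurable_mag mf) (measurable_mag mg) p1).
have p0 : 0 < p by lra.
pose h : F := fun t => ((nc (f t) + nc (g t))%:C)%C.
have magh : mag h = (mag f \+ mag g)%R.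
  by apply/funext => x; rewrite /mag /h normc_real ger0_norm// addr_ge0// normc_ge0.
rewrite -magh; apply: (@Lpnorm_le_ae p _ h) => //.
- exact: cmeasD.
- split; last exact: measurable_cst.
  by apply: measurable_funD; exact: measurable_mag.
- by apply: aeW => x; rewrite magh /mag; exact: normcD.
Qed.

Lemma LpD p f g : 1 <= p -> Lp p%:E f -> Lp p%:E g ->
  Lp p%:E (fun t => f t + g t) /\ nrm p (fun t => f t + g t) <= nrm p f + nrm p g.
Proof.
move=> p1 Lf Lg; have h := LpnormD p1 (Lp_cmeas Lf) (Lp_cmeas Lg).
have Lh : Lp p%:E (fun t => f t + g t).
  apply/LpP; split; first by apply: cmeasD; [exact: Lp_cmeas Lf|exact: Lp_cmeas Lg].
  by apply: le_lt_trans h _; rewrite -!nrmE// -EFinD ltry.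
by split => //; rewrite -lee_fin EFinD !nrmE.
Qed.

Lemma LpB p f g : 1 <= p -> Lp p%:E f -> Lp p%:E g ->
  Lp p%:E (fun t => f t - g t) /\ nrm p (fun t => f t - g t) <= nrm p f + nrm p g.
Proof.
move=> p1 Lf Lg; have p0 : 0 < p by lra.
have [LN <-] := LpN p0 Lg; exact: (LpD p1 Lf LN).
Qed.

Lemma hoelder_circ p q f g : 0 < p -> 0 < q -> p^-1 + q^-1 = 1 ->
  Lp p%:E f -> Lp q%:E g ->
  Lp 1%:E (fun t => f t * g t) /\ nrm 1 (fun t => f t * g t) <= nrm p f * nrm q g.
Proof.
move=> p0 q0 pq Lf Lg.
have h := hoelder mu (measurable_mag (Lp_cmeas Lf)) (measurable_mag (Lp_cmeas Lg)) p0 q0 pq.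
have e : EFin \o (mag f \* mag g)%R = EFin \o mag (fun t => f t * g t).
  by apply/funext => x /=; rewrite /mag Normc.normcM.
rewrite e in h.
have Lh : Lp 1%:E (fun t => f t * g t).
  apply/LpP; split; first by apply: cmeasM; [exact: Lp_cmeas Lf|exact: Lp_cmeas Lg].
  apply: le_lt_trans h _; rewrite -/(Lpnorm p%:E f) -/(Lpnorm q%:E g).
  by rewrite -!nrmE// -EFinM ltry.
by split => //; rewrite -lee_fin EFinM !nrmE.
Qed.

Lemma nrm1E f : Lp 1%:E f -> (nrm 1 f)%:E = (\int[mu]_x (mag f x)%:E)%E.
Proof.
move=> Lf; rewrite nrmE// LpnormE Lnorm1; apply: eq_integral => x _ /=.
by rewrite ger0_norm ?mag_ge0.
Qed.

Lemma Lp1_mag_integrable f : Lp 1%:E f -> mu.-integrable setT (EFin \o mag f).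
Proof.
move=> Lf; apply/integrableP; split.
  by apply/measurable_EFinP; apply: measurable_mag; exact: Lp_cmeas Lf.
rewrite (eq_integral (fun x => (mag f x)%:E)); last first.
  by move=> x _; rewrite /= ger0_norm ?mag_ge0.
by rewrite -nrm1E// ltry.
Qed.

Lemma Lp1_Re_integrable f : Lp 1%:E f ->
  mu.-integrable setT (fun x => (complex.Re (f (expi x)))%:E).
Proof.
move=> Lf; have [mr _] := Lp_cmeas Lf.
apply: (le_integrable _ _ _ (Lp1_mag_integrable Lf)) => //.
  exact/measurable_EFinP.
by move=> x _ /=; rewrite lee_fin (ger0_norm (mag_ge0 _ _)); exact: normc_Re.
Qed.

Lemma Lp1_Im_integrable f : Lp 1%:E f ->
  mu.-integrable setT (fun x => (complex.Im (f (expi x)))%:E).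
Proof.
move=> Lf; have [_ mi] := Lp_cmeas Lf.
apply: (le_integrable _ _ _ (Lp1_mag_integrable Lf)) => //.
  exact/measurable_EFinP.
by move=> x _ /=; rewrite lee_fin (ger0_norm (mag_ge0 _ _)); exact: normc_Im.
Qed.

Lemma circ_intD f g : Lp 1%:E f -> Lp 1%:E g ->
  circ_int (fun t => f t + g t) = circ_int f + circ_int g.
Proof.
move=> Lf Lg; apply: complex_ext; rewrite ?ReD ?ImD /circ_int /=.
- under eq_Rintegral do rewrite ReD.
  by rewrite RintegralD//; exact: Lp1_Re_integrable.
- under eq_Rintegral do rewrite ImD.
  by rewrite RintegralD//; exact: Lp1_Im_integrable.
Qed.

Lemma circ_intZ f (c : C) : Lp 1%:E f ->
  circ_int (fun t => c * f t) = c * circ_int f.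
Proof.
move=> Lf; have ir := Lp1_Re_integrable Lf; have ii := Lp1_Im_integrable Lf.
have iZ (k : R) (u : T -> R) : mu.-integrable setT (fun x => (u x)%:E) ->
    mu.-integrable setT (fun x => (k * u x)%:E).
  by move=> iu; under eq_fun do rewrite EFinM; exact: integrableZl.
apply: complex_ext; rewrite ?ReM ?ImM /circ_int /=.
- under eq_Rintegral do rewrite ReM.
  by rewrite RintegralB ?RintegralZl//; exact: iZ.
- under eq_Rintegral do rewrite ImM.
  by rewrite RintegralD ?RintegralZl//; exact: iZ.
Qed.

Lemma circ_int_conj f : Lp 1%:E f ->
  circ_int (circ_conj f) = conjc (circ_int f).
Proof.
move=> Lf; apply: complex_ext; rewrite ?Re_conj ?Im_conj /circ_int /circ_conj /=.
- by under eq_Rintegral do rewrite Re_conj.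
- under eq_Rintegral do rewrite Im_conj -mulN1r.
  by rewrite RintegralZl ?mulN1r//; exact: Lp1_Im_integrable.
Qed.

Lemma circ_int_ae f g : cmeas f -> cmeas g -> circ_eq f g -> circ_int f = circ_int g.
Proof.
move=> [fr fi] [gr gi] fg; rewrite /circ_int /Rintegral.
congr Complex; congr fine; apply: ae_eq_integral => //; try exact/measurable_EFinP.
- by apply: ae_imp fg => x e _; rewrite e.
- by apply: ae_imp fg => x e _; rewrite e.
Qed.

(** The real and the imaginary part are estimated separately, whence the factor 2. *)
Lemma circ_int_le f : Lp 1%:E f -> nc (circ_int f) <= 2 * nrm 1 f.
Proof.
move=> Lf; apply: le_trans (normc_le_ReIm _) _; rewrite mulr_natl mulr2n.
have ir := Lp1_Re_integrable Lf; have ii := Lp1_Im_integrable Lf.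
have key (u : T -> R) : mu.-integrable setT (EFin \o u) ->
    (forall x, `|u x| <= mag f x) -> `|\int[mu]_(x in setT) u x| <= nrm 1 f.
  move=> iu um; apply: le_trans (le_normr_Rintegral _ iu) _ => //.
  rewrite -lee_fin nrm1E// /Rintegral fineK; last first.
    by apply: integrable_fin_num => //; exact: (integrable_abse iu).
  apply: ge0_le_integral => //=.
  - by apply: measurable_int (integrable_abse iu).
  - exact: measurable_int (Lp1_mag_integrable Lf).
  - by move=> x _; rewrite lee_fin.
by apply: lerD; apply: key => // x; [exact: normc_Re|exact: normc_Im].
Qed.

(** Essential boundedness with an explicit constant, as needed when it acts as a multiplier
    on every L^p at once. *)
Definition bdd g := cmeas g /\ exists2 M, 0 <= M & {ae mu, forall x, mag g x <= M}.

Lemma bdd_intro g M : cmeas g -> (forall x, mag g x <= M) -> bdd g.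
Proof.
move=> mg gM; split=> //; exists M; first exact: le_trans (mag_ge0 g 0) (gM 0).
exact: aeW.
Qed.

Lemma Linf_bdd g : Lp +oo%E g -> bdd g.
Proof.
move=> /LpP[mg]; rewrite LpnormE unlock arc_lengthT lte_fin pi2_gt0.
rewrite ess_supEae => /ereal_inf_lt[y /= hy yoo]; split=> //.
exists (fine (maxe y 0)); first by rewrite fine_ge0// le_max lexx orbT.
apply: filterS hy => x /= hx; have mx0 := mag_ge0 g x; rewrite ger0_norm// in hx.
move: hx yoo; case: y => [y||]//= hx _.
rewrite lee_fin in hx; rewrite /maxe; case: ifPn => //=.
by rewrite lte_fin => y0; rewrite (le_trans hx)// ltW.
Qed.

Lemma LpM_bdd p g : 1 <= p -> bdd g -> exists2 M, 0 <= M &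
  forall f, Lp p%:E f -> Lp p%:E (fun t => g t * f t) /\
    nrm p (fun t => g t * f t) <= M * nrm p f.
Proof.
move=> p1 [mg [M M0 gM]]; have p0 : 0 < p by lra.
exists M => // f Lf.
have [LM <-] : Lp p%:E (fun t => ((M%:C)%C) * f t) /\
   nrm p (fun t => ((M%:C)%C) * f t) = M * nrm p f.
  by have := LpZ ((M%:C)%C) p0 Lf; rewrite normc_real ger0_norm.
apply: Lp_le => //; first by apply: cmeasM => //; exact: Lp_cmeas Lf.
apply: filterS gM => x gM; rewrite /mag !Normc.normcM normc_real ger0_norm//.
by rewrite ler_wpM2r// normc_ge0.
Qed.

Lemma bdd_Lp p g : 1 <= p -> bdd g -> Lp p%:E g.
Proof.
move=> p1 bg; have p0 : 0 < p by lra.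
have L1 : Lp p%:E (fun=> (1 : C)).
  apply/LpP; split; first exact: cmeas_cst.
  rewrite LpnormE.
  have -> : EFin \o mag (fun=> (1 : C)) = EFin \o cst 1.
    by apply/funext => x; rewrite /mag /= expr0n/= addr0 expr1n sqrtr1.
  by rewrite Lnorm_cst1 arc_lengthT poweR_lty ?ltry.
have [M _ /(_ _ L1)[+ _]] := LpM_bdd p1 bg.
by under eq_fun do rewrite mulr1.
Qed.

Lemma bddM f g : bdd f -> bdd g -> bdd (fun t => f t * g t).
Proof.
move=> [mf [M M0 fM]] [mg [N N0 gN]]; split; first exact: cmeasM.
exists (M * N); first exact: mulr_ge0.
apply: filterS2 fM gN => x fM gN; rewrite /mag Normc.normcM.
by rewrite ler_pM// normc_ge0.
Qed.

Lemma bdd_pow (n : int) : bdd (circ_pow n).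
Proof.
apply: (@bdd_intro _ 1); first exact: cmeas_pow.
by move=> x; rewrite /mag /circ_pow expiXz normc_expi.
Qed.

Lemma bdd_cst (c : C) : bdd (fun=> c).
Proof. by apply: (@bdd_intro _ (nc c)) => //; exact: cmeas_cst. Qed.

(** Hoelder against the constant function 1, the circle having finite length. *)
Lemma Lp_L1 p : 1 < p -> exists2 K, 0 <= K &
  forall f, Lp p%:E f -> Lp 1%:E f /\ nrm 1 f <= K * nrm p f.
Proof.
move=> p1; pose q := (1 - p^-1)^-1.
have pi1 : p^-1 < 1 by rewrite invf_lt1//; lra.
have q1 : 1 <= q.
  rewrite /q -[leLHS]invr1 lef_pV2 ?posrE ?subr_gt0//.
  by rewrite gerBl invr_ge0; lra.
have L := bdd_Lp q1 (bdd_cst 1).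
exists (nrm q (fun=> 1)); first exact: nrm_ge0.
move=> f Lf; have p0 : 0 < p by lra.
have q0 : 0 < q by lra.
have pq : p^-1 + q^-1 = 1 by rewrite /q invrK addrC subrK.
have := hoelder_circ p0 q0 pq Lf L.
under eq_fun do rewrite mulr1.
by rewrite mulrC.
Qed.

Lemma circ_eq_refl f : circ_eq f f. Proof. exact: aeW. Qed.
Lemma circ_eq_sym f g : circ_eq f g -> circ_eq g f.
Proof. by apply: ae_imp. Qed.
Lemma Lp_ae p f g : 0 < p -> cmeas g -> Lp p%:E f -> circ_eq f g ->
  Lp p%:E g /\ nrm p g = nrm p f.
Proof.
move=> p0 mg Lf fg.
have [Lg le1] : Lp p%:E g /\ nrm p g <= nrm p f.
  by apply: Lp_le => //; apply: ae_imp fg => x e; rewrite /mag e.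
split => //; apply/eqP; rewrite eq_le le1/=.
have [] // := @Lp_le p f g p0 (Lp_cmeas Lf) Lg.
by apply: ae_imp fg => x e; rewrite /mag e.
Qed.

End LebesgueSpaces.

(** * Fourier coefficients, reflection and the flip J *)

Opaque Lp.

Section FourierCoefficients.
Context {R : realType}.
Local Notation C := R[i].
Local Notation F := (C -> C).
Local Notation T := (measurableTypeR R).
Local Notation mu := (@arc_length R).
Local Notation leb := (@lebesgue_measure R).
Implicit Types (f g h : F) (p q : R) (n k : int).

Lemma circ_int_ext f g : (forall x, f (expi x) = g (expi x)) -> circ_int f = circ_int g.
Proof.
move=> fg; rewrite /circ_int; congr Complex; apply: eq_Rintegral => x _; by rewrite fg.
Qed.

Lemma is_derive_mulr (k x : R) : is_derive x 1 ( *%R k : R -> R) k.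
Proof.
apply: (is_derive_eq (is_deriveZ k (is_derive_id x 1))).
by rewrite /GRing.scale /= mulr1.
Qed.

Lemma integral_cos (k : R) : k != 0 -> sin (k * (2 * pi)) = 0 ->
  (\int[leb]_(x in `[0%R, (2 * pi)%R]) (cos (k * x))%:E = 0)%E.
Proof.
move=> k0 s0.
have d (x : R) : is_derive x 1 (fun x => k^-1 * sin (k * x)) (cos (k * x)).
  have ds : is_derive (k * x) 1 (@sin R) (cos (k * x)) by exact: is_derive_sin.
  have := is_deriveZ k^-1 (is_derive1_comp ds (is_derive_mulr k x)).
  by rewrite /GRing.scale/= (mulrC (cos _)) mulrA mulVf// mul1r.
rewrite (@continuous_FTC2 _ _ (fun x => k^-1 * sin (k * x))).
- by rewrite s0 !mulr0 sin0 mulr0 subee.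
- exact: pi2_gt0.
- apply: continuous_subspaceT => x.
  by apply: continuous_comp; [exact: mulrl_continuous|exact: continuous_cos].
- have c : continuous (fun x : R => k^-1 * sin (k * x)).
    move=> x; apply: differentiable_continuous; apply/derivable1_diffP.
    by have [] := d x.
  split; first by move=> x _; have [] := d x.
  + by apply: cvg_at_right_filter; exact: c.
  + by apply: cvg_at_left_filter; exact: c.
- by move=> x _; rewrite derive1E; have [] := d x.
Qed.

Lemma integral_sin (k : R) : k != 0 -> cos (k * (2 * pi)) = 1 ->
  (\int[leb]_(x in `[0%R, (2 * pi)%R]) (sin (k * x))%:E = 0)%E.
Proof.
move=> k0 s0.
have d (x : R) : is_derive x 1 (fun x => - k^-1 * cos (k * x)) (sin (k * x)).
  have ds : is_derive (k * x) 1 (@cos R) (- sin (k * x)) by exact: is_derive_cos.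
  have := is_deriveZ (- k^-1) (is_derive1_comp ds (is_derive_mulr k x)).
  by rewrite /GRing.scale/= (mulrC (- sin _)) mulrA mulNr mulVf// mulN1r opprK.
rewrite (@continuous_FTC2 _ _ (fun x => - k^-1 * cos (k * x))).
- by rewrite s0 mulr0 cos0 subee.
- exact: pi2_gt0.
- apply: continuous_subspaceT => x.
  by apply: continuous_comp; [exact: mulrl_continuous|exact: continuous_sin].
- have c : continuous (fun x : R => - k^-1 * cos (k * x)).
    move=> x; apply: differentiable_continuous; apply/derivable1_diffP.
    by have [] := d x.
  split; first by move=> x _; have [] := d x.
  + by apply: cvg_at_right_filter; exact: c.
  + by apply: cvg_at_left_filter; exact: c.
- by move=> x _; rewrite derive1E; have [] := d x.
Qed.

Lemma circ_int_pow n : circ_int (circ_pow n) =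
  if n == 0 then ((2 * pi : R)%:C)%C else 0.
Proof.
have iT (u : T -> R) : measurable_fun setT u -> (forall x, `|u x| <= 1) ->
    \int[mu]_(x in setT) u x = fine (\int[leb]_(x in `[0%R, (2 * pi)%R]) (u x)%:E)%E.
  move=> m b; rewrite /Rintegral integral_arc_length//.
  exact: bounded_integrable m b.
have [mc ms] := continuous_cos_sin_comp (n%:~R : R).
rewrite /circ_int /circ_pow.
under eq_Rintegral do rewrite expiXz /=.
rewrite [X in Complex _ X](_ : _ = \int[mu]_(x in setT) sin (n%:~R * x)); last first.
  by apply: eq_Rintegral => x _; rewrite expiXz.
rewrite !iT//; [|by move=> x; exact: sin_max|by move=> x; exact: cos_max].
have [->|n0] := eqVneq n 0.
  congr Complex; under eq_integral do rewrite mul0r ?cos0 ?sin0.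
    rewrite integral_cst//= lebesgue_measure_itv/= lte_fin pi2_gt0 mul1e.
    by rewrite -EFinD subr0.
  by rewrite integral0.
have nR : n%:~R != 0 :> R by rewrite intr_eq0.
have e1 : expi (n%:~R * (2 * pi) : R) = 1 by rewrite -expiXz expi2pi exp1rz.
rewrite integral_cos//; last by case: e1.
by rewrite integral_sin//; case: e1.
Qed.

Lemma pi2C_neq0 : (Complex (2 * pi) 0 : C) != 0.
Proof. by rewrite eq_complex /= negb_and gt_eqF// pi2_gt0. Qed.

Lemma Lp_pow p f n : 1 <= p -> Lp p%:E f -> Lp p%:E (fun t => t ^ n * f t) /\
  nrm p (fun t => t ^ n * f t) = nrm p f.
Proof.
move=> p1 Lf; have p0 : 0 < p by lra.
rewrite -[nrm p f]mul1r; apply: Lp_scale => //.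
- by apply: cmeasM; [exact: cmeas_pow|exact: Lp_cmeas Lf].
- by move=> x; rewrite /mag Normc.normcM expiXz normc_expi mul1r.
Qed.

Lemma Lp_powr p f n : 1 <= p -> Lp p%:E f -> Lp p%:E (fun t => f t * t ^ n) /\
  nrm p (fun t => f t * t ^ n) = nrm p f.
Proof. by move=> p1 Lf; under eq_fun do rewrite mulrC; exact: Lp_pow. Qed.

Lemma fourier_ext f g n : (forall x, f (expi x) = g (expi x)) -> fourier f n = fourier g n.
Proof. by move=> fg; congr (_ * _); apply: circ_int_ext => x; rewrite fg. Qed.

Lemma fourierD f g n : Lp 1%:E f -> Lp 1%:E g ->
  fourier (fun t => f t + g t) n = fourier f n + fourier g n.
Proof.
move=> Lf Lg; rewrite /fourier -mulrDr -circ_intD.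
- by congr (_ * _); apply: circ_int_ext => x; rewrite mulrDl.
- exact: (Lp_powr _ (lexx _) Lf).1.
- exact: (Lp_powr _ (lexx _) Lg).1.
Qed.

Lemma fourierZ f (c : C) n : Lp 1%:E f -> fourier (fun t => c * f t) n = c * fourier f n.
Proof.
move=> Lf; rewrite /fourier mulrCA -(circ_intZ c (Lp_powr (- n) (lexx 1) Lf).1); congr (_ * _).
by apply: circ_int_ext => x; rewrite mulrA.
Qed.

Lemma fourierN f n : Lp 1%:E f -> fourier (fun t => - f t) n = - fourier f n.
Proof.
move=> Lf; by rewrite -mulN1r -fourierZ//; apply: fourier_ext => x; rewrite mulN1r.
Qed.

Lemma fourierB f g n : Lp 1%:E f -> Lp 1%:E g ->
  fourier (fun t => f t - g t) n = fourier f n - fourier g n.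
Proof.
move=> Lf Lg; rewrite fourierD ?fourierN//.
by have [] := LpN ltr01 Lg.
Qed.

Lemma fourier0 n : fourier (fun=> 0 : C) n = 0.
Proof.
have L1 := bdd_Lp (lexx 1) (@bdd_cst R 1).
rewrite (@fourier_ext _ (fun t => 0 * 1)); first by rewrite fourierZ// mul0r.
by move=> x; rewrite mul0r.
Qed.

Lemma fourier_ae f g n : cmeas f -> cmeas g -> circ_eq f g -> fourier f n = fourier g n.
Proof.
move=> mf mg fg; rewrite /fourier; congr (_ * _); apply: circ_int_ae.
- by apply: cmeasM => //; exact: cmeas_pow.
- by apply: cmeasM => //; exact: cmeas_pow.
- by apply: ae_imp fg => x ->.
Qed.

Lemma fourier_shift f k n : fourier (fun t => t ^ k * f t) n = fourier f (n - k).
Proof.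
congr (_ * _); apply: circ_int_ext => x.
by rewrite mulrAC mulrC -expfzDr ?expi_neq0// opprB.
Qed.

Lemma fourier_le f n : Lp 1%:E f -> nc (fourier f n) <= 2 * nrm 1 f.
Proof.
move=> Lf; rewrite /fourier Normc.normcM Normc.normcV normc_real.
have [L e] := Lp_powr (- n) (lexx 1) Lf.
apply: le_trans (_ : 1 * (2 * nrm 1 (fun t => f t * t ^ (- n))) <= _).
  apply: ler_pM; rewrite ?normc_ge0 ?invr_ge0//; last exact: circ_int_le.
  rewrite invf_le1 ?normr_gt0 ?gt_eqF ?pi2_gt0// ger0_norm ?(ltW pi2_gt0)//.
  by have := pi_ge2 R; lra.
by rewrite mul1r e.
Qed.

Lemma fourier_conj f n : Lp 1%:E f ->
  fourier (circ_conj f) n = conjc (fourier f (- n)).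
Proof.
move=> Lf; rewrite /fourier conjcM conjcV -circ_int_conj; last first.
  exact: (Lp_powr _ (lexx _) Lf).1.
have -> : conjc (Complex (2 * pi) 0) = (Complex (2 * pi) 0 : C) by rewrite /= oppr0.
congr (_ * _); apply: circ_int_ext => x; rewrite /circ_conj conjcM; congr (_ * _).
by rewrite opprK !expiXz conj_expi -expiN mulrNz mulNr.
Qed.

Lemma fourier_pow k n : fourier (circ_pow k : F) n = (n == k)%:R.
Proof.
rewrite /fourier.
rewrite (@circ_int_ext _ (circ_pow (k - n))); last first.
  by move=> x; rewrite /circ_pow -expfzDr ?expi_neq0.
rewrite circ_int_pow subr_eq0 eq_sym; case: eqP => _; last by rewrite mulr0.
by rewrite mulVf// pi2C_neq0.
Qed.

(** Trigonometric polynomials are lists of (coefficient, frequency) pairs, so that sums are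
    concatenations and the Riesz projection is a filter; repeated frequencies are harmless. *)
Definition teval (s : seq (C * int)) : F := fun t => \sum_(ck <- s) ck.1 * t ^ ck.2.

Lemma teval_nil : teval [::] = (fun=> 0).
Proof. by apply/funext => t; rewrite /teval big_nil. Qed.

Lemma teval_cons c s : teval (c :: s) = (fun t => c.1 * t ^ c.2 + teval s t).
Proof. by apply/funext => t; rewrite /teval big_cons. Qed.

Lemma bddD f g : bdd f -> bdd g -> bdd (fun t => f t + g t).
Proof.
move=> [mf [M M0 fM]] [mg [N N0 gN]]; split; first exact: cmeasD.
exists (M + N); first exact: addr_ge0.
apply: ae_imp2 fM gN => x fM gN; apply: le_trans (normcD _ _) _.
exact: lerD.
Qed.

Lemma bdd_teval s : bdd (teval s).
Proof.
elim: s => [|c s IH]; first by rewrite teval_nil; exact: bdd_cst.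
rewrite teval_cons; apply: bddD => //; apply: bddM; first exact: bdd_cst.
exact: bdd_pow.
Qed.

Lemma teval_bounded s : exists2 M, 0 <= M & forall x : R, nc (teval s (expi x)) <= M.
Proof.
elim: s => [|c s [M M0 IH]].
  by exists 0 => // x; rewrite teval_nil Normc.normc0.
exists (nc c.1 + M) => [|x]; first by rewrite addr_ge0// normc_ge0.
rewrite teval_cons; apply: le_trans (normcD _ _) _; apply: lerD => //.
by rewrite Normc.normcM expiXz normc_expi mulr1.
Qed.

Lemma Lp_teval p s : 1 <= p -> Lp p%:E (teval s).
Proof. by move=> p1; apply: bdd_Lp => //; exact: bdd_teval. Qed.

Lemma fourierM_teval f s n : Lp 1%:E f ->
  fourier (fun t => teval s t * f t) n = \sum_(ck <- s) ck.1 * fourier f (n - ck.2).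
Proof.
move=> Lf; elim: s => [|c s IH].
  rewrite teval_nil big_nil -[RHS](fourier0 n); apply: fourier_ext => x.
  by rewrite mul0r.
have [M _ Ls] := LpM_bdd (lexx 1) (bdd_teval s).
have [Lc _] := Lp_pow c.2 (lexx 1) Lf.
have [Lcc _] := LpZ c.1 ltr01 Lc.
rewrite big_cons -IH -fourier_shift -(fourierZ _ _ Lc) -(fourierD _ Lcc (Ls _ Lf).1).
by apply: fourier_ext => x; rewrite teval_cons mulrDl mulrA.
Qed.

Lemma fourier_teval s n : fourier (teval s) n = \sum_(ck <- s | ck.2 == n) ck.1.
Proof.
have L1 := bdd_Lp (lexx 1) (@bdd_cst R 1).
have -> : teval s = (fun t => teval s t * 1) by apply/funext => t; rewrite mulr1.
rewrite fourierM_teval// [RHS]big_mkcond; apply: eq_bigr => -[c k] _ /=.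
rewrite (_ : (fun=> 1) = circ_pow 0); last by apply/funext => t; rewrite /circ_pow expr0z.
rewrite fourier_pow subr_eq0 eq_sym.
by case: eqP => _; rewrite ?mulr1 ?mulr0.
Qed.

(** The map t -> t^-1 of the circle, read on the angle in [0, 2 pi]. *)
Definition refl : T -> T := fun x => 2 * pi - x.

Lemma measurable_refl : measurable_fun setT refl.
Proof. by apply: measurable_funB. Qed.

Lemma expi_refl (x : R) : expi (refl x) = (expi x)^-1.
Proof. by rewrite /refl expiD expi2pi mul1r expiN. Qed.

Lemma arc_length_refl (A : set T) : measurable A -> mu (refl @^-1` A) = mu A.
Proof.
have key (B : set T) : measurable B -> leb (refl @^-1` B) = leb B.
  move=> mB; apply/esym.
  apply: (@lebesgue_measure_unique _ (pushforward leb refl)) mB.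
    exact: measurable_refl.
  move=> mr _ [[a b]] _ <-; rewrite /pushforward.
  rewrite /= /pushforward.
  have -> : refl @^-1` `]a, b] = `[2 * pi - b, 2 * pi - a[%classic.
    apply/seteqP; split => x; rewrite /refl /= !in_itv /= => /andP[h1 h2];
      apply/andP; split; lra.
  rewrite !lebesgue_measure_itv /= !lte_fin.
  have -> : (2 * pi - b < 2 * pi - a) = (a < b) by rewrite ltrD2l ltrN2.
  by case: ifP => // _; rewrite -!EFinD; congr EFin; lra.
move=> mA; rewrite /arc_length /= /mrestr.
have -> : refl @^-1` A `&` `[0, 2 * pi] = refl @^-1` (A `&` `[0, 2 * pi]).
  apply/seteqP; split => x; rewrite /refl /= !in_itv /= => -[Ax /andP[h1 h2]];
    split => //; apply/andP; split; lra.
apply: key; apply: measurableI => //; exact: measurable_itv.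
Qed.

Lemma ae_refl (P : T -> Prop) : {ae mu, forall x, P x} -> {ae mu, forall x, P (refl x)}.
Proof.
move=> [N [mN N0 PN]]; exists (refl @^-1` N); split.
- by rewrite -[X in measurable X]setTI; exact: measurable_refl.
- by rewrite arc_length_refl.
- by move=> x nP; apply: PN.
Qed.

Lemma ge0_integral_refl (u : T -> \bar R) : measurable_fun setT u -> (forall x, 0 <= u x)%E ->
  (\int[mu]_x u (refl x) = \int[mu]_x u x)%E.
Proof.
move=> mu_ u0.
have := @ge0_integral_pushforward _ _ _ _ _ _ measurable_refl mu setT u measurableT mu_
   (fun x _ => u0 x).
rewrite preimage_setT => <-.
apply: eq_measure_integral => [|mr A mA _]; first exact: measurable_refl.
transitivity (mu (refl @^-1` A)); first by [].
exact: arc_length_refl.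
Qed.

Lemma integral_refl (u : T -> \bar R) : measurable_fun setT u ->
  mu.-integrable setT (u \o refl) ->
  (\int[mu]_x u (refl x) = \int[mu]_x u x)%E.
Proof.
move=> mu_ iu.
have := @integral_pushforward _ _ _ _ _ _ measurable_refl mu setT u mu_.
rewrite preimage_setT => /(_ iu measurableT) <-.
apply: eq_measure_integral => [|mr A mA _]; first exact: measurable_refl.
transitivity (mu (refl @^-1` A)); first by [].
exact: arc_length_refl.
Qed.

Lemma circ_tilde_refl f x : circ_tilde f (expi x) = f (expi (refl x)).
Proof. by rewrite expi_refl. Qed.

Lemma cmeas_tilde f : cmeas f -> cmeas (circ_tilde f).
Proof.
move=> [fr fi]; split; under eq_fun do rewrite circ_tilde_refl.
- exact: (measurableT_comp fr measurable_refl).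
- exact: (measurableT_comp fi measurable_refl).
Qed.

Lemma bdd_tilde f : bdd f -> bdd (circ_tilde f).
Proof.
move=> [mf [M M0 fM]]; split; first exact: cmeas_tilde.
by exists M => //; move: fM => /ae_refl; apply: ae_imp => x; rewrite /mag circ_tilde_refl.
Qed.

Lemma Lp_tilde p f : 0 < p -> Lp p%:E f ->
  Lp p%:E (circ_tilde f) /\ nrm p (circ_tilde f) = nrm p f.
Proof.
move=> p0 Lf.
have e : Lpnorm p%:E (circ_tilde f) = Lpnorm p%:E f.
  pose u : T -> \bar R := fun x => (`|(EFin \o mag f) x| `^ p)%E.
  have mu_ : measurable_fun setT u.
    apply: (measurableT_comp (measurable_poweR _)) => //.
    apply: measurableT_comp => //; apply/measurable_EFinP.
    by apply: measurable_mag; exact: Lp_cmeas Lf.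
  have := ge0_integral_refl mu_ (fun x => poweR_ge0 _ _).
  have ue x : u (refl x) = (`|(EFin \o mag (circ_tilde f)) x| `^ p)%E.
    by rewrite /u /= /mag circ_tilde_refl.
  under eq_integral do rewrite ue.
  by move=> e; rewrite !LpnormE unlock e.
split; last by rewrite /nrm e.
apply/LpP; split; first by apply: cmeas_tilde; exact: Lp_cmeas Lf.
by rewrite e; case: Lf.
Qed.

Lemma circ_int_tilde f : Lp 1%:E f -> circ_int (circ_tilde f) = circ_int f.
Proof.
move=> Lf; have [Lt _] := Lp_tilde ltr01 Lf; have [mr mi] := Lp_cmeas Lf.
rewrite /circ_int /Rintegral; congr Complex; congr fine.
- rewrite -[RHS]integral_refl; first by apply: eq_integral => x _; rewrite circ_tilde_refl.
  + exact/measurable_EFinP.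
  + have := Lp1_Re_integrable Lt; apply: eq_integrable => // x _.
    by rewrite circ_tilde_refl.
- rewrite -[RHS]integral_refl; first by apply: eq_integral => x _; rewrite circ_tilde_refl.
  + exact/measurable_EFinP.
  + have := Lp1_Im_integrable Lt; apply: eq_integrable => // x _.
    by rewrite circ_tilde_refl.
Qed.

Lemma fourier_tilde f n : Lp 1%:E f -> fourier (circ_tilde f) n = fourier f (- n).
Proof.
move=> Lf; rewrite /fourier opprK; congr (_ * _).
rewrite -[RHS]circ_int_tilde; last exact: (Lp_powr _ (lexx _) Lf).1.
apply: circ_int_ext => x; rewrite /circ_tilde; congr (_ * _).
by rewrite exprz_inv.
Qed.

Lemma Lp_flipJ p f : 1 <= p -> Lp p%:E f -> Lp p%:E (flipJ f) /\ nrm p (flipJ f) = nrm p f.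
Proof.
move=> p1 Lf; have p0 : 0 < p by lra.
have [Lt <-] := Lp_tilde p0 Lf.
by have := Lp_pow (-1) p1 Lt; under eq_fun do rewrite exprN1.
Qed.

(** J exchanges the frequencies n >= 0 and n < 0; this is what links H(b) to a Toeplitz
    operator. *)
Lemma fourier_flipJ f n : Lp 1%:E f -> fourier (flipJ f) n = fourier f (- n - 1).
Proof.
move=> Lf.
have -> : flipJ f = (fun t => t ^ (-1) * circ_tilde f t).
  by apply/funext => t; rewrite exprN1.
by rewrite fourier_shift fourier_tilde//; congr (fourier _ _); lia.
Qed.

Lemma flipJ_flipJ f x : flipJ (flipJ f) (expi x) = f (expi x).
Proof. by rewrite /flipJ invrK mulrA mulVf ?mul1r// expi_neq0. Qed.

End FourierCoefficients.

(** * Completeness of L^p *)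

Section Completeness.
Context {R : realType}.
Local Notation C := R[i].
Local Notation F := (C -> C).
Local Notation T := (measurableTypeR R).
Local Notation mu := (@arc_length R).
Variable p : R.
Hypothesis p1 : 1 <= p.

Let p0 : 0 < p. Proof. exact: lt_le_trans ltr01 p1. Qed.

Lemma LnormE_real (u : T -> R) : Lnorm mu p%:E (EFin \o u) =
  ((\int[mu]_x (`|u x| `^ p)%:E) `^ p^-1)%E.
Proof. by rewrite unlock. Qed.

Lemma measurable_abs_powR (u : T -> R) : measurable_fun setT u ->
  measurable_fun setT (fun x => (`|u x| `^ p)%:E).
Proof.
move=> mu_; apply/measurable_EFinP; apply: (measurableT_comp (measurable_powR _)) => //.
by apply: measurableT_comp.
Qed.

(** Norm estimates become estimates of integrals of p-th powers, for which monotone and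
    dominated convergence are available. *)
Lemma Lnorm_le_int (u : T -> R) (c : R) : 0 <= c ->
  (Lnorm mu p%:E (EFin \o u) <= c%:E)%E = (\int[mu]_x (`|u x| `^ p)%:E <= (c `^ p)%:E)%E.
Proof.
move=> c0; rewrite LnormE_real.
have i0 : (0 <= \int[mu]_x (`|u x| `^ p)%:E)%E.
  by apply: integral_ge0 => x _; rewrite lee_fin powR_ge0.
have pV : 0 < p^-1 by rewrite invr_gt0.
apply/idP/idP => h.
- rewrite -[leLHS]poweRe1// -(@mulVf _ p) ?gt_eqF// poweRrM.
  rewrite -poweR_EFin; apply: gt0_ler_poweR; rewrite ?(ltW p0)// in_itv/= ?leey ?andbT.
    exact: poweR_ge0.
  by rewrite lee_fin.
- have -> : c%:E = ((c `^ p)%:E `^ p^-1)%E.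
    by rewrite poweR_EFin -powRrM divff ?gt_eqF// powRr1.
  by apply: gt0_ler_poweR; rewrite ?(ltW pV)// in_itv/= ?leey ?andbT// lee_fin powR_ge0.
Qed.

Lemma measurable_sum_ord (d : nat -> T -> R) n : (forall j, measurable_fun setT (d j)) ->
  measurable_fun setT (fun x => (\sum_(j < n) d j x)%R).
Proof.
move=> md; elim: n => [|n IH].
  by under eq_fun do rewrite big_ord0; exact: measurable_cst.
by under eq_fun do rewrite big_ord_recr /=; exact: measurable_funD.
Qed.

Lemma Lnorm_sum_le (d : nat -> T -> R) (c : nat -> R) n :
  (forall j, measurable_fun setT (d j)) ->
  (forall j, (Lnorm mu p%:E (EFin \o d j) <= (c j)%:E)%E) ->
  (Lnorm mu p%:E (EFin \o (fun x => (\sum_(j < n) d j x)%R)) <= ((\sum_(j < n) c j)%R)%:E)%E.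
Proof.
move=> md dc; elim: n => [|n IH].
  rewrite big_ord0 (_ : EFin \o _ = cst 0%E); first by rewrite Lnorm0// eqe gt_eqF.
  by apply/funext => x /=; rewrite big_ord0.
rewrite big_ord_recr EFinD /=.
rewrite (_ : EFin \o _ = EFin \o ((fun x => (\sum_(j < n) d j x)%R) \+ d n)%R); last first.
  by apply/funext => x /=; rewrite big_ord_recr.
apply: le_trans (minkowski_EFin mu _ (md n) p1) _; last exact: leeD.
exact: measurable_sum_ord.
Qed.

Lemma sum_geometric_le (n : nat) : \sum_(j < n) 2^-1 ^+ j <= 2 :> R.
Proof.
suff -> : \sum_(j < n) 2^-1 ^+ j = 2 - 2 * 2^-1 ^+ n :> R.
  by rewrite gerBl mulr_ge0// exprn_ge0.
elim: n => [|n IH]; first by rewrite big_ord0 expr0 mulr1 subrr.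
by rewrite big_ord_recr /= IH exprS; field.
Qed.

(** The p-th power of the sum of the series of the d j, as a possibly infinite increasing
    limit. *)
Definition sumsup (d : nat -> T -> R) (x : T) : \bar R :=
  limn (fun n => ((\sum_(j < n) d j x) `^ p)%:E).

Lemma sumsup_homo (d : nat -> T -> R) x : (forall j, 0 <= d j x) ->
  {homo (fun n => ((\sum_(j < n) d j x) `^ p)%:E) : n m / (n <= m)%N >-> (n <= m)%E}.
Proof.
move=> d0 n m nm; rewrite lee_fin; apply: ge0_ler_powR; rewrite ?(ltW p0)// ?nnegrE ?sumr_ge0//.
rewrite -(subnKC nm) big_split_ord /= lerDl sumr_ge0//.
Qed.

Lemma le_sumsup (d : nat -> T -> R) x n : (forall j, 0 <= d j x) ->
  (((\sum_(j < n) d j x) `^ p)%:E <= sumsup d x)%E.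
Proof.
move=> d0; rewrite /sumsup.
rewrite (cvg_lim _ (ereal_nondecreasing_cvgn (sumsup_homo d0)))//.
by apply: ereal_sup_ubound; exists n.
Qed.

(** By Minkowski the partial sums of the d j have norm at most c (1 + 1/2 + 1/4 + ...) = 2
    c, and monotone convergence passes to the whole series. *)
Lemma integral_sumsup (d : nat -> T -> R) (c : R) : 0 <= c ->
  (forall j, measurable_fun setT (d j)) -> (forall j x, 0 <= d j x) ->
  (forall j, (Lnorm mu p%:E (EFin \o d j) <= (c * 2^-1 ^+ j)%:E)%E) ->
  (\int[mu]_x sumsup d x <= ((c * 2) `^ p)%:E)%E /\ measurable_fun setT (sumsup d).
Proof.
move=> c0 md d0 dc.
have mS n : measurable_fun [set: T] (fun x => ((\sum_(j < n) d j x) `^ p)%:E).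
  have := @measurable_abs_powR (fun x => \sum_(j < n) d j x) (measurable_sum_ord n md).
  by under eq_fun do rewrite ger0_norm ?sumr_ge0//.
split; last first.
  rewrite (_ : sumsup d = fun x => limn_esup (fun n => ((\sum_(j < n) d j x) `^ p)%:E)).
    exact: measurable_fun_limn_esup.
  apply/funext => x; rewrite is_cvg_limn_esupE//.
  exact: ereal_nondecreasing_is_cvgn (sumsup_homo (d0^~ x)).
rewrite /sumsup monotone_convergence//; last 2 first.
- by move=> n x _; rewrite lee_fin powR_ge0.
- by move=> x _; exact: sumsup_homo.
apply: lime_le.
  apply: ereal_nondecreasing_is_cvgn => n m nm; apply: ge0_le_integral => //.
  - by move=> x _; rewrite lee_fin powR_ge0.
  - by move=> x _; exact: sumsup_homo.
apply: nearW => n.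
have := Lnorm_sum_le n md dc; rewrite Lnorm_le_int; last first.
  by rewrite -mulr_sumr mulr_ge0// sumr_ge0// => j _; rewrite exprn_ge0.
have -> : (\int[mu]_x (`|(\sum_(j < n) d j x)%R| `^ p)%:E =
    \int[mu]_x ((\sum_(j < n) d j x)%R `^ p)%:E)%E.
  by apply: eq_integral => x _; rewrite ger0_norm ?sumr_ge0.
move=> h; apply: le_trans h _; rewrite lee_fin.
apply: ge0_ler_powR; rewrite ?(ltW p0)// ?nnegrE.
- by rewrite sumr_ge0// => j _; rewrite mulr_ge0// exprn_ge0.
- by rewrite mulr_ge0.
- by rewrite -mulr_sumr ler_wpM2l// sum_geometric_le.
Qed.

Lemma cvg_series_bounded (d : R ^nat) (B : R) : (forall j, 0 <= d j) ->
  (forall n, \sum_(j < n) d j <= B) -> cvgn (series d).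
Proof.
move=> d0 dB; apply: nondecreasing_is_cvgn.
  exact: nondecreasing_series.
by exists B => _ [n _ <-]; rewrite /series /= big_mkord.
Qed.

Lemma cvg_telescope (u d : R ^nat) : (forall n, `|u n.+1 - u n| <= d n) ->
  cvgn (series d) -> cvgn u.
Proof.
move=> ud cd.
have cs : cvgn (series (telescope u)).
  apply: normed_cvg; apply: (series_le_cvg _ _ ud cd) => // n; exact: le_trans (normr_ge0 _) (ud n).
have -> : u = (fun n => u 0%N + series (telescope u) n).
  by apply/funext => n; rewrite -eq_sum_telescope.
by apply: is_cvgD => //; exact: is_cvg_cst.
Qed.

Lemma normc_diff_sum (v : nat -> C) k n :
  nc (v (k + n)%N - v k) <= \sum_(j < n) nc (v (k + j).+1 - v (k + j)%N).
Proof.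
elim: n => [|n IH]; first by rewrite addn0 subrr Normc.normc0 big_ord0.
rewrite big_ord_recr /= addnS.
have -> : v (k + n).+1 - v k = (v (k + n)%N - v k) + (v (k + n).+1 - v (k + n)%N).
  by rewrite [RHS]addrC addrA subrK.
by apply: le_trans (normcD _ _) _; apply: lerD.
Qed.

(** The upper limit is used because it is measurable without any convergence assumption; it
    is the limit at almost every point for the sequences considered here. *)
Definition seqlim (v : nat -> F) : F := fun t =>
  Complex (fine (limn_esup (fun n => (complex.Re (v n t))%:E)))
          (fine (limn_esup (fun n => (complex.Im (v n t))%:E))).

Lemma cmeas_seqlim v : (forall n, cmeas (v n)) -> cmeas (seqlim v).
Proof.
move=> mv; split; rewrite /seqlim /=.
- apply: (measurableT_comp (fine_measurable _)) => //.
  by apply: measurable_fun_limn_esup => n; apply/measurable_EFinP; have [] := mv n.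
- apply: (measurableT_comp (fine_measurable _)) => //.
  by apply: measurable_fun_limn_esup => n; apply/measurable_EFinP; have [] := mv n.
Qed.

Lemma fine_limn_esup (u : R ^nat) : cvgn u -> fine (limn_esup (fun n => (u n)%:E)) = limn u.
Proof.
move=> cu.
have : (EFin \o u) x @[x --> \oo] --> (limn u)%:E by apply: cvg_EFin; [exact: nearW|exact: cu].
by move=> /cvg_limn_einf_sup[_ ->].
Qed.

Lemma seqlim_near (v : nat -> F) (t : C) (B : R) :
  (forall n, \sum_(j < n) nc (v j.+1 t - v j t) <= B) ->
  forall e, 0 < e -> \forall n \near \oo, nc (seqlim v t - v n t) < e.
Proof.
move=> vB e e0.
have cd := cvg_series_bounded (fun j => normc_ge0 (v j.+1 t - v j t)) vB.
have cr : cvgn (fun n => complex.Re (v n t)).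
  apply: cvg_telescope cd => n; rewrite -ReN -ReD; exact: normc_Re.
have ci : cvgn (fun n => complex.Im (v n t)).
  apply: cvg_telescope cd => n; rewrite -ImN -ImD; exact: normc_Im.
have e2 : 0 < e / 2 by rewrite divr_gt0.
have /cvgrPdist_lt/(_ _ e2) nr := cr.
have /cvgrPdist_lt/(_ _ e2) ni := ci.
near=> n.
apply: le_lt_trans (normc_le_ReIm _) _.
rewrite ReD ReN ImD ImN /seqlim /= !fine_limn_esup// (splitr e).
by apply: ltrD; near: n.
Unshelve. all: by end_near. Qed.

(** The Riesz-Fischer argument: the telescoping series of |v (k+1) - v k| has finite norm,
    hence converges almost everywhere, and its tails dominate |h - v k|. *)
Lemma Lp_complete (v : nat -> F) : (forall k, Lp p%:E (v k)) ->
  (forall k, nrm p (fun t => v k.+1 t - v k t) <= 2^-1 ^+ k) ->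
  exists2 h, Lp p%:E h & forall k, nrm p (fun t => h t - v k t) <= 2 * 2^-1 ^+ k.
Proof.
move=> Lv vle.
pose d j : T -> R := mag (fun t => v j.+1 t - v j t).
have LD j : Lp p%:E (fun t => v j.+1 t - v j t) by have [] := LpB p1 (Lv j.+1) (Lv j).
have md j : measurable_fun setT (d j) by apply: measurable_mag; exact: Lp_cmeas (LD j).
have d0 j x : 0 <= d j x by exact: mag_ge0.
have dk k j : (Lnorm mu p%:E (EFin \o d (k + j)%N) <= (2^-1 ^+ k * 2^-1 ^+ j)%:E)%E.
  by rewrite -LpnormE -nrmE// lee_fin -exprD.
have h0 : 0 <= 2^-1 :> R by rewrite invr_ge0.
have H k := @integral_sumsup (fun j => d (k + j)%N) (2^-1 ^+ k)
  (exprn_ge0 k h0) (fun j => md (k + j)%N) (fun j x => d0 (k + j)%N x) (dk k).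
have good : {ae mu, forall x, exists B, forall n, \sum_(j < n) d j x <= B}.
  have [i0 m0] := H 0%N.
  have s0 x : (0 <= sumsup (fun j => d (0 + j)%N) x)%E.
    by apply: le_trans (@le_sumsup (fun j => d (0 + j)%N) x 0%N (fun j => d0 (0 + j)%N x)); rewrite lee_fin powR_ge0.
  have int0 : mu.-integrable setT (sumsup (fun j => d (0 + j)%N)).
    apply/integrableP; split => //.
    under eq_integral do rewrite gee0_abs//.
    by apply: le_lt_trans i0 _; rewrite ltry.
  have := integrable_ae measurableT int0.
  apply: ae_imp => x /(_ I) fx.
  exists (fine (sumsup (fun j => d (0 + j)%N) x) `^ p^-1) => n.
  have h : (\sum_(j < n) d j x) `^ p <= fine (sumsup (fun j => d (0 + j)%N) x).
    by rewrite -lee_fin fineK//; exact: (@le_sumsup _ x n (fun j => d0 (0 + j)%N x)).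
  have -> : \sum_(j < n) d j x = ((\sum_(j < n) d j x) `^ p) `^ p^-1.
    by rewrite -powRrM divff ?gt_eqF// powRr1// sumr_ge0.
  by apply: ge0_ler_powR; rewrite ?invr_ge0 ?(ltW p0)// nnegrE ?powR_ge0 ?fine_ge0.
have mh : cmeas (seqlim v) by apply: cmeas_seqlim => n; exact: Lp_cmeas (Lv n).
have mhv k : cmeas (fun t => seqlim v t - v k t).
  by apply: cmeasD => //; apply: cmeasN; exact: Lp_cmeas (Lv k).
have key k : (Lpnorm p%:E (fun t => (seqlim v t - v k t)%R) <= (2 * 2^-1 ^+ k)%:E)%E.
  have [ik mk] := H k.
  rewrite LpnormE Lnorm_le_int ?mulr_ge0 ?exprn_ge0// mulrC.
  apply: le_trans ik; apply: ae_ge0_le_integral => //.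
  - by apply: measurable_abs_powR; exact: measurable_mag.
  - move=> x _; apply: le_trans (@le_sumsup (fun j => d (k + j)%N) x 0%N (fun j => d0 (k + j)%N x)).
    by rewrite lee_fin powR_ge0.
  apply: ae_imp good => x [B xB] _.
  have near_h := @seqlim_near v (expi x) B xB.
  rewrite (ger0_norm (mag_ge0 _ _)).
  have [fx|] := boolP (sumsup (fun j => d (k + j)%N) x \is a fin_num); last first.
    rewrite ge0_fin_numE.
      by rewrite -leNgt leye_eq => /eqP ->; rewrite leey.
    by apply: le_trans (@le_sumsup (fun j => d (k + j)%N) x 0%N (fun j => d0 (k + j)%N x)); rewrite lee_fin powR_ge0.
  have lek n := @le_sumsup (fun j => d (k + j)%N) x n (fun j => d0 (k + j)%N x).
  move: lek; rewrite -(fineK fx); set r := fine _ => lek.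
  have r0 : 0 <= r by rewrite -lee_fin; apply: le_trans (lek 0%N); rewrite lee_fin powR_ge0.
  have mag_le : mag (fun t => seqlim v t - v k t) x <= r `^ p^-1.
    apply/ler_addgt0Pr => e e0.
    have [N _ Ne] := near_h e e0.
    have {Ne} := Ne (k + N)%N (leq_addl _ _) => /= he.
    rewrite /mag.
    have -> : seqlim v (expi x) - v k (expi x) =
      (v (k + N)%N (expi x) - v k (expi x)) + (seqlim v (expi x) - v (k + N)%N (expi x)).
      by rewrite [RHS]addrC addrA subrK.
    apply: le_trans (normcD _ _) _; apply: lerD; last exact: ltW.
    apply: le_trans (normc_diff_sum (fun n => v n (expi x)) k N) _.
    have := lek N; rewrite lee_fin => h.
    have -> : \sum_(j < N) nc (v (k + j).+1 (expi x) - v (k + j)%N (expi x)) =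
        ((\sum_(j < N) d (k + j)%N x) `^ p) `^ p^-1.
      by rewrite -powRrM divff ?gt_eqF// powRr1// sumr_ge0.
    by apply: ge0_ler_powR; rewrite ?invr_ge0 ?(ltW p0)// nnegrE ?powR_ge0.
  rewrite lee_fin; have -> : r = (r `^ p^-1) `^ p.
    by rewrite -powRrM mulVf ?gt_eqF// powRr1.
  by apply: ge0_ler_powR; rewrite ?(ltW p0)// nnegrE ?powR_ge0// mag_ge0.
have Lhv k : Lp p%:E (fun t => seqlim v t - v k t).
  by apply/LpP; split => //; apply: le_lt_trans (key k) _; rewrite ltry.
exists (seqlim v).
  have [+ _] := LpD p1 (Lhv 0%N) (Lv 0%N).
  by under eq_fun do rewrite subrK.
by move=> k; rewrite -lee_fin nrmE.
Qed.

End Completeness.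

(** * Trigonometric polynomials and dominated limits *)

Section Density.
Context {R : realType}.
Local Notation C := R[i].
Local Notation F := (C -> C).
Local Notation T := (measurableTypeR R).
Local Notation mu := (@arc_length R).

(** Real-valued trigonometric polynomials, as functions of the angle. *)
Definition rtrig (w : R -> R) := exists s, forall x : R, teval s (expi x) = ((w x)%:C)%C.

Lemma teval_cat (s1 s2 : seq (C * int)) t : teval (s1 ++ s2) t = teval s1 t + teval s2 t.
Proof. by rewrite /teval big_cat. Qed.

Lemma teval_mul (s1 s2 : seq (C * int)) x :
  teval [seq (a.1 * b.1, a.2 + b.2) | a <- s1, b <- s2] (expi x) =
  teval s1 (expi x) * teval s2 (expi x).
Proof.
rewrite /teval big_allpairs_dep mulr_suml; apply: eq_bigr => a _.
rewrite mulr_sumr; apply: eq_bigr => b _ /=.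
by rewrite expfzDr ?expi_neq0// mulrACA.
Qed.

Lemma teval_scale (c : C) s t : teval [seq (c * a.1, a.2) | a <- s] t = c * teval s t.
Proof.
by rewrite /teval big_map mulr_sumr; apply: eq_bigr => a _ /=; rewrite mulrA.
Qed.

Lemma rtrig_cst c : rtrig (fun=> c).
Proof. by exists [:: ((c%:C)%C, 0)] => x; rewrite /teval big_seq1 expr0z mulr1. Qed.

Lemma rtrigD w v : rtrig w -> rtrig v -> rtrig (fun x => w x + v x).
Proof.
by move=> [s hs] [s' hs']; exists (s ++ s') => x; rewrite teval_cat hs hs' rmorphD.
Qed.

Lemma rtrigM w v : rtrig w -> rtrig v -> rtrig (fun x => w x * v x).
Proof.
move=> [s hs] [s' hs'].
by exists [seq (a.1 * b.1, a.2 + b.2) | a <- s, b <- s'] => x; rewrite teval_mul hs hs' rmorphM.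
Qed.

Lemma rtrigX w n : rtrig w -> rtrig (fun x => w x ^+ n).
Proof.
move=> hw; elim: n => [|n IH]; first exact: rtrig_cst.
under eq_fun do rewrite exprS; exact: rtrigM.
Qed.

Lemma rtrigB w v : rtrig w -> rtrig v -> rtrig (fun x => w x - v x).
Proof.
move=> hw hv; have := rtrigD hw (rtrigM (rtrig_cst (-1)) hv).
by under eq_fun do rewrite mulN1r.
Qed.

Lemma rtrig_cos m : rtrig (fun x => cos (x - m)).
Proof.
exists [:: ((2^-1%:C)%C * expi (- m), 1); ((2^-1%:C)%C * expi m, -1)] => x.
rewrite /teval big_cons big_seq1 /= expr1z exprN1 -expiN -!mulrA -!expiD -mulrDr.
have -> : m - x = - (x - m) by lra.
rewrite (addrC (- m)); apply: complex_ext; rewrite ?ReM ?ImM /= cosN sinN; lra.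
Qed.

Lemma rtrig_bounded w : rtrig w ->
  measurable_fun [set: T] w /\ exists2 M, 0 <= M & forall x, `|w x| <= M.
Proof.
move=> [s hs].
have e : w = (fun x => complex.Re (teval s (expi x))) by apply/funext => x; rewrite hs.
split; first by rewrite e; have [[]] := bdd_teval s.
have [M M0 sM] := teval_bounded s.
by exists M => // x; rewrite e; apply: le_trans (normc_Re _) (sM x).
Qed.

Lemma ae_neq (a : R) : {ae mu, forall x, x != a}.
Proof.
exists [set a]; split; first exact: measurable_set1.
- apply/eqP; rewrite -measure_le0.
  apply: (@le_trans _ _ (lebesgue_measure [set a])); last by rewrite lebesgue_measure_set1.
  rewrite /arc_length /= /mrestr; apply: le_measure; rewrite ?inE//.
  by apply: measurableI => //; exact: measurable_itv.
- by move=> x /= /negP; rewrite negbK => /eqP.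
Qed.

Lemma cvg_geometric_bound (u : nat -> R) (l r : R) : 0 <= r < 1 ->
  (forall n, `|u n - l| <= r ^+ n) -> u n @[n --> \oo] --> l.
Proof.
move=> /andP[r0 r1] h; apply/cvgrPdist_lt => e e0.
have hr : `|r| < 1 by rewrite ger0_norm.
have /cvgrPdist_lt/(_ _ e0) := cvg_expr hr.
apply: filterS => n; rewrite sub0r normrN ger0_norm ?exprn_ge0// distrC.
exact: le_lt_trans (h n).
Qed.

Lemma bernoulli_sub (z : R) m : 0 <= z <= 1 -> 1 - m%:R * z <= (1 - z) ^+ m.
Proof.
move=> /andP[z0 z1]; elim: m => [|m IH]; first by rewrite mul0r subr0 expr0.
rewrite exprS; apply: le_trans (_ : (1 - z) * (1 - m%:R * z) <= _).
  rewrite mulrSr; have : 0 <= m%:R * z * z by rewrite !mulr_ge0.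
  by move: (m%:R) => k h; nra.
by apply: ler_wpM2l => //; rewrite subr_ge0.
Qed.

Lemma bernoulli_add (z : R) m : 0 <= z -> 1 + m%:R * z <= (1 + z) ^+ m.
Proof.
move=> z0; elim: m => [|m IH]; first by rewrite mul0r addr0 expr0.
rewrite exprS; apply: le_trans (_ : (1 + z) * (1 + m%:R * z) <= _).
  rewrite mulrSr; have : 0 <= m%:R * z * z by rewrite !mulr_ge0.
  by move: (m%:R) => k h; nra.
by apply: ler_wpM2l => //; rewrite addr_ge0.
Qed.

(** These polynomials converge on [0, 1] to the indicator of [0, 1/2), except at 1/2: since
    they are polynomials, they send trigonometric polynomials to trigonometric polynomials. *)
Definition step_poly (n : nat) (y : R) : R := (1 - y ^+ n) ^+ (2 ^ n)%N.

Lemma step_poly_01 n y : 0 <= y <= 1 -> 0 <= step_poly n y <= 1.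
Proof.
move=> /andP[y0 y1].
have h0 : 0 <= y ^+ n by rewrite exprn_ge0.
have h1 : y ^+ n <= 1 by rewrite exprn_ile1.
by rewrite /step_poly exprn_ge0 ?exprn_ile1//; lra.
Qed.

Lemma step_poly_lt y : 0 <= y < 2^-1 -> step_poly n y @[n --> \oo] --> (1 : R).
Proof.
move=> /andP[y0 y1].
apply: (@cvg_geometric_bound _ _ (2 * y)) => [|n]; first by apply/andP; split; lra.
have y01 : 0 <= y <= 1 by apply/andP; split; lra.
have /andP[s0 s1] := step_poly_01 n y01.
rewrite ler0_norm ?subr_le0// opprB.
have yn01 : 0 <= y ^+ n <= 1 by rewrite exprn_ge0// exprn_ile1//; lra.
have := bernoulli_sub (2 ^ n)%N yn01.
by rewrite -/(step_poly n y) natrX exprMn; lra.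
Qed.

Lemma step_poly_gt y : 2^-1 < y <= 1 -> step_poly n y @[n --> \oo] --> (0 : R).
Proof.
move=> /andP[y0 y1].
have yp : 0 < y by lra.
apply: (@cvg_geometric_bound _ _ ((2 * y)^-1)) => [|n].
  by apply/andP; split; [rewrite invr_ge0; lra|rewrite invf_lt1; lra].
have y01 : 0 <= y <= 1 by apply/andP; split; lra.
have /andP[s0 s1] := step_poly_01 n y01.
rewrite subr0 ger0_norm// exprVn -[leRHS]mul1r ler_pdivlMr; last by rewrite exprn_gt0//; lra.
have yn0 : 0 <= y ^+ n by rewrite exprn_ge0//; lra.
have yn1 : y ^+ n <= 1 by rewrite exprn_ile1//; lra.
have h := bernoulli_add (2 ^ n)%N yn0.
apply: le_trans (_ : step_poly n y * (1 + y ^+ n) ^+ (2 ^ n)%N <= _).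
  by apply: ler_wpM2l => //; apply: le_trans h; rewrite natrX exprMn; lra.
rewrite /step_poly -exprMn -subr_sqr expr1n exprn_ile1//; last by rewrite gerBl sqr_ge0.
by rewrite subr_ge0 expr_le1.
Qed.

(** A linear class of functions that contains the trigonometric polynomials and is closed under
    bounded almost everywhere limits contains all indicators. This serves twice: for the
    functions approximable in L^p, and for those orthogonal to a given function. *)
Section TrigClass.
Variable V : (R -> R) -> Prop.
Hypothesis V_trig : forall w, rtrig w -> V w.
Hypothesis V_lin : forall c u v, V u -> V v -> V (fun x => c * u x + v x).
Hypothesis V_lim : forall (u_ : nat -> R -> R) (u : R -> R) (M : R),
  (forall n, measurable_fun [set: T] (u_ n)) -> measurable_fun [set: T] u ->
  (forall n x, `|u_ n x| <= M) -> (forall x, `|u x| <= M) ->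
  {ae mu, forall x, u_ n x @[n --> \oo] --> u x} ->
  (forall n, V (u_ n)) -> V u.

Lemma indic_le1 (A : set T) (x : T) : `|\1_A x : R| <= 1.
Proof. by rewrite indicE; case: (_ \in _); rewrite /= ?normr1 ?normr0. Qed.

(** The trigonometric polynomial sin (x/2) sin ((a - x)/2) is positive on (0, a) and
    negative on (a, 2 pi); step_poly turns it into the indicator of an arc in the limit. *)
Lemma V_indic_halfline (a : R) : V (\1_(`]-oo, a[%classic : set T) : T -> R).
Proof.
have mA : measurable_fun [set: T] (\1_(`]-oo, a[%classic : set T) : T -> R).
  by apply: measurable_indic; exact: measurable_itv.
have indE (x : T) : (\1_(`]-oo, a[%classic : set T) x : R) = ((x : R) < a)%R%:R.
  by rewrite indicE; congr (nat_of_bool _)%:R; apply/idP/idP;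
    rewrite ?inE /= in_itv.
have [a0|a0] := leP a 0.
  apply: (@V_lim (fun _ _ => 0) _ 1) => //.
  - by move=> n x; rewrite normr0.
  - exact: indic_le1.
  - apply: arc_length_ae => x /andP[x0 _]; rewrite indE ltNge (le_trans a0)//.
    exact: cvg_cst.
  - by move=> n; apply: V_trig; exact: rtrig_cst.
have [a2|a2] := leP (2 * pi) a.
  apply: (@V_lim (fun _ _ => 1) _ 1) => //.
  - by move=> n x; rewrite normr1.
  - exact: indic_le1.
  - have h1 : {ae mu, forall x, x <= 2 * pi} by apply: arc_length_ae => x /andP[].
    apply: ae_imp2 h1 (ae_neq (2 * pi)) => x x2 xn.
    rewrite indE lt_neqAle (le_trans x2)// andbT.
    have -> : x != a by rewrite lt_eqF// (lt_le_trans _ a2)// lt_neqAle xn.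
    exact: cvg_cst.
  - by move=> n; apply: V_trig; exact: rtrig_cst.
pose phi (x : R) := sin (x / 2) * sin ((a - x) / 2).
have phiE x : phi x = (cos (x - a / 2) - cos (a / 2)) * 2^-1.
  rewrite /phi; have -> : x - a / 2 = x / 2 - (a - x) / 2 by lra.
  have -> : a / 2 = x / 2 + (a - x) / 2 by lra.
  by rewrite cosB cosD; lra.
pose y x := (1 - phi x) * 2^-1.
have y01 x : 0 <= y x <= 1.
  have : `|phi x| <= 1 by rewrite /phi normrM mulr_ile1// sin_max.
  by rewrite ler_norml /y => /andP[h1 h2]; apply/andP; split; lra.
have ty : rtrig y.
  apply: rtrigM; last exact: rtrig_cst.
  apply: rtrigB; first exact: rtrig_cst.
  rewrite (_ : phi = fun x => (cos (x - a / 2) - cos (a / 2)) * 2^-1); last exact/funext.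
  apply: rtrigM; last exact: rtrig_cst.
  by apply: rtrigB; [exact: rtrig_cos|exact: rtrig_cst].
have tw n : rtrig (fun x => step_poly n (y x)).
  by apply: rtrigX; apply: rtrigB; [exact: rtrig_cst|exact: rtrigX].
apply: (@V_lim (fun n x => step_poly n (y x)) _ 1) => //.
- by move=> n; have [] := rtrig_bounded (tw n).
- by move=> n x; have /andP[h1 h2] := step_poly_01 n (y01 x); rewrite ger0_norm.
- exact: indic_le1.
- have h1 : {ae mu, forall x, 0 <= x <= 2 * pi} by exact: arc_length_ae.
  apply: ae_imp2 h1 (ae_imp2 (fun x h1 h2 => conj h1 h2)
     (ae_neq a) (ae_imp2 (fun x h1 h2 => conj h1 h2) (ae_neq 0) (ae_neq (2 * pi)))).
  move=> x /andP[x0 x2] [xa [xn0 xn2]]; rewrite indE.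
  have s1 : 0 < sin (x / 2).
    apply: sin_gt0_pi; have : 0 < x by rewrite lt_neqAle eq_sym xn0.
    have : x < 2 * pi by rewrite lt_neqAle xn2.
    by move=> h2 h3; apply/andP; split; lra.
  have [xla|xla] := ltP x a.
    apply: step_poly_lt; have /andP[-> _] /= := y01 x.
    have : 0 < phi x.
      apply: mulr_gt0 => //; apply: sin_gt0_pi; apply/andP; split; lra.
    by rewrite /y; lra.
  apply: step_poly_gt; have /andP[_ ->] := y01 x; rewrite andbT.
  have : phi x < 0.
    rewrite /phi pmulr_rlt0//.
    have -> : (a - x) / 2 = - ((x - a) / 2) by lra.
    rewrite sinN oppr_lt0; apply: sin_gt0_pi.
    have xa' : a < x by rewrite lt_neqAle eq_sym xa.
    by apply/andP; split; lra.
  by rewrite /y; lra.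
- by move=> n; exact: V_trig.
Qed.

(** Half-lines are stable under intersection and generate the Borel sets, so that the
    Dynkin class argument applies. *)
Lemma V_indic (A : set T) : measurable A -> V (\1_A : T -> R).
Proof.
move=> mA.
have mE : @measurable _ T = <<s @RGenInftyO.G R >> by exact: RGenInftyO.measurableE.
move: mA; rewrite mE.
apply: (@dynkin_induction _ T (@RGenInftyO.G R) (fun S => V (\1_S : T -> R)) mE).
- move=> _ _ [x ->] [y ->]; exists (Num.min x y).
  apply/seteqP; split => z /=; rewrite !in_itv/= lt_min; first by move=> [-> ->].
  by move=> /andP[].
- by rewrite indicT; apply: V_trig; exact: rtrig_cst.
- by move=> _ [x ->]; exact: V_indic_halfline.
- move=> S mS VS.
  have := V_lin (-1) VS (V_trig (rtrig_cst 1)).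
  congr V; apply/funext => x; rewrite !indicE in_setC.
  by case: (_ \in _) => /=; ring.
- move=> S mS tS VS.
  pose G n := \bigcup_(k in [set k | (k < n)%N]) S k.
  have mG n : measurable (G n : set T) by apply: bigcup_measurable => k _.
  have GS n x : \1_(G n.+1) x = 1 * \1_(G n) x + \1_(S n) x :> R.
    rewrite mul1r !indicE; have [xS|xS] := pselect (S n x).
      rewrite [x \in S n]mem_set// [x \in G n]memNset ?add0r; last first.
        move=> [k /= kn Sk]; move/trivIsetP : tS => /(_ k n I I).
        by rewrite (ltn_eqF kn) => /(_ isT)/seteqP[+ _]; apply; split; [exact: Sk|exact: xS].
      by rewrite mem_set//; exists n => /=.
    rewrite [x \in S n]memNset// addr0; congr (nat_of_bool _)%:R.
    apply/idP/idP; rewrite !inE => -[k /= kn Sk].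
      exists k => //=; rewrite ltn_neqAle -ltnS kn andbT.
      by apply: contra_notN xS => /eqP <-.
    by exists k => //=; exact: ltnW.
  have VG n : V (\1_(G n) : T -> R).
    elim: n => [|n IH].
      have -> : (\1_(G 0%N) : T -> R) = (fun=> 0).
        by apply/funext => x; rewrite indicE memNset// => -[].
      by apply: V_trig; exact: rtrig_cst.
    rewrite (_ : \1_ _ = fun x => 1 * \1_(G n) x + \1_(S n) x); last exact/funext.
    exact: V_lin.
  apply: (@V_lim (fun n => \1_(G n)) _ 1) => //.
  - by apply: measurable_indic; exact: bigcupT_measurable.
  - by move=> n x; exact: indic_le1.
  - exact: indic_le1.
  - apply: aeW => x; have [[k _ Sk]|nS] := pselect ((\bigcup_k S k) x).
      apply: cvg_near_cst; exists k.+1 => // n /= kn.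
      by rewrite !indicE !mem_set//; exists k.
    rewrite indicE memNset//; apply: cvg_near_cst; apply: nearW => n.
    by rewrite indicE memNset// => -[k _ Sk]; apply: nS; exists k.
Qed.

End TrigClass.

End Density.

(** * Density of trigonometric polynomials and uniqueness of Fourier coefficients *)

Section TrigApproximation.
Import HBNNSimple.
Context {R : realType}.
Local Notation C := R[i].
Local Notation F := (C -> C).
Local Notation T := (measurableTypeR R).
Local Notation mu := (@arc_length R).

Section RealApproximation.
Variable p : R.
Hypothesis p1 : 1 <= p.

Let p0 : 0 < p. Proof. exact: lt_le_trans ltr01 p1. Qed.

Definition trig_approx (u : R -> R) := measurable_fun [set: T] u /\
  forall e, 0 < e -> exists w, rtrig w /\
    (Lnorm mu p%:E (EFin \o (fun x => u x - w x)%R) <= e%:E)%E.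

Lemma trig_approx_rtrig w : rtrig w -> trig_approx w.
Proof.
move=> tw; split; first by have [] := rtrig_bounded tw.
move=> e e0; exists w; split => //.
rewrite (_ : EFin \o _ = cst 0%E); first by rewrite Lnorm0 ?lee_fin ?(ltW e0)// eqe gt_eqF.
by apply/funext => x /=; rewrite subrr.
Qed.

Lemma Lnorm_addb (u v : T -> R) (e1 e2 : R) : measurable_fun setT u -> measurable_fun setT v ->
  (Lnorm mu p%:E (EFin \o u) <= e1%:E)%E -> (Lnorm mu p%:E (EFin \o v) <= e2%:E)%E ->
  (Lnorm mu p%:E (EFin \o (fun x => u x + v x)%R) <= (e1 + e2)%:E)%E.
Proof.
move=> mu_ mv h1 h2; rewrite EFinD; apply: le_trans (leeD h1 h2).
exact: (minkowski_EFin mu mu_ mv p1).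
Qed.

Lemma Lnorm_scaleb (u : T -> R) (c e : R) : measurable_fun setT u -> 0 <= e ->
  (Lnorm mu p%:E (EFin \o u) <= e%:E)%E ->
  (Lnorm mu p%:E (EFin \o (fun x => c * u x)%R) <= (`|c| * e)%:E)%E.
Proof.
move=> mu_ e0; rewrite !(Lnorm_le_int p1) ?mulr_ge0// => h.
have -> : (\int[mu]_x (`|(c * u x)%R| `^ p)%:E = (`|c| `^ p)%:E * \int[mu]_x (`|u x| `^ p)%:E)%E.
  rewrite -ge0_integralZl//; last by exact: measurable_abs_powR.
  by apply: eq_integral => x _; rewrite -EFinM normrM powRM.
by rewrite powRM// EFinM lee_wpmul2l// lee_fin powR_ge0.
Qed.

Lemma trig_approx_lin c u v : trig_approx u -> trig_approx v ->
  trig_approx (fun x => c * u x + v x).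
Proof.
move=> [mu_ hu] [mv hv]; split.
  by apply: measurable_funD => //; apply: measurable_funM.
move=> e e0.
have c0 : 0 < `|c| + 1 by rewrite ltr_wpDl.
have [w [tw hw]] := hu (e / (2 * (`|c| + 1))) (divr_gt0 e0 (mulr_gt0 (ltr0Sn _ 1) c0)).
have [w' [tw' hw']] := hv (e / 2) (divr_gt0 e0 (ltr0Sn _ 1)).
exists (fun x => c * w x + w' x); split.
  by apply: rtrigD => //; apply: rtrigM => //; exact: rtrig_cst.
have [mw _] := rtrig_bounded tw; have [mw' _] := rtrig_bounded tw'.
have -> : (fun x => c * u x + v x - (c * w x + w' x)) =
   (fun x => c * (u x - w x) + (v x - w' x)).
  by apply/funext => x; ring.
have m1 : measurable_fun [set: T] (fun x => u x - w x) by exact: measurable_funB.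
have m2 : measurable_fun [set: T] (fun x => v x - w' x) by exact: measurable_funB.
have h1 := Lnorm_scaleb c m1 (ltW (divr_gt0 e0 (mulr_gt0 (ltr0Sn _ 1) c0))) hw.
have m3 : measurable_fun [set: T] (fun x => c * (u x - w x)) by exact: measurable_funM.
apply: le_trans (Lnorm_addb m3 m2 h1 hw') _.
rewrite lee_fin {3}(splitr e) lerD2r mulrA ler_pdivrMr ?mulr_gt0//.
have -> : e / 2 * (2 * (`|c| + 1)) = (`|c| + 1) * e by field.
by rewrite ler_pM2r// lerDl.
Qed.

(** Dominated convergence applied to |u - u_n|^p, which is bounded by (2 |G|)^p. *)
Lemma cvg_Lnorm (u_ : nat -> T -> R) (u G : T -> R) :
  (forall n, measurable_fun setT (u_ n)) -> measurable_fun setT u ->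
  (forall n x, `|u_ n x| <= G x) -> (forall x, `|u x| <= G x) ->
  measurable_fun setT G ->
  (\int[mu]_x (`|G x| `^ p)%:E < +oo)%E ->
  {ae mu, forall x, u_ n x @[n --> \oo] --> u x} ->
  forall e, 0 < e -> exists n, (Lnorm mu p%:E (EFin \o (fun x => u x - u_ n x)%R) <= e%:E)%E.
Proof.
move=> mu_ mu0 uG uG' mG iG cu e e0.
pose f_ n x := (`|u x - u_ n x| `^ p)%:E.
have mf n : measurable_fun [set: T] (f_ n).
  by apply: measurable_abs_powR; exact: measurable_funB.
have h := @dominated_convergence _ T R mu setT measurableT f_ (cst 0%E)
  (fun x => (((2 * `|G x|)%R `^ p)%:E)).
have [] := h.
- exact: mf.
- exact: measurable_cst.
- apply: ae_imp cu => x cu _.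
  apply/cvg_EFin; first exact: nearW.
  apply/cvgrPdist_lt => d d0.
  have dm : 0 < Num.min d 1 by rewrite lt_min d0 ltr01.
  have /cvgrPdist_lt/(_ _ dm) := cu.
  apply: filterS => n; rewrite lt_min => /andP[h1 h2].
  rewrite /= sub0r normrN ger0_norm ?powR_ge0//.
  apply: le_lt_trans h1.
  have [->|ne] := eqVneq (u x - u_ n x) 0; first by rewrite normr0 powR0// gt_eqF.
  rewrite -[leRHS](powRr1 (normr_ge0 _)).
  apply: ger_powR => //; rewrite normr_gt0 ne/=.
  exact: ltW.
- have -> : (fun x => (((2 * `|G x|)%R `^ p)%:E)) =
      (fun x => (2 `^ p)%:E * (`|G x| `^ p)%:E)%E.
    by apply/funext => x; rewrite powRM// EFinM.
  apply: integrableZl => //; apply/integrableP; split; first exact: measurable_abs_powR.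
  by under eq_integral do rewrite gee0_abs ?lee_fin ?powR_ge0//.
- apply: aeW => x n _; rewrite /f_ gee0_abs ?lee_fin ?powR_ge0//.
  apply: ge0_ler_powR; rewrite ?(ltW p0)// ?nnegrE ?mulr_ge0//.
  apply: le_trans (ler_normB _ _) _; rewrite mulr_natl mulr2n.
  by apply: lerD; apply: le_trans (ler_norm _).
move=> _ _ /=; rewrite integral0 => cI.
have ep : 0 < e `^ p by rewrite powR_gt0.
have /fine_cvgP[nfin /cvgrPdist_lt/(_ _ ep) nlt] := cI.
have [n [fn ln]] : exists n, (\int[mu]_x f_ n x)%E \is a fin_num /\
    `|0 - fine (\int[mu]_x f_ n x)%E| < e `^ p.
  have := filterI nfin nlt => -[n _ /(_ n (leqnn n))[h1 h2]].
  by exists n.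
exists n; rewrite (Lnorm_le_int p1) ?(ltW e0)//.
rewrite -[leLHS](fineK fn) lee_fin; apply: le_trans (ltW ln).
by rewrite sub0r normrN ler_norm.
Qed.

Lemma trig_approx_lim (u_ : nat -> R -> R) (u G : R -> R) :
  measurable_fun [set: T] u -> measurable_fun [set: T] G ->
  (forall n x, `|u_ n x| <= G x) -> (forall x, `|u x| <= G x) ->
  (\int[mu]_x (`|G x| `^ p)%:E < +oo)%E ->
  {ae mu, forall x, u_ n x @[n --> \oo] --> u x} ->
  (forall n, trig_approx (u_ n)) -> trig_approx u.
Proof.
move=> mu0 mG uG uG' iG cu ta; split => // e e0.
have e2 : 0 < e / 2 by rewrite divr_gt0.
have mu_ n : measurable_fun [set: T] (u_ n) by have [] := ta n.
have [n hn] := cvg_Lnorm mu_ mu0 uG uG' mG iG cu e2.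
have [_ /(_ _ e2)[w [tw hw]]] := ta n.
have [mw _] := rtrig_bounded tw.
exists w; split => //.
rewrite (splitr e).
have -> : (fun x => u x - w x) = (fun x => (u x - u_ n x) + (u_ n x - w x)).
  by apply/funext => x; rewrite addrA subrK.
by apply: Lnorm_addb => //; exact: measurable_funB.
Qed.

Lemma trig_approx_indic (A : set T) : measurable A -> trig_approx (\1_A : T -> R).
Proof.
apply: V_indic.
- exact: trig_approx_rtrig.
- exact: trig_approx_lin.
- move=> u_ u M mu_ mu0 uM uM' cu ta.
  apply: (@trig_approx_lim u_ u (fun=> M)) => //.
  rewrite integral_cst// ltey_eq; apply/orP; left.
  by rewrite fin_numM// ge0_fin_numE// arc_length_lty.
Qed.

Lemma trig_approx_sum (I : Type) (r : seq I) (c : I -> R) (A : I -> set T) :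
  (forall i, measurable (A i)) ->
  trig_approx (fun x => \sum_(i <- r) c i * \1_(A i) x).
Proof.
move=> mA; elim: r => [|i r IH].
  rewrite (_ : (fun=> _) = fun=> 0); first by apply: trig_approx_rtrig; exact: rtrig_cst.
  by apply/funext => x; rewrite big_nil.
under eq_fun do rewrite big_cons.
by apply: trig_approx_lin => //; exact: trig_approx_indic.
Qed.

Lemma trig_approx_simple (f : {nnsfun T >-> R}) : trig_approx (f : T -> R).
Proof.
have -> : (f : T -> R) = (fun x => \sum_(i < size (finmap.enum_fset (fset_set (range f))))
   (finmap.enum_fset (fset_set (range f)))`_i *
   \1_(f @^-1` [set (finmap.enum_fset (fset_set (range f)))`_i]) x).
  by apply/funext => x; rewrite -fimfunEord.
by apply: trig_approx_sum => i.
Qed.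

Lemma trig_approx_ge0 (u : R -> R) : measurable_fun [set: T] u -> (forall x, 0 <= u x) ->
  (\int[mu]_x (`|u x| `^ p)%:E < +oo)%E -> trig_approx u.
Proof.
move=> mu0 u0 iu.
have mE : measurable_fun [set: T] (EFin \o u) by exact/measurable_EFinP.
have u0' (x : T) : [set: T] x -> (0 <= (EFin \o u) x)%E by rewrite lee_fin.
apply: (@trig_approx_lim (fun n => (nnsfun_approx measurableT mE n : T -> R)) u u) => //.
- move=> n x; rewrite ger0_norm//.
  rewrite -lee_fin nnsfun_approxE; exact: (le_approx _ u0').
- by move=> x; rewrite ger0_norm.
- apply: aeW => x.
  have h : (nnsfun_approx measurableT mE n x)%:E @[n --> \oo] --> (u x)%:E.
    exact: (@cvg_nnsfun_approx _ T R setT measurableT _ mE u0' x I).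
  exact: fine_cvg h.
- by move=> n; exact: trig_approx_simple.
Qed.

Lemma trig_approx_Lp (u : R -> R) : measurable_fun [set: T] u ->
  (\int[mu]_x (`|u x| `^ p)%:E < +oo)%E -> trig_approx u.
Proof.
move=> mu0 iu.
have dom (v : R -> R) : measurable_fun [set: T] v -> (forall x, 0 <= v x <= `|u x|) -> trig_approx v.
  move=> mv hv; apply: (trig_approx_ge0 mv) => [x|]; first by have /andP[] := hv x.
  apply: le_lt_trans iu; apply: ge0_le_integral => //.
  - exact: measurable_abs_powR.
  - exact: measurable_abs_powR.
  - move=> x _; have /andP[h1 h2] := hv x; rewrite lee_fin.
    by apply: ge0_ler_powR; rewrite ?(ltW p0)// ?nnegrE// ger0_norm.
have -> : u = (fun x => -1 * Num.max (- u x) 0 + Num.max (u x) 0).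
  apply/funext => x; rewrite !/Num.max.
  by case: ltP => h1; case: ltP => h2; lra.
apply: trig_approx_lin.
- apply: dom; first by apply: measurable_maxr => //; exact: measurableT_comp.
  by move=> x; rewrite le_max lexx orbT ge_max normr_ge0 andbT -normrN ler_norm.
- apply: dom; first exact: measurable_maxr.
  by move=> x; rewrite le_max lexx orbT ge_max normr_ge0 andbT ler_norm.
Qed.

(** Indicators are limits of trigonometric polynomials by V_indic; simple functions,
    nonnegative functions, real functions and complex functions follow in this order. *)
Lemma teval_dense (f : F) (e : R) : Lp p%:E f -> 0 < e ->
  exists s, nrm p (fun t => f t - teval s t) <= e.
Proof.
move=> Lf e0; have [mr mi] := Lp_cmeas Lf.
have e2 : 0 < e / 2 by rewrite divr_gt0.
have fin : (\int[mu]_x (`|mag f x| `^ p)%:E < +oo)%E.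
  have : (Lnorm mu p%:E (EFin \o mag f) <= (nrm p f)%:E)%E by rewrite nrmE.
  rewrite (Lnorm_le_int p1) ?nrm_ge0// => h; apply: le_lt_trans h _; exact: ltry.
have ta (u : T -> R) : measurable_fun [set: T] u -> (forall x, `|u x| <= mag f x) ->
    trig_approx u.
  move=> mu0 hu; apply: (trig_approx_Lp mu0); apply: le_lt_trans fin.
  apply: ge0_le_integral => //.
  - exact: measurable_abs_powR.
  - by apply: measurable_abs_powR; apply: measurable_mag; exact: Lp_cmeas Lf.
  - move=> x _; rewrite lee_fin.
    by apply: ge0_ler_powR; rewrite ?(ltW p0)// ?nnegrE// (ger0_norm (mag_ge0 _ _)).
have [_ /(_ _ e2)[w1 [[s1 hs1] h1]]] := ta _ mr (fun x => normc_Re _).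
have [_ /(_ _ e2)[w2 [[s2 hs2] h2]]] := ta _ mi (fun x => normc_Im _).
have tw1 : rtrig w1 by exists s1.
have tw2 : rtrig w2 by exists s2.
have [mw1 _] := rtrig_bounded tw1; have [mw2 _] := rtrig_bounded tw2.
pose s := s1 ++ [seq ('i%C * a.1, a.2) | a <- s2]; exists s.
have sE x : teval s (expi x) = Complex (w1 x) (w2 x).
  rewrite teval_cat teval_scale hs1 hs2; apply: complex_ext.
    by rewrite ReD ReM /=; ring.
  by rewrite ImD ImM /=; ring.
pose u1 (x : T) := complex.Re (f (expi x)) - w1 x.
pose u2 (x : T) := complex.Im (f (expi x)) - w2 x.
have m1 : measurable_fun [set: T] u1 by exact: measurable_funB.
have m2 : measurable_fun [set: T] u2 by exact: measurable_funB.
have na (u : T -> R) : measurable_fun setT u -> (Lnorm mu p%:E (EFin \o u) <= (e / 2)%:E)%E ->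
    (Lnorm mu p%:E (EFin \o (fun x => `|u x|)%R) <= (e / 2)%:E)%E.
  by move=> mu0; rewrite -Lnorm_abse.
have h12 := Lnorm_addb (measurableT_comp (@normr_measurable _ setT) m1) (measurableT_comp (@normr_measurable _ setT) m2) (na _ m1 h1) (na _ m2 h2).
rewrite -splitr in h12.
have Lfs : Lp p%:E (fun t => f t - teval s t) by have [] := LpB p1 Lf (Lp_teval s p1).
rewrite -lee_fin nrmE//; apply: le_trans h12.
rewrite LpnormE !LnormE_real.
have mag0 : measurable_fun [set: T] (fun x => `|u1 x| + `|u2 x|).
  by apply: measurable_funD; apply: measurableT_comp.
apply: gt0_ler_poweR.
- by rewrite invr_ge0 ltW.
- by rewrite in_itv/= leey andbT; apply: integral_ge0 => x _; rewrite lee_fin powR_ge0.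
- by rewrite in_itv/= leey andbT; apply: integral_ge0 => x _; rewrite lee_fin powR_ge0.
rewrite /=; apply: ge0_le_integral => //.
- by apply: measurable_abs_powR; apply: measurable_mag; exact: Lp_cmeas Lfs.
- exact: measurable_abs_powR.
move=> x _; rewrite lee_fin.
apply: ge0_ler_powR; rewrite ?(ltW p0)// ?nnegrE//.
rewrite (ger0_norm (mag_ge0 _ _)) ger0_norm ?addr_ge0// /mag sE.
apply: le_trans (normc_le_ReIm _) _.
by rewrite ReD ReN ImD ImN.
Qed.

End RealApproximation.

(** By V_indic the integral of u over every measurable set vanishes. *)
Lemma ae0_of_rtrig (u : T -> R) : mu.-integrable setT (EFin \o u) ->
  (forall w, rtrig w -> (\int[mu]_x (u x * w x)%:E = 0)%E) ->
  {ae mu, forall x, u x = 0}.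
Proof.
move=> iu uw.
have mu0 : measurable_fun [set: T] u by apply/measurable_EFinP; exact: measurable_int iu.
have iuv (v : T -> R) M : measurable_fun [set: T] v -> (forall x, `|v x| <= M) ->
    mu.-integrable setT (fun x => (u x * v x)%:E).
  move=> mv vM.
  have i2 := integrableZl measurableT M (integrable_abse iu).
  apply: (le_integrable _ _ _ i2) => //.
    by apply/measurable_EFinP; exact: measurable_funM.
  move=> x _; rewrite -EFinM lee_fin mulrC !normrM normr_id.
  by apply: ler_wpM2r => //; exact: le_trans (vM x) (ler_norm _).
pose V (v : R -> R) := [/\ measurable_fun [set: T] v, exists M : R, forall x, `|v x| <= M & (\int[mu]_x (u x * v x)%:E = 0)%E].
have VA (A : set T) : measurable A -> V (\1_A : T -> R).
  apply: V_indic.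
  - move=> w tw; have [mw [M M0 wM]] := rtrig_bounded tw.
    by split => //; [exists M|exact: uw].
  - move=> c v1 v2 [mv1 [M1 h1] e1] [mv2 [M2 h2] e2].
    split; first by apply: measurable_funD => //; exact: measurable_funM.
      exists (`|c| * M1 + M2) => x; apply: le_trans (ler_normD _ _) _.
      by apply: lerD => //; rewrite normrM ler_wpM2l.
    have -> : (fun x => (u x * (c * v1 x + v2 x))%:E) =
        (fun x => c%:E * (u x * v1 x)%:E + (u x * v2 x)%:E)%E.
      by apply/funext => x; rewrite -EFinM -EFinD; congr EFin; ring.
    rewrite integralD//; last 2 first.
    + by apply: integrableZl => //; exact: iuv h1.
    + exact: iuv h2.
    by rewrite integralZl ?e1 ?e2 ?mule0 ?adde0//; exact: iuv h1.
  - move=> v_ v M mv_ mv v_M vM cv Vv.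
    split => //; first by exists M.
    have i2 := integrableZl measurableT M (integrable_abse iu).
    have [] := @dominated_convergence _ T R mu setT measurableT
      (fun n x => (u x * v_ n x)%:E) (fun x => (u x * v x)%:E) (fun x => M%:E * `|(u x)%:E|)%E.
    + by move=> n; apply/measurable_EFinP; exact: measurable_funM.
    + by apply/measurable_EFinP; exact: measurable_funM.
    + apply: ae_imp cv => x cv _; apply/cvg_EFin; first exact: nearW.
      exact: cvgMr.
    + exact: i2.
    + apply: aeW => x n _; rewrite -EFinM lee_fin mulrC normrM.
      by rewrite ler_wpM2r.
    move=> _ _ h.
    have v0 : (fun n => (\int[mu]_x (u x * v_ n x)%:E)%E) = (fun=> 0%E).
      by apply/funext => n; have [_ _ ->] := Vv n.
    have h' : (fun n => (\int[mu]_x (u x * v_ n x)%:E)%E) n @[n --> \oo] -->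
      (\int[mu]_x (u x * v x)%:E)%E := h.
    rewrite v0 in h'.
    exact: (cvg_unique _ h' (cvg_cst _)).
have : ae_eq mu setT (EFin \o u) (cst 0%E).
  apply: integral_ae_eq => //.
  move=> E _ mE; rewrite integral0 integral_mkcond.
  have [_ _ <-] := VA E mE.
  apply: eq_integral => x _; rewrite patchE indicE.
  by case: (_ \in _); rewrite ?mulr1 ?mulr0.
by apply: ae_imp => x /(_ I) [].
Qed.

(** The Fourier coefficients of f are its integrals against trigonometric polynomials. *)
Lemma fourier_inj0 (f : F) : Lp 1%:E f -> (forall n, fourier f n = 0) ->
  circ_eq f (fun=> 0).
Proof.
move=> Lf f0.
have int0 s : circ_int (fun t => f t * teval s t) = 0.
  have h : fourier (fun t => teval s t * f t) 0 = 0.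
    by rewrite fourierM_teval// big1// => ck _; rewrite f0 mulr0.
  move: h; rewrite /fourier => /eqP; rewrite mulf_eq0 invr_eq0 (negPf pi2C_neq0)/= => /eqP <-.
  by apply: circ_int_ext => x; rewrite oppr0 expr0z mulr1 mulrC.
have reim w : rtrig w -> (\int[mu]_x (complex.Re (f (expi x)) * w x)%:E = 0)%E /\
    (\int[mu]_x (complex.Im (f (expi x)) * w x)%:E = 0)%E.
  move=> [s hs].
  have [M _ /(_ _ Lf)[Lsf _]] := LpM_bdd (lexx 1) (bdd_teval s).
  have {Lsf} Lsf : Lp 1%:E (fun t => f t * teval s t) by under eq_fun do rewrite mulrC.
  have := int0 s; rewrite /circ_int /Rintegral => -[hr hi].
  have ir := integrable_fin_num measurableT (Lp1_Re_integrable Lsf).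
  have ii := integrable_fin_num measurableT (Lp1_Im_integrable Lsf).
  split.
  - have <- : (\int[mu]_x (complex.Re (f (expi x) * teval s (expi x)))%:E)%E = 0%E.
      by rewrite -(fineK ir); exact: (congr1 EFin hr).
    by apply: eq_integral => x _; rewrite hs ReM /= mulr0 subr0.
  - have <- : (\int[mu]_x (complex.Im (f (expi x) * teval s (expi x)))%:E)%E = 0%E.
      by rewrite -(fineK ii); exact: (congr1 EFin hi).
    by apply: eq_integral => x _; rewrite hs ImM /= mulr0 add0r.
have h1 := ae0_of_rtrig (Lp1_Re_integrable Lf) (fun w tw => (reim w tw).1).
have h2 := ae0_of_rtrig (Lp1_Im_integrable Lf) (fun w tw => (reim w tw).2).
by apply: ae_imp2 h1 h2 => x e1 e2; apply: complex_ext; rewrite ?e1 ?e2.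
Qed.

Lemma fourier_inj (f g : F) : Lp 1%:E f -> Lp 1%:E g ->
  (forall n, fourier f n = fourier g n) -> circ_eq f g.
Proof.
move=> Lf Lg fg; have [L _] := LpB (lexx 1) Lf Lg.
have h n : fourier (fun t => f t - g t) n = 0 by rewrite fourierB// fg subrr.
have := fourier_inj0 L h; apply: ae_imp => x /eqP.
by rewrite subr_eq0 => /eqP.
Qed.

End TrigApproximation.

(** * The converse of the Hoelder inequality *)

Section ConverseHoelder.
Context {R : realType}.
Local Notation C := R[i].
Local Notation F := (C -> C).
Local Notation T := (measurableTypeR R).
Local Notation mu := (@arc_length R).

Lemma nrm_powR p (f : F) : 0 < p -> Lp p%:E f ->
  ((nrm p f `^ p)%:E = \int[mu]_x (mag f x `^ p)%:E)%E.
Proof.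
move=> p0 Lf; have pn : p != 0 by rewrite gt_eqF.
rewrite -poweR_EFin (nrmE Lf) LpnormE (poweR_Lnorm _ _ pn).
by apply: eq_integral => x _; rewrite /= ger0_norm ?mag_ge0.
Qed.

Lemma Lp_of_integral p (f : F) (c : R) : 1 <= p -> 0 <= c -> cmeas f ->
  (\int[mu]_x (mag f x `^ p)%:E <= (c `^ p)%:E)%E -> Lp p%:E f /\ nrm p f <= c.
Proof.
move=> p1 c0 mf h.
have hL : (Lpnorm p%:E f <= c%:E)%E.
  have e : (\int[mu]_x (`|mag f x| `^ p)%:E = \int[mu]_x (mag f x `^ p)%:E)%E.
    by apply: eq_integral => x _; rewrite ger0_norm ?mag_ge0.
  by rewrite LpnormE (Lnorm_le_int p1 (mag f) c0) e.
have Lf : Lp p%:E f by apply/LpP; split => //; apply: le_lt_trans hL _; rewrite ltry.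
by split=> //; rewrite -lee_fin nrmE.
Qed.

Lemma conj_exp_mul (p q : R) : 1 < p -> p^-1 + q^-1 = 1 ->
  [/\ 1 < q, (q - 1) * p = q & q^-1 + p^-1 = 1].
Proof.
move=> p1 pq; have p0 : 0 < p by lra.
have pi1 : p^-1 < 1 by rewrite invf_lt1.
have pi0 : 0 < p^-1 by rewrite invr_gt0.
have qi : q^-1 = 1 - p^-1 by lra.
have qi0 : 0 < q^-1 by rewrite qi; lra.
have q0 : 0 < q by rewrite invr_gt0 in qi0.
have q1 : 1 < q by rewrite -invf_lt1// qi; lra.
split=> //; last by rewrite addrC.
have : q * p * (p^-1 + q^-1) = q * p by rewrite pq mulr1.
by rewrite mulrDr mulfK ?gt_eqF// mulrAC divff ?gt_eqF// mul1r; lra.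
Qed.

(** The extremal function conj(f) |f|^(q-2) has norm N^(q-1) in L^p, where N is the norm of
    f in L^q, and pairs with f to N^q; approximating it by trigonometric polynomials gives
    N^q <= K N^(q-1). *)
Lemma converse_hoelder p q (f : F) (K : R) : 1 < p -> p^-1 + q^-1 = 1 -> 0 <= K ->
  Lp q%:E f ->
  (forall s, nc (circ_int (fun t => f t * teval s t)) <= K * nrm p (teval s)) ->
  nrm q f <= K.
Proof.
move=> p1 pq K0 Lf fK.
have [q1 qp qp'] := conj_exp_mul p1 pq.
have p0 : 0 < p by lra.
have q0 : 0 < q by lra.
have mf := Lp_cmeas Lf.
have N0 := nrm_ge0 q f; set N := nrm q f in N0 *.
have [->//|Nn0] := eqVneq N 0.
pose w : F := fun t => conjc (f t) * ((nc (f t) `^ (q - 2))%:C)%C.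
have magw x : mag w x = mag f x `^ (q - 1).
  rewrite /w /mag Normc.normcM normc_conj normc_real ger0_norm ?powR_ge0//.
  set z := nc _; have z0 : 0 <= z by exact: normc_ge0.
  have [->|zn0] := eqVneq z 0; first by rewrite mul0r powR0// gt_eqF//; lra.
  have -> : q - 1 = 1 + (q - 2) by lra.
  by rewrite (@powRD _ z 1) ?zn0 ?implybT// powRr1.
have mw : cmeas w.
  apply: cmeasM; first exact: cmeas_conj.
  split => /=; last exact: measurable_cst.
  by apply: (measurableT_comp (measurable_powR _)); exact: measurable_mag.
have [Lw nw] : Lp p%:E w /\ nrm p w <= N `^ (q - 1).
  apply: Lp_of_integral; rewrite ?(ltW p1) ?powR_ge0//.
  have e : (\int[mu]_x (mag w x `^ p)%:E = \int[mu]_x (mag f x `^ q)%:E)%E.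
    by apply: eq_integral => x _; rewrite magw -powRrM qp.
  by rewrite e -nrm_powR// -powRrM qp.
have [Lfw _] := hoelder_circ q0 p0 qp' Lf Lw.
have fw : N `^ q <= nc (circ_int (fun t => f t * w t)).
  apply: le_trans (normc_Re _); apply: le_trans (ler_norm _).
  rewrite -lee_fin nrm_powR//.
  have fwE x : complex.Re (f (expi x) * w (expi x)) = mag f x `^ q.
    rewrite /w mulrA mul_conjc -rmorphM /= /mag.
    set z := nc _; have z0 : 0 <= z by exact: normc_ge0.
    have [->|zn0] := eqVneq z 0; first by rewrite expr0n/= mul0r powR0// gt_eqF.
    have e : z `^ q = z `^ 2%:R * z `^ (q - 2).
      by rewrite -powRD ?zn0 ?implybT//; congr (_ `^ _); lra.
    by rewrite e powR_mulrn.
  have ir := integrable_fin_num measurableT (Lp1_Re_integrable Lfw).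
  have -> : (\int[mu]_x (mag f x `^ q)%:E =
     \int[mu]_x (complex.Re (f (expi x) * w (expi x)))%:E)%E.
    by apply: eq_integral => x _; rewrite fwE.
  by rewrite -(fineK ir).
have main e : 0 < e -> N `^ q <= K * N `^ (q - 1) + e * (2 * N + K).
  move=> e0; have [s hs] := teval_dense (ltW p1) Lw e0.
  have Ls := Lp_teval s (ltW p1).
  have [Lws _] := LpB (ltW p1) Lw Ls.
  have [L1 n1] := hoelder_circ q0 p0 qp' Lf Lws.
  have [L2 _] := hoelder_circ q0 p0 qp' Lf Ls.
  have ns : nrm p (teval s) <= N `^ (q - 1) + e.
    have [Lsw nsw] := LpN p0 Lws.
    have [_ h] := LpD (ltW p1) Lw Lsw.
    have ee : (fun t => w t + - (w t - teval s t)) = teval s.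
      by apply/funext => t; rewrite opprB addrC subrK.
    rewrite ee in h; apply: le_trans h _; rewrite nsw; exact: lerD.
  have dec : circ_int (fun t => f t * w t) =
      circ_int (fun t => f t * (w t - teval s t)) + circ_int (fun t => f t * teval s t).
    rewrite -circ_intD//; apply: circ_int_ext => x.
    by rewrite -mulrDr subrK.
  apply: le_trans fw _; rewrite dec; apply: le_trans (normcD _ _) _.
  have b1 := circ_int_le L1; have b2 := fK s.
  have b3 : nrm q f * nrm p (fun t => w t - teval s t) <= N * e.
    by apply: ler_wpM2l.
  have b4 : K * nrm p (teval s) <= K * (N `^ (q - 1) + e) by apply: ler_wpM2l.
  move: b1 b2 b3 b4 n1; rewrite -/N => b1 b2 b3 b4 n1.
  by move: (nc _) (nc _) b1 b2 => z1 z2 b1 b2; lra.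
have NN : N `^ q <= K * N `^ (q - 1).
  apply/ler_addgt0Pr => e e0.
  have d0 : 0 < 2 * N + K + 1 by lra.
  have := main (e / (2 * N + K + 1)) (divr_gt0 e0 d0).
  move=> h; apply: le_trans h _; rewrite lerD2l.
  by rewrite mulrAC ler_pdivrMr// ler_pM2l//; lra.
have Np : 0 < N by rewrite lt_neqAle eq_sym Nn0.
have NqE : N `^ q = N * N `^ (q - 1).
  rewrite -{2}(powRr1 N0) -powRD ?Nn0 ?implybT//; congr (_ `^ _); lra.
by move: NN; rewrite NqE ler_pM2r// powR_gt0.
Qed.

End ConverseHoelder.

(** * Integrals of bounded functions; analytic polynomials *)

Section BoundedMeasurable.
Context {R : realType}.
Local Notation C := R[i].
Local Notation T := (measurableTypeR R).
Local Notation mu := (@arc_length R).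

(** Everywhere bounded measurable functions: integrals of the expressions below are then
    linear and monotone without integrability side conditions. *)
Definition bm (u : T -> R) := measurable_fun setT u /\ exists M, forall x, `|u x| <= M.

Definition Rint (u : T -> R) : R := \int[mu]_(x in setT) u x.

Lemma bm_integrable u : bm u -> mu.-integrable setT (EFin \o u).
Proof. by move=> [mu0 [M uM]]; exact: bounded_integrable uM. Qed.

Lemma bm_cst c : bm (fun=> c).
Proof. by split; [exact: measurable_cst|exists `|c|]. Qed.

Lemma bmD u v : bm u -> bm v -> bm (fun x => u x + v x).
Proof.
move=> [mu0 [M uM]] [mv [N vN]]; split; first exact: measurable_funD.
by exists (M + N) => x; apply: le_trans (ler_normD _ _) _; exact: lerD.
Qed.

Lemma bmM u v : bm u -> bm v -> bm (fun x => u x * v x).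
Proof.
move=> [mu0 [M uM]] [mv [N vN]]; split; first exact: measurable_funM.
by exists (M * N) => x; rewrite normrM; exact: ler_pM.
Qed.

Lemma bmZ c u : bm u -> bm (fun x => c * u x).
Proof. by apply: bmM; exact: bm_cst. Qed.

Lemma bmX u n : bm u -> bm (fun x => u x ^+ n).
Proof.
move=> bu; elim: n => [|n IH]; first exact: bm_cst.
by under eq_fun do rewrite exprS; exact: bmM.
Qed.

Lemma bm_inv u : bm u -> (forall x, 1 <= u x) -> bm (fun x => (u x)^-1).
Proof.
move=> [mu0 _] u1; split.
  by apply: measurable_inv_ge0 => // x; exact: le_trans ler01 (u1 x).
exists 1 => x; have u0 : 0 < u x by exact: lt_le_trans ltr01 (u1 x).
by rewrite ger0_norm ?invr_ge0 ?(ltW u0)// invf_le1.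
Qed.

Lemma bm_powR u p : 0 <= p -> bm u -> (forall x, 0 <= u x) -> bm (fun x => u x `^ p).
Proof.
move=> p0 [mu0 [M uM]] u0; split.
  exact: (measurableT_comp (measurable_powR _)).
exists (M `^ p) => x; rewrite ger0_norm ?powR_ge0//.
have uxM : u x <= M by apply: le_trans (uM x); exact: ler_norm.
by apply: ge0_ler_powR; rewrite ?nnegrE//; exact: le_trans (u0 x) uxM.
Qed.

Lemma bm_abs u : bm u -> bm (fun x => `|u x|).
Proof.
move=> [mu0 [M uM]]; split; first exact: measurableT_comp.
by exists M => x; rewrite normr_id.
Qed.

Lemma bm_sum n (u : nat -> T -> R) : (forall i, bm (u i)) -> bm (fun x => \sum_(i < n) u i x).
Proof.
move=> bu; elim: n => [|n IH].
  by under eq_fun do rewrite big_ord0; exact: bm_cst.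
by under eq_fun do rewrite big_ord_recr /=; exact: bmD.
Qed.

Lemma Rint_le u v : bm u -> bm v -> (forall x, u x <= v x) -> Rint u <= Rint v.
Proof. by move=> bu bv uv; apply: le_Rintegral => //; exact: bm_integrable. Qed.

Lemma RintD u v : bm u -> bm v -> Rint (fun x => u x + v x) = Rint u + Rint v.
Proof. by move=> bu bv; apply: RintegralD => //; exact: bm_integrable. Qed.

Lemma RintZ c u : bm u -> Rint (fun x => c * u x) = c * Rint u.
Proof. by move=> bu; apply: RintegralZl => //; exact: bm_integrable. Qed.

Lemma Rint_cst c : Rint (fun=> c) = c * (2 * pi).
Proof. by rewrite /Rint Rintegral_cst// arc_lengthT. Qed.

Lemma Rint_sum n (u : nat -> T -> R) : (forall i, bm (u i)) ->
  Rint (fun x => \sum_(i < n) u i x) = \sum_(i < n) Rint (u i).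
Proof.
move=> bu; elim: n => [|n IH].
  rewrite big_ord0 -[RHS](mul0r (2 * pi)) -Rint_cst; congr Rint.
  by apply/funext => x; rewrite big_ord0.
rewrite big_ord_recr /= -IH -(RintD (bm_sum n bu) (bu n)).
by congr Rint; apply/funext => x; rewrite big_ord_recr.
Qed.

Definition pseq (G : {poly C}) : seq (C * int) := [seq (G`_i, i%:Z) | i <- iota 0 (size G)].

Lemma teval_pseq G t : teval (pseq G) t = G.[t].
Proof.
rewrite /teval /pseq big_map horner_coef -(big_mkord xpredT (fun i => G`_i * t ^+ i)).
rewrite /index_iota subn0.
by apply: eq_bigr => i _ /=; rewrite exprnP.
Qed.

Lemma fourier_horner (G : {poly C}) (n : int) : @fourier R (fun t => G.[t]) n =
  match n with Posz m => G`_m | Negz _ => 0 end.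
Proof.
have -> : (fun t : C => G.[t]) = teval (pseq G) by apply/funext => t; rewrite teval_pseq.
rewrite fourier_teval /pseq big_map /=; case: n => m; last by rewrite big1.
have [mG|mG] := ltnP m (size G).
  rewrite big_mkcond (bigD1_seq m) ?mem_iota ?iota_uniq//= eqxx big1 ?addr0// => i im.
  by case: eqP => // -[e]; rewrite e eqxx in im.
rewrite nth_default// big1_seq// => i /andP[/eqP[->]].
by rewrite mem_iota add0n ltnNge mG.
Qed.

Lemma poly_bounded (G : {poly C}) : exists2 M, 0 <= M & forall x : R, nc G.[expi x] <= M.
Proof.
by have [M M0 h] := teval_bounded (pseq G); exists M => // x; rewrite -teval_pseq.
Qed.

Lemma cmeas_poly (G : {poly C}) : @cmeas R (fun t => G.[t]).
Proof.
have -> : (fun t : C => G.[t]) = teval (pseq G) by apply/funext => t; rewrite teval_pseq.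
by have [] := bdd_teval (pseq G).
Qed.

Lemma bm_Re_poly (G : {poly C}) : bm (fun x => complex.Re G.[expi x]).
Proof.
have [mr _] := cmeas_poly G; have [M _ h] := poly_bounded G.
by split => //; exists M => x; apply: le_trans (normc_Re _) (h x).
Qed.

Lemma bm_Im_poly (G : {poly C}) : bm (fun x => complex.Im G.[expi x]).
Proof.
have [_ mi] := cmeas_poly G; have [M _ h] := poly_bounded G.
by split => //; exists M => x; apply: le_trans (normc_Im _) (h x).
Qed.

Lemma circ_int_poly (G : {poly C}) : @circ_int R (fun t => G.[t]) = ((2 * pi)%:C)%C * G`_0.
Proof.
have <- : @fourier R (fun t => G.[t]) 0 = G`_0 := fourier_horner G 0.
rewrite /fourier.
rewrite mulrA divff ?pi2C_neq0// mul1r; apply: circ_int_ext => x.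
by rewrite oppr0 expr0z mulr1.
Qed.

Lemma Rint_Re_poly (G : {poly C}) :
  Rint (fun x => complex.Re G.[expi x]) = 2 * pi * complex.Re G`_0.
Proof.
by have := congr1 (fun z : C => complex.Re z) (circ_int_poly G); rewrite ReM /= mul0r subr0.
Qed.

End BoundedMeasurable.

(** * The conjugate function at a single scale *)

Section ConjugateFunction.
Context {R : realType}.
Local Notation C := R[i].
Local Notation T := (measurableTypeR R).
Local Notation mu := (@arc_length R).

Lemma Re_inv (z : C) : complex.Re z^-1 = complex.Re z / (nc z ^+ 2).
Proof. by rewrite complex_inv ReM Re_conj /= mulr0 subr0. Qed.

Lemma real_complexX (x : R) n : ((x ^+ n)%:C)%C = ((x%:C)%C : C) ^+ n.
Proof. by elim: n => [|n IH]; rewrite ?expr0// !exprS -IH -rmorphM. Qed.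

Lemma normc_ge_Re1 (z : C) : 1 <= complex.Re z -> 1 <= nc z.
Proof. by move=> h; apply: le_trans h _; apply: le_trans (ler_norm _) (normc_Re z). Qed.

(** An analytic polynomial G with Re G >= 1 on the circle has an analytic reciprocal, whose
    mean is 1/m; only the weaker bound 1/m >= 2 - m is recorded, because this is what the
    pointwise inequality below consumes. The reciprocal is expanded in powers of H = 1 - k
    G, a contraction on the circle for small k. *)
Lemma Rint_resolvent (G : {poly C}) (m : R) :
  (forall x : R, 1 <= complex.Re G.[expi x]) -> G`_0 = (m%:C)%C ->
  2 * pi * (2 - m) <= Rint (fun x => complex.Re (G.[expi x])^-1).
Proof.
move=> G1 G0.
have pi0 := pi2_gt0 (R := R).
have [b0 _ hb0] := poly_bounded G.
pose b := b0 + 1.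
have hb (x : R) : nc G.[expi x] <= b by apply: le_trans (hb0 x) _; rewrite /b lerDl.
have b1 : 1 <= b by apply: le_trans (hb 0); exact: normc_ge_Re1 (G1 0).
(* b bounds |G|, so k = 1/b^2 makes |1 - k G|^2 = 1 - 2 k Re G + k^2 |G|^2 <= 1 - k *)
pose M : R := b ^+ 2.
have M1 : 1 <= M by rewrite /M; nra.
have M0 : 0 < M by lra.
have m1 : 1 <= m.
  have := Rint_le (bm_cst 1) (bm_Re_poly G) G1.
  by rewrite Rint_cst Rint_Re_poly G0 /= mulrC ler_pM2l.
have mM : m <= M.
  have h x : complex.Re G.[expi x] <= b.
    by apply: le_trans (hb x); apply: le_trans (ler_norm _) (normc_Re _).
  have := Rint_le (bm_Re_poly G) (bm_cst b) h.
  rewrite Rint_cst Rint_Re_poly G0 /= [b * _]mulrC ler_pM2l//.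
  by rewrite /M; nra.
pose k : R := M^-1.
have k0 : 0 < k by rewrite invr_gt0.
have k1 : k <= 1 by rewrite invf_le1.
have kM : k * M = 1 by rewrite mulVf// gt_eqF.
pose r : R := 1 - k / 2.
have r01 : 0 <= r < 1 by apply/andP; split; rewrite /r; lra.
have /andP[r0 r1] := r01.
pose H : {poly C} := 1 - ((k%:C)%C)%:P * G.
have Hr (x : R) : nc H.[expi x] <= r.
  have hn := normc_sqr H.[expi x].
  have HE : H.[expi x] = 1 - (k%:C)%C * G.[expi x] by rewrite /H !hornerE.
  move: hn; rewrite HE ReD ImD ReN ImN ReM ImM /= !mul0r subr0 addr0 => hn.
  have g2 := normc_sqr G.[expi x].
  have gb : nc G.[expi x] ^+ 2 <= M.
    by rewrite /M ler_sqr ?nnegrE ?normc_ge0//; lra.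
  have G1x := G1 x.
  have kg : k ^+ 2 * nc G.[expi x] ^+ 2 <= k.
    by rewrite -[leRHS]mulr1 -kM mulrA -expr2 ler_wpM2l// sqr_ge0.
  rewrite g2 in kg.
  move: (complex.Re _) (complex.Im _) hn G1x kg => u v hn G1x kg.
  rewrite -(@ler_pXn2r _ 2)// ?nnegrE ?normc_ge0//.
  have : k * 1 <= k * u by apply: ler_wpM2l => //; lra.
  by rewrite hn /r => ku; nra.
pose h0 : R := 1 - k * m.
have h00 : 0 <= h0.
  have : k * m <= k * M by apply: ler_wpM2l => //; lra.
  by rewrite kM /h0; lra.
have h0r : h0 <= r.
  have : k * 1 <= k * m by apply: ler_wpM2l => //; lra.
  by rewrite /h0 /r; lra.
have HH0 : H`_0 = (h0%:C)%C.
  rewrite -horner_coef0 /H !hornerE /= horner_coef0 G0 -rmorphM /=.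
  by rewrite /h0 rmorphB rmorph1.
have main N : 2 * pi * (2 - m) <= Rint (fun x => complex.Re (G.[expi x])^-1) + 4 * pi * r ^+ N.
  (* A approximates 1/G, with relative error H^N *)
  pose A : {poly C} := ((k%:C)%C)%:P * \sum_(j < N) H ^+ j.
  have AG : A * G = 1 - H ^+ N.
    rewrite -opprB subrX1 -mulNr opprB.
    have -> : 1 - H = ((k%:C)%C)%:P * G by rewrite /H opprB addrC subrK.
    by rewrite /A mulrAC.
  have A0 : A`_0 = (((1 - h0 ^+ N) / m)%:C)%C.
    have mC : (m%:C)%C != 0 :> C by rewrite eq_complex /= negb_and gt_eqF//; lra.
    apply: (mulIf mC); rewrite -G0 -coef0M AG coefB coef1 /=.
    rewrite -(horner_coef0 (H ^+ N)) horner_exp horner_coef0 HH0 G0 -rmorphM /=.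
    rewrite divfK; last by rewrite gt_eqF//; lra.
    by rewrite -real_complexX rmorphB rmorph1.
  have bG : bm (fun x => complex.Re (G.[expi x])^-1).
    have mG : @cmeas R (circ_inv (fun t => G.[t])) by apply: cmeas_inv; exact: cmeas_poly.
    split; first by have [] := mG.
    exists 1 => x; apply: le_trans (normc_Re _) _; rewrite Normc.normcV invf_le1.
      exact: normc_ge_Re1.
    by apply: lt_le_trans ltr01 _; exact: normc_ge_Re1.
  have le1 (x : R) : complex.Re A.[expi x] - r ^+ N <= complex.Re (G.[expi x])^-1.
    have Gn0 : G.[expi x] != 0.
      apply/eqP => e; have := G1 x; rewrite e /=; lra.
    have -> : (G.[expi x])^-1 = A.[expi x] + H.[expi x] ^+ N / G.[expi x].
      apply: (mulIf Gn0); rewrite mulVf// mulrDl divfK//.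
      have := congr1 (fun p : {poly C} => p.[expi x]) AG.
      by rewrite !hornerE => ->; rewrite subrK.
    rewrite ReD lerD2l lerNl; apply: le_trans (ler_norm _) _; rewrite normrN.
    apply: le_trans (normc_Re _) _; rewrite Normc.normcM Normc.normcV normcX.
    apply: le_trans (_ : nc H.[expi x] ^+ N * 1 <= _).
      apply: ler_wpM2l; first by rewrite exprn_ge0// normc_ge0.
      rewrite invf_le1; first exact: normc_ge_Re1.
      by apply: lt_le_trans ltr01 _; exact: normc_ge_Re1.
    by rewrite mulr1; apply: lerXn2r; rewrite ?nnegrE ?normc_ge0.
  have := Rint_le (bmD (bm_Re_poly A) (bm_cst (- r ^+ N))) bG le1.
  rewrite RintD ?Rint_cst ?Rint_Re_poly ?A0 /=; [|exact: bm_Re_poly|exact: bm_cst].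
  have hN : h0 ^+ N <= r ^+ N by apply: lerXn2r; rewrite ?nnegrE.
  have hN0 : 0 <= h0 ^+ N by rewrite exprn_ge0.
  have im : 2 - m <= m^-1.
    rewrite -[m^-1]mul1r ler_pdivlMr; last lra.
    by nra.
  have hm : h0 ^+ N / m <= h0 ^+ N.
    by rewrite ler_pdivrMr; nra.
  have lower : 2 - m - r ^+ N <= (1 - h0 ^+ N) / m by rewrite mulrBl mul1r; lra.
  have : 2 * pi * (2 - m - r ^+ N) <= 2 * pi * ((1 - h0 ^+ N) / m) by rewrite ler_pM2l.
  by lra.
apply/ler_addgt0Pr => e e0.
have rn : `|r| < 1 by rewrite ger0_norm.
have e4 : 0 < e / (4 * pi) by rewrite divr_gt0// mulr_gt0// pi_gt0.
have /cvgrPdist_lt/(_ _ e4)[N _ /(_ N (leqnn N))] := cvg_expr rn.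
rewrite /= sub0r normrN ger0_norm ?exprn_ge0// ltr_pdivlMr ?mulr_gt0 ?pi_gt0// => rN.
apply: le_trans (main N) _; rewrite lerD2l; apply: ltW.
by rewrite mulrC.
Qed.

(** With y = s v this kernel, integrated against s^(-p) ds/s, is a multiple of |v|^p for 0
    < p < 2; with z = s u the kernel rhof gives in the same way a multiple of u^p for 1 < p
    < 2. *)
Definition phif (y : R) := y ^+ 2 / (1 + y ^+ 2).
Definition rhof (z : R) := z ^+ 2 / (1 + z).

(** With X = 1 + s u and w = s v, X / (X^2 + w^2) is the real part of 1 / (1 + s F). For X
    <= 2 the last term controls w^2 / (1 + w^2); for X > 2 the first one exceeds the bound
    1. *)
Lemma resolvent_pointwise (X w : R) : 1 <= X ->
  phif w <= 24 * rhof (X - 1) - 8 * (X / (X ^+ 2 + w ^+ 2) - 2 + X).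
Proof.
move=> X1; rewrite /phif /rhof; set W := w ^+ 2.
have W0 : 0 <= W by exact: sqr_ge0.
have X0 : 0 < X by lra.
have W1 : 0 < 1 + W by lra.
have D0 : 0 < X ^+ 2 + W by rewrite ltr_pwDl// exprn_gt0.
have -> : 1 + (X - 1) = X by lra.
have -> : X / (X ^+ 2 + W) - 2 + X = (X - 1) ^+ 2 / X - W / (X * (X ^+ 2 + W)).
  by field; rewrite !gt_eqF.
set rho := (X - 1) ^+ 2 / X; set q := W / (X * (X ^+ 2 + W)).
have rho0 : 0 <= rho by rewrite divr_ge0 ?sqr_ge0// ltW.
have q0 : 0 <= q by rewrite divr_ge0// mulr_ge0// ltW.
suff : W / (1 + W) <= 16 * rho + 8 * q by lra.
have [X2|X2] := leP X 2.
  apply: le_trans (_ : 8 * q <= _); last by lra.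
  rewrite ler_pdivrMr// /q.
  have -> : 8 * (W / (X * (X ^+ 2 + W))) * (1 + W) = 8 * W * (1 + W) / (X * (X ^+ 2 + W)).
    by field; rewrite !gt_eqF.
  rewrite ler_pdivlMr ?mulr_gt0//.
  have : X * (X ^+ 2 + W) <= 8 * (1 + W).
    apply: le_trans (_ : 2 * (4 + W) <= _); last lra.
    apply: ler_pM => //; [exact: ltW|exact: ltW|].
    by rewrite lerD2r; nra.
  by move=> /(ler_wpM2l W0); lra.
apply: le_trans (_ : 1 <= _); first by rewrite ler_pdivrMr; lra.
have : 2^-1 <= rho.
  by rewrite /rho ler_pdivlMr//; nra.
by lra.
Qed.

Lemma bm_phif u : bm u -> bm (fun x : T => phif (u x)).
Proof.
move=> bu; apply: bmM; first exact: bmX.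
apply: bm_inv; first by apply: bmD; [exact: bm_cst|exact: bmX].
by move=> x; rewrite lerDl sqr_ge0.
Qed.

Lemma bm_rhof u : bm u -> (forall x, 0 <= u x) -> bm (fun x : T => rhof (u x)).
Proof.
move=> bu u0; apply: bmM; first exact: bmX.
apply: bm_inv; first by apply: bmD; [exact: bm_cst|].
by move=> x; rewrite lerDl.
Qed.

(** Integrate resolvent_pointwise for G = 1 + s F: the terms 1/G - 2 + G integrate to
    something nonnegative by Rint_resolvent. *)
Lemma conjugate_scale (F : {poly C}) (m s : R) : 0 < s ->
  (forall x : R, 0 < complex.Re F.[expi x]) -> F`_0 = (m%:C)%C ->
  Rint (fun x => phif (s * complex.Im F.[expi x])) <=
  24 * Rint (fun x => rhof (s * complex.Re F.[expi x])).
Proof.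
move=> s0 F0 Fm.
pose G : {poly C} := 1 + ((s%:C)%C)%:P * F.
have GE (x : R) : G.[expi x] = 1 + (s%:C)%C * F.[expi x] by rewrite /G !hornerE.
have ReG (x : R) : complex.Re G.[expi x] = 1 + s * complex.Re F.[expi x].
  by rewrite GE ReD ReM /= mul0r subr0.
have ImG (x : R) : complex.Im G.[expi x] = s * complex.Im F.[expi x].
  by rewrite GE ImD ImM /= mul0r addr0 add0r.
have G1 (x : R) : 1 <= complex.Re G.[expi x].
  by rewrite ReG lerDl mulr_ge0// ltW.
have Gm : G`_0 = ((1 + s * m)%:C)%C.
  by rewrite -horner_coef0 /G !hornerE horner_coef0 Fm rmorphD rmorph1 rmorphM.
have res := Rint_resolvent G1 Gm.
have bsF : bm (fun x : T => s * complex.Re F.[expi x]) by apply: bmZ; exact: bm_Re_poly.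
have bsI : bm (fun x : T => s * complex.Im F.[expi x]) by apply: bmZ; exact: bm_Im_poly.
have bG : bm (fun x : T => complex.Re (G.[expi x])^-1).
  have mG : @cmeas R (circ_inv (fun t => G.[t])) by apply: cmeas_inv; exact: cmeas_poly.
  split; first by have [] := mG.
  exists 1 => x; apply: le_trans (normc_Re _) _; rewrite Normc.normcV invf_le1.
    exact: normc_ge_Re1.
  by apply: lt_le_trans ltr01 _; exact: normc_ge_Re1.
have brho : bm (fun x : T => rhof (s * complex.Re F.[expi x])).
  by apply: bm_rhof => // x; rewrite mulr_ge0// ltW.
have pt (x : T) : phif (s * complex.Im F.[expi x]) <=
    24 * rhof (s * complex.Re F.[expi x]) +
    (-8 * complex.Re (G.[expi x])^-1 + (16 + -8 * complex.Re G.[expi x])).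
  have := resolvent_pointwise (complex.Im G.[expi x]) (G1 x).
  rewrite Re_inv normc_sqr ImG.
  have -> : complex.Re G.[expi x] - 1 = s * complex.Re F.[expi x] by rewrite ReG; lra.
  by lra.
have bR := bm_Re_poly G.
have b2 : bm (fun x : T => 16 + -8 * complex.Re G.[expi x]).
  by apply: bmD; [exact: bm_cst|exact: bmZ].
have b3 : bm (fun x : T => -8 * complex.Re (G.[expi x])^-1 + (16 + -8 * complex.Re G.[expi x])).
  by apply: bmD => //; exact: bmZ.
have := Rint_le (bm_phif bsI) (bmD (bmZ 24 brho) b3) pt.
rewrite (RintD (bmZ _ brho) b3) (RintD (bmZ _ bG) b2) (RintD (bm_cst 16) (bmZ _ bR)).
rewrite !RintZ// Rint_cst Rint_Re_poly Gm /=.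
by move: (Rint _) (Rint _) (Rint _) res => i1 i2 i3; lra.
Qed.

End ConjugateFunction.

(** * Summation over dyadic scales *)

Section Dyadic.
Context {R : realType}.
Implicit Types (z y p : R).

Lemma phif_ge0 y : 0 <= phif y.
Proof. by rewrite divr_ge0 ?sqr_ge0// addr_ge0// sqr_ge0. Qed.

Lemma phif_half y : 1 <= `|y| -> 2^-1 <= phif y.
Proof.
move=> y1; rewrite /phif.
have : 1 <= y ^+ 2 by rewrite -real_normK ?num_real// expr_ge1.
by move=> h; rewrite ler_pdivlMr; lra.
Qed.

Lemma rhof_le z : 0 < z -> rhof z <= z /\ rhof z <= z ^+ 2.
Proof.
move=> z0; have z1 : 0 < 1 + z by lra.
by split; rewrite /rhof ler_pdivrMr//; nra.
Qed.

Section Potential.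
Variable p : R.
Hypothesis p12 : 1 < p < 2.

Definition potA := (2 `^ (2 - p) - 1)^-1.
Definition potB := (1 - 2 `^ (1 - p))^-1.
Definition potK := potA + potB + 1.

(** A bounded function whose increment over [z, 2z] dominates z^(-p) rhof z: summing over a
    dyadic progression telescopes. The two branches come from rhof z <= z^2 and rhof z <=
    z, and potK makes the jump at 1 large enough. *)
Definition Psi z : R := if z <= 1 then potA * z `^ (2 - p) else potK - potB * z `^ (1 - p).

Lemma pot_p1 : 1 < p. Proof. by case/andP: p12. Qed.
Lemma pot_p2 : p < 2. Proof. by case/andP: p12. Qed.

Lemma pot_ha : 1 < 2 `^ (2 - p).
Proof.
have {1}-> : (1 : R) = 1 `^ (2 - p) by rewrite powR1.
by apply: gt0_ltr_powR; rewrite ?nnegrE ?subr_gt0 ?pot_p2 ?ltr1n ?ler01 ?ler0n.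
Qed.

Lemma pot_hb : 2 `^ (1 - p) < 1.
Proof.
have h : 1 < 2 `^ (p - 1).
  have {1}-> : (1 : R) = 1 `^ (p - 1) by rewrite powR1.
  by apply: gt0_ltr_powR; rewrite ?nnegrE ?subr_gt0 ?pot_p1 ?ltr1n ?ler01 ?ler0n.
rewrite -opprB powRN invf_lt1//; exact: lt_trans ltr01 h.
Qed.

Lemma pot_A0 : 0 < potA. Proof. by rewrite invr_gt0 subr_gt0 pot_ha. Qed.
Lemma pot_B0 : 0 < potB. Proof. by rewrite invr_gt0 subr_gt0 pot_hb. Qed.

Lemma pow_le1 z : 0 <= z <= 1 -> 0 <= z `^ (2 - p) <= 1.
Proof.
move=> /andP[z0 z1]; rewrite powR_ge0/=.
have {2}-> : (1 : R) = 1 `^ (2 - p) by rewrite powR1.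
by apply: ge0_ler_powR; rewrite ?nnegrE ?subr_ge0 ?(ltW pot_p2).
Qed.

Lemma pow_ge1 z : 1 <= z -> 0 <= z `^ (1 - p) <= 1.
Proof.
move=> z1; rewrite powR_ge0/=.
have : z `^ (1 - p) <= z `^ 0 by apply: ler_powR => //; have := pot_p1; lra.
by rewrite powRr0.
Qed.

Lemma Psi_bound z : 0 < z -> 0 <= Psi z <= potK.
Proof.
move=> z0; rewrite /Psi; case: ifPn => [z1|].
  have /andP[h0 h1] : 0 <= z `^ (2 - p) <= 1 by apply: pow_le1; rewrite z1 ltW.
  have : potA * z `^ (2 - p) <= potA * 1 by exact: (ler_wpM2l (ltW pot_A0)).
  have : 0 <= potA * z `^ (2 - p) by exact: (mulr_ge0 (ltW pot_A0)).
  by move: pot_A0 pot_B0; rewrite /potK; lra.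
rewrite -ltNge => z1; have /andP[h0 h1] := pow_ge1 (ltW z1).
have : potB * z `^ (1 - p) <= potB * 1 by exact: (ler_wpM2l (ltW pot_B0)).
have : 0 <= potB * z `^ (1 - p) by exact: (mulr_ge0 (ltW pot_B0)).
by move: pot_A0 pot_B0; rewrite /potK; lra.
Qed.

Lemma theta_le z : 0 < z -> z `^ (- p) * rhof z <= z `^ (2 - p) /\
  z `^ (- p) * rhof z <= z `^ (1 - p).
Proof.
move=> z0; have [h1 h2] := rhof_le z0.
have zn : z != 0 by rewrite gt_eqF.
have -> : z `^ (2 - p) = z `^ (- p) * z ^+ 2.
  rewrite -(powR_mulrn _ (ltW z0)) -powRD ?zn ?implybT//; congr (_ `^ _); lra.
have -> : z `^ (1 - p) = z `^ (- p) * z.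
  rewrite -[X in _ * X](powRr1 (ltW z0)) -powRD ?zn ?implybT//; congr (_ `^ _); lra.
by split; apply: ler_wpM2l => //; exact: powR_ge0.
Qed.

Lemma Psi_step z : 0 < z -> z `^ (- p) * rhof z <= Psi (2 * z) - Psi z.
Proof.
move=> z0; have [t1 t2] := theta_le z0.
have e1 : (2 * z) `^ (2 - p) = 2 `^ (2 - p) * z `^ (2 - p) by rewrite powRM// ltW.
have e2 : (2 * z) `^ (1 - p) = 2 `^ (1 - p) * z `^ (1 - p) by rewrite powRM// ltW.
have AE : potA * (2 `^ (2 - p) - 1) = 1 by rewrite mulVf// gt_eqF// subr_gt0 ?pot_ha ?pot_hb.
have BE : potB * (1 - 2 `^ (1 - p)) = 1 by rewrite mulVf// gt_eqF// subr_gt0 ?pot_ha ?pot_hb.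
rewrite /Psi; case: (leP (2 * z) 1) => h1.
  have -> : z <= 1 by lra.
  apply: le_trans t1 _.
  have -> : potA * (2 * z) `^ (2 - p) - potA * z `^ (2 - p) =
    potA * (2 `^ (2 - p) - 1) * z `^ (2 - p) by rewrite e1; ring.
  by rewrite AE mul1r.
case: (leP z 1) => h2.
  have /andP[g0 g1] := pow_ge1 (ltW h1).
  have /andP[f0 f1] : 0 <= z `^ (2 - p) <= 1 by apply: pow_le1; rewrite h2 ltW.
  have : potB * (2 * z) `^ (1 - p) <= potB * 1 by exact: (ler_wpM2l (ltW pot_B0)).
  have : potA * z `^ (2 - p) <= potA * 1 by exact: (ler_wpM2l (ltW pot_A0)).
  by rewrite /potK; lra.
apply: le_trans t2 _.
have -> : potK - potB * (2 * z) `^ (1 - p) - (potK - potB * z `^ (1 - p)) =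
   potB * (1 - 2 `^ (1 - p)) * z `^ (1 - p) by rewrite e2; ring.
by rewrite BE mul1r.
Qed.

(** Apply the telescoping bound at z = s u and multiply by u^p. *)
Lemma dyadic_upper : exists2 K : R, 0 <= K & forall n s u, 0 < s -> 0 < u ->
  \sum_(i < n) (2 ^+ i * s) `^ (- p) * rhof (2 ^+ i * s * u) <= K * u `^ p.
Proof.
exists potK; first by have /andP[h1 h2] := Psi_bound ltr01; exact: le_trans h2.
move=> n s u s0 u0.
have tel z : 0 < z -> \sum_(i < n) (2 ^+ i * z) `^ (- p) * rhof (2 ^+ i * z) <= potK.
  move=> z0; apply: le_trans (_ : Psi (2 ^+ n * z) - Psi z <= _).
    elim: n => [|n IH]; first by rewrite big_ord0 expr0 mul1r subrr.
    rewrite big_ord_recr /= exprS.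
    have zn0 : 0 < 2 ^+ n * z by rewrite mulr_gt0// exprn_gt0.
    by have := Psi_step zn0; rewrite -mulrA; lra.
  have zn0 : 0 < 2 ^+ n * z by rewrite mulr_gt0// exprn_gt0.
  have /andP[_ h1] := Psi_bound zn0; have /andP[h2 _] := Psi_bound z0.
  by lra.
have su0 : 0 < s * u by exact: mulr_gt0.
have up : u `^ (- p) * u `^ p = 1.
  by rewrite powRN mulVf// gt_eqF// powR_gt0.
have := tel _ su0; move=> /(ler_wpM2r (powR_ge0 u p)).
rewrite mulr_suml; apply: le_trans; apply: ler_sum => i _.
have is0 : 0 <= 2 ^+ i * s by rewrite mulr_ge0 ?exprn_ge0// ltW.
have -> : 2 ^+ i * (s * u) = 2 ^+ i * s * u by rewrite mulrA.
rewrite (powRM _ is0 (ltW u0)).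
set A := (2 ^+ i * s) `^ (- p); set B := rhof _.
have -> : A * u `^ (- p) * B * u `^ p = A * B * (u `^ (- p) * u `^ p) by ring.
by rewrite up mulr1.
Qed.

End Potential.

(** Some scale 2^i / 2^N brings |y| into [1, 2), where phif is at least 1/2; if |y| <= 2^-N
    instead, |y|^p is absorbed by the error term. *)
Lemma dyadic_lower (p : R) (N : nat) (y : R) : 1 <= p -> `|y| <= 2 ^+ N ->
  `|y| `^ p <= 2 * 2 `^ p *
     \sum_(i < (2 * N).+1) (2 ^+ i * 2^-1 ^+ N) `^ (- p) * phif (2 ^+ i * 2^-1 ^+ N * y)
   + 2^-1 ^+ N.
Proof.
move=> p1 yN; set s := 2^-1 ^+ N.
have s0 : 0 < s by rewrite exprn_gt0// invr_gt0.
have sN : s * 2 ^+ N = 1 by rewrite /s -exprMn mulVf ?expr1n// pnatr_eq0.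
have p0 : 0 < p by lra.
set S := \sum_(i < _) _.
have S0 : 0 <= S by apply: sumr_ge0 => i _; rewrite mulr_ge0 ?powR_ge0// phif_ge0.
have C0 : 0 <= 2 * 2 `^ p :> R by rewrite mulr_ge0// powR_ge0.
have [ys|ys] := leP `|y| s.
  apply: le_trans (_ : s <= _); last by rewrite lerDr mulr_ge0.
  have [->|y0] := eqVneq y 0; first by rewrite normr0 powR0 ?gt_eqF ?ltW.
  apply: (le_trans _ ys); apply: ge1r_powR => //.
  rewrite normr_gt0 y0/=; apply: (le_trans ys).
  by rewrite /s exprn_ile1// ?invr_ge0// invf_le1 ?ler1n.
apply: le_trans (_ : 2 * 2 `^ p * S <= _); last by rewrite lerDl ltW.
have ex : exists i, 1 <= 2 ^+ i * s * `|y|.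
  exists (2 * N)%N.
  have -> : 2 ^+ (2 * N) * s = 2 ^+ N :> R.
    by rewrite mul2n -addnn exprD -mulrA (mulrC _ s) sN mulr1.
  by apply: le_trans (_ : 2 ^+ N * s <= _); [rewrite mulrC sN|rewrite ler_pM2l ?ltW// exprn_gt0].
pose i := ex_minn ex.
have [i1 imin] : 1 <= 2 ^+ i * s * `|y| /\ (forall j, 1 <= 2 ^+ j * s * `|y| -> (i <= j)%N).
  by rewrite /i; case: ex_minnP.
have y0 : 0 < `|y| by apply: lt_trans ys.
have i2 : 2 ^+ i * s * `|y| < 2.
  case: {1 2}i imin => [|j] imin.
    rewrite expr0 mul1r; apply: le_lt_trans (_ : s * 2 ^+ N < _).
      by rewrite ler_wpM2l// ltW.
    by rewrite sN ltr1n.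
  rewrite exprS ltNge; apply/negP => h.
  have : (j.+1 <= j)%N by apply: imin; rewrite -mulrA -(ler_pM2l (ltr0Sn R 1)) mulr1; lra.
  by rewrite ltnn.
have iN : (i < (2 * N).+1)%N.
  rewrite ltnS; apply: imin.
  have -> : 2 ^+ (2 * N) * s = 2 ^+ N :> R.
    by rewrite mul2n -addnn exprD -mulrA (mulrC _ s) sN mulr1.
  by apply: le_trans (_ : 2 ^+ N * s <= _); [rewrite mulrC sN|rewrite ler_pM2l ?ltW// exprn_gt0].
have is0 : 0 < 2 ^+ i * s by rewrite mulr_gt0// exprn_gt0.
have Si : (2 ^+ i * s) `^ (- p) * 2^-1 <= S.
  rewrite /S (bigD1 (Ordinal iN))//=.
  apply: le_trans (_ : (2 ^+ i * s) `^ (- p) * phif (2 ^+ i * s * y) <= _).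
    apply: ler_wpM2l; first exact: powR_ge0.
    by apply: phif_half; rewrite normrM (ger0_norm (ltW is0)).
  by rewrite lerDl; apply: sumr_ge0 => j _; rewrite mulr_ge0 ?powR_ge0// phif_ge0.
apply: le_trans (_ : 2 * 2 `^ p * ((2 ^+ i * s) `^ (- p) * 2^-1) <= _); last first.
  by rewrite ler_wpM2l.
have -> : 2 * 2 `^ p * ((2 ^+ i * s) `^ (- p) * 2^-1) = (2 / (2 ^+ i * s)) `^ p.
  move: (2 ^+ i * s) is0 => w w0; rewrite powRM ?invr_ge0 ?(ltW w0)//.
  have -> : w^-1 `^ p = w `^ (- p) by rewrite -powR_inv1 ?(ltW w0)// -powRrM mulN1r.
  by field.
apply: ge0_ler_powR; rewrite ?nnegrE ?divr_ge0 ?(ltW is0)// ?(ltW p0)//.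
by rewrite ler_pdivlMr// mulrC ltW.
Qed.

End Dyadic.

(** * Conjugates of real trigonometric polynomials *)

Section RealConjugate.
Context {R : realType}.
Local Notation C := R[i].
Local Notation F := (C -> C).
Local Notation T := (measurableTypeR R).
Local Notation mu := (@arc_length R).

Lemma bm_Psum (p : R) (h : R -> R) (N : nat) (s : R) (u : T -> R) :
  (forall a, 0 < a -> bm (fun x : T => h (a * u x))) -> 0 < s ->
  bm (fun x : T => \sum_(i < N) (2 ^+ i * s) `^ (- p) * h (2 ^+ i * s * u x)) /\
  Rint (fun x : T => \sum_(i < N) (2 ^+ i * s) `^ (- p) * h (2 ^+ i * s * u x)) =
  \sum_(i < N) (2 ^+ i * s) `^ (- p) * Rint (fun x : T => h (2 ^+ i * s * u x)).
Proof.
move=> bh s0.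
have b i : bm (fun x : T => (2 ^+ i * s) `^ (- p) * h (2 ^+ i * s * u x)).
  by apply: bmZ; apply: bh; rewrite mulr_gt0// exprn_gt0.
split; first exact: (bm_sum N b).
rewrite (Rint_sum N b); apply: eq_bigr => i _.
by rewrite RintZ//; apply: bh; rewrite mulr_gt0// exprn_gt0.
Qed.

(** Sum the estimate at scale s with weight s^(-p) over s = 2^i / 2^N, i <= 2N, and let N
    tend to infinity. *)
Lemma conjugate_pos (p : R) : 1 < p < 2 -> exists2 K, 0 <= K & forall (G : {poly C}) m,
  (forall x : R, 0 < complex.Re G.[expi x]) -> G`_0 = (m%:C)%C ->
  Rint (fun x => `|complex.Im G.[expi x]| `^ p) <=
  K * Rint (fun x => complex.Re G.[expi x] `^ p).
Proof.
move=> p12; have /andP[p1 p2] := p12.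
have [K K0 up] := dyadic_upper p12.
have C0 : 0 <= 2 * 2 `^ p :> R by rewrite mulr_ge0// powR_ge0.
exists (2 * 2 `^ p * (24 * K)); first by rewrite mulr_ge0// mulr_ge0.
move=> G m G0 Gm.
have bR := bm_Re_poly G; have bI := bm_Im_poly G.
have p0 : 0 <= p by lra.
have bRp : bm (fun x : T => complex.Re G.[expi x] `^ p).
  by apply: bm_powR => // x; exact: ltW.
have bIp : bm (fun x : T => `|complex.Im G.[expi x]| `^ p).
  by apply: bm_powR => //; exact: bm_abs.
have [M0 M00 hM0] := poly_bounded G.
have [N0 MN0] : exists N, M0 <= 2 ^+ N.
  have := bernoulli_add (Num.truncn M0).+1 (@ler01 R).
  move=> h; exists (Num.truncn M0).+1; apply: le_trans h; rewrite mulr1.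
  by apply: ltW; apply: lt_le_trans (truncnS_gt M0) _; rewrite lerDr.
set L := Rint _; set J := Rint _.
have main N : (N0 <= N)%N -> L <= 2 * 2 `^ p * (24 * K) * J + 2^-1 ^+ N * (2 * pi).
  move=> N0N; have s0 : 0 < 2^-1 ^+ N :> R by rewrite exprn_gt0// invr_gt0.
  have [b1 i1] := @bm_Psum p phif (2 * N).+1 (2^-1 ^+ N) (fun x => complex.Im G.[expi x])
    (fun a a0 => bm_phif (bmZ a bI)) s0.
  have [b2 i2] := @bm_Psum p rhof (2 * N).+1 (2^-1 ^+ N) (fun x => complex.Re G.[expi x])
    (fun a a0 => bm_rhof (bmZ a bR) (fun x => mulr_ge0 (ltW a0) (ltW (G0 x)))) s0.
  have pt (x : T) : `|complex.Im G.[expi x]| `^ p <= 2 * 2 `^ p *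
     (\sum_(i < (2 * N).+1) (2 ^+ i * 2^-1 ^+ N) `^ (- p) *
        phif (2 ^+ i * 2^-1 ^+ N * complex.Im G.[expi x])) + 2^-1 ^+ N.
    apply: dyadic_lower; first exact: ltW.
    apply: le_trans (normc_Im _) _; apply: le_trans (hM0 x) _; apply: le_trans MN0 _.
    by apply: ler_weXn2l => //; rewrite ler1n.
  have := Rint_le bIp (bmD (bmZ _ b1) (bm_cst _)) pt.
  rewrite (RintD (bmZ _ b1) (bm_cst _)) (RintZ _ b1) Rint_cst i1 -/L => h1.
  apply: le_trans h1 _; rewrite lerD2r -[leRHS]mulrA; apply: ler_wpM2l => //.
  apply: le_trans (_ : 24 * \sum_(i < (2 * N).+1) (2 ^+ i * 2^-1 ^+ N) `^ (- p) *
     Rint (fun x : T => rhof (2 ^+ i * 2^-1 ^+ N * complex.Re G.[expi x])) <= _).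
    rewrite mulr_sumr; apply: ler_sum => i _; rewrite mulrCA; apply: ler_wpM2l.
      exact: powR_ge0.
    by apply: (conjugate_scale _ G0 Gm); rewrite mulr_gt0// exprn_gt0.
  rewrite -[leRHS]mulrA; apply: ler_wpM2l => //; rewrite -i2 -(RintZ _ bRp).
  by apply: Rint_le => //; [exact: bmZ|move=> x; exact: up].
have pi0 := pi2_gt0 (R := R).
apply/ler_addgt0Pr => e e0.
have r1 : `|2^-1 : R| < 1 by rewrite ger0_norm ?invr_ge0// invf_lt1// ltr1n.
have e1 : 0 < e / (2 * pi) by rewrite divr_gt0.
have /cvgrPdist_lt/(_ _ e1)[N1 _ hN] := cvg_expr r1.
have := hN (maxn N0 N1) (leq_maxr _ _).
rewrite /= sub0r normrN ger0_norm ?exprn_ge0 ?invr_ge0// ltr_pdivlMr// => rN.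
by apply: le_trans (main _ (leq_maxl N0 N1)) _; rewrite lerD2l ltW.
Qed.

(** The analytic polynomial with the same real part on the circle as the given
    trigonometric polynomial: a negative frequency is folded over by conjugating its term. *)
Definition anp (s : seq (C * int)) : {poly C} :=
  \sum_(ck <- s) (if 0 <= ck.2 then ck.1 else conjc ck.1) *: 'X^`|ck.2|.

Lemma anp_cat s1 s2 : anp (s1 ++ s2) = anp s1 + anp s2.
Proof. by rewrite /anp big_cat. Qed.

Lemma anp_cons c s : anp (c :: s) =
  (if 0 <= c.2 then c.1 else conjc c.1) *: 'X^`|c.2| + anp s.
Proof. by rewrite /anp big_cons. Qed.

Lemma anp_scale (r : R) s : anp [seq ((r%:C)%C * a.1, a.2) | a <- s] = (r%:C)%C *: anp s.
Proof.
rewrite /anp big_map scaler_sumr; apply: eq_bigr => -[c k] _ /=; rewrite scalerA.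
by case: ifP => // _; rewrite conjcM /= oppr0.
Qed.

Lemma Re_anp s (x : R) : complex.Re (anp s).[expi x] = complex.Re (teval s (expi x)).
Proof.
elim: s => [|[c k] s IH]; first by rewrite /anp teval_nil big_nil horner0.
rewrite anp_cons teval_cons hornerD !ReD IH; congr (_ + _).
rewrite hornerZ hornerXn /=; case: k => k /=.
  by rewrite exprnP.
rewrite -[in RHS]Re_conj conjcM; congr (complex.Re (_ * _)).
by rewrite expiXz conj_expi -expiN expiX; congr (expi _); rewrite NegzE mulrNz mulNr opprK.
Qed.

Lemma anp0 s : (anp s)`_0 = fourier (teval s) 0.
Proof.
rewrite fourier_teval big_mkcond /anp coef_sum; apply: eq_bigr => -[c k] _ /=.
rewrite coefZ coefXn eq_sym absz_eq0; case: eqP => [->|_]; last by rewrite mulr0.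
by rewrite lexx mulr1.
Qed.

Lemma teval_conj (s : seq (C * int)) (x : R) :
  teval [seq (conjc a.1, - a.2) | a <- s] (expi x) = conjc (teval s (expi x)).
Proof.
elim: s => [|[c k] s IH]; first by rewrite teval_nil conjc0.
rewrite /= !teval_cons IH conjcD conjcM /=; congr (_ * _ + _).
by rewrite !expiXz conj_expi -expiN mulrNz mulNr.
Qed.

Lemma rtrig_Re (s : seq (C * int)) : rtrig (fun x => complex.Re (teval s (expi x))).
Proof.
exists [seq (2^-1 * a.1, a.2) | a <- s ++ [seq (conjc a.1, - a.2) | a <- s]] => x.
rewrite teval_scale teval_cat.
rewrite teval_conj.
have -> : (2^-1 : C) = ((2^-1 : R)%:C)%C by rewrite fmorphV rmorph_nat.
by apply: complex_ext; rewrite ?ReM ?ImM ?ImD ?ReD Re_conj Im_conj /=; lra.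
Qed.

(** The iteration r -> r + (y^2 - r^2) / 2, which increases to |y| on [-1, 1] and stays
    polynomial in y. *)
Fixpoint abs_poly (y : R) (k : nat) : R :=
  if k is k'.+1 then abs_poly y k' + (y ^+ 2 - abs_poly y k' ^+ 2) / 2 else 0.

Lemma abs_poly_bound y k : `|y| <= 1 ->
  0 <= abs_poly y k <= `|y| /\ `|y| - abs_poly y k <= `|y| * (1 - `|y| / 2) ^+ k.
Proof.
have -> : abs_poly y k = abs_poly `|y| k.
  by elim: k => //= k ->; rewrite real_normK ?num_real.
move: (normr_ge0 y); move: `|y| => {}y y0 y1.
elim: k => [|k [/andP[h0 h1] h2]]; first by rewrite /= expr0 lexx y0 subr0 mulr1.
rewrite /=; move: (abs_poly y k) h0 h1 h2 => r r0 r1 h.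
split; first by apply/andP; split; nra.
rewrite [_ ^+ k.+1]exprSr mulrA; apply: le_trans (_ : (y - r) * (1 - y / 2) <= _); first by nra.
by apply: ler_wpM2r => //; lra.
Qed.

(** Each step multiplies the error by at most 1 - |y|/2, and |y| (1 - |y|/2)^k is of order
    1/k by the Bernoulli inequality. *)
Lemma abs_poly_close y k : `|y| <= 1 -> `|y| - abs_poly y k <= 2 / k.+1%:R.
Proof.
move=> y1; have [_ h] := abs_poly_bound k y1; apply: le_trans h _.
move: (normr_ge0 y) y1; move: `|y| => {}y y0 y1.
have z0 : 0 <= y / 2 by lra.
have h1 := bernoulli_add k z0.
have h2 : (1 - y / 2) ^+ k * (1 + y / 2) ^+ k <= 1.
  by rewrite -exprMn exprn_ile1//; nra.
rewrite ler_pdivlMr ?ltr0Sn// mulrSr.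
have a0 : 0 <= (1 - y / 2) ^+ k by rewrite exprn_ge0//; lra.
have k0 : 0 <= k%:R :> R by rewrite ler0n.
have ay : y * (1 - y / 2) ^+ k <= (1 - y / 2) ^+ k by rewrite ler_piMl.
have h3 : (1 - y / 2) ^+ k * (1 + k%:R * (y / 2)) <= 1.
  by apply: le_trans h2; exact: ler_wpM2l.
by nra.
Qed.

Lemma rtrig_abs_poly w k : rtrig w -> rtrig (fun x => abs_poly (w x) k).
Proof.
move=> hw; elim: k => [|k IH] /=; first exact: rtrig_cst.
apply: rtrigD => //; apply: rtrigM; last exact: rtrig_cst.
by apply: rtrigB; exact: rtrigX.
Qed.

(** Rescale w into [-1, 1] and apply the polynomials that approximate the absolute value
    there. *)
Lemma rtrig_abs (w : R -> R) (e : R) : rtrig w -> 0 < e ->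
  exists2 r, rtrig r & forall x, `|w x| - e <= r x <= `|w x|.
Proof.
move=> hw e0; have [_ [M M0 wM]] := rtrig_bounded hw.
pose B := M + 1; have B0 : 0 < B by rewrite /B; lra.
have hy : rtrig (fun x => B^-1 * w x) by apply: rtrigM => //; exact: rtrig_cst.
pose k := Num.truncn (2 * B / e).
exists (fun x => B * abs_poly (B^-1 * w x) k).
  by apply: rtrigM; [exact: rtrig_cst|exact: (rtrig_abs_poly k hy)].
move=> x.
have yE : B * `|B^-1 * w x| = `|w x|.
  by rewrite normrM (ger0_norm (_ : 0 <= B^-1)) ?invr_ge0 ?(ltW B0)// mulVKf// gt_eqF.
have y1 : `|B^-1 * w x| <= 1.
  rewrite -(ler_pM2l B0) yE mulr1; apply: le_trans (wM x) _; rewrite /B; lra.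
have [/andP[_ h1] _] := abs_poly_bound k y1.
have h2 := abs_poly_close k y1.
have hk : B * (2 / k.+1%:R) <= e.
  rewrite mulrA ler_pdivrMr ?ltr0Sn// -ler_pdivrMl// mulrC [B * 2]mulrC.
  exact: ltW (truncnS_gt _).
apply/andP; split; last by rewrite -[leRHS]yE ler_pM2l.
rewrite -yE; move: h2; rewrite -(ler_pM2l B0) mulrBr.
move: (B * _) (B * _) (B * _) hk => b1 b2 b3 hk h2; lra.
Qed.

Lemma powR_add_le (p a b : R) : 1 <= p -> 0 <= a -> 0 <= b ->
  (a + b) `^ p <= 2 `^ p * (a `^ p + b `^ p).
Proof.
move=> p1 a0 b0; have p0 : 0 <= p by lra.
wlog ab : a b a0 b0 / a <= b => [H|].
  by case/orP: (le_total a b) => h; [exact: H|rewrite addrC [X in _ * X]addrC; exact: H].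
apply: le_trans (_ : (2 * b) `^ p <= _).
  by apply: ge0_ler_powR; rewrite ?nnegrE ?addr_ge0 ?mulr_ge0//; lra.
by rewrite powRM//; apply: ler_wpM2l; rewrite ?powR_ge0// lerDr powR_ge0.
Qed.

(** The conjugate function, normalized to have mean zero, is bounded in the L^p norm by the
    real part. *)
Definition conj_bound (p : R) := exists2 K, 0 <= K & forall s,
  Rint (fun x => `|complex.Im (anp s).[expi x] - complex.Im (anp s)`_0| `^ p) <=
  K * Rint (fun x => `|complex.Re (teval s (expi x))| `^ p).

(** The mean of G^2 is G(0)^2, whose real part is nonnegative when G(0) is real. *)
Lemma conj_bound2 : conj_bound 2.
Proof.
exists 1 => // s; rewrite mul1r.
pose c := complex.Im (anp s)`_0.
(* subtracting the imaginary mean makes G(0) real *)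
pose G : {poly C} := anp s - (Complex 0 c)%:P.
have GE (x : R) : G.[expi x] = (anp s).[expi x] - Complex 0 c by rewrite /G !hornerE.
have GR (x : R) : complex.Re G.[expi x] = complex.Re (teval s (expi x)).
  by rewrite GE ReD /= oppr0 addr0 Re_anp.
have GI (x : R) : complex.Im G.[expi x] = complex.Im (anp s).[expi x] - c by rewrite GE ImD.
have G0 : complex.Im G`_0 = 0 by rewrite /G coefB coefC eqxx ImD /= subrr.
have bR := bm_Re_poly G; have bI := bm_Im_poly G.
have h := Rint_Re_poly (G ^+ 2).
have e2 (x : R) : complex.Re (G ^+ 2).[expi x] =
   complex.Re G.[expi x] ^+ 2 - complex.Im G.[expi x] ^+ 2.
  by rewrite horner_exp expr2 ReM !expr2.
have e0 : complex.Re (G ^+ 2)`_0 = (complex.Re G`_0) ^+ 2.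
  by rewrite expr2 coef0M ReM G0 mul0r subr0 expr2.
have eR : Rint (fun x : T => `|complex.Re (teval s (expi x))| `^ 2) =
    Rint (fun x : T => complex.Re G.[expi x] ^+ 2).
  by congr Rint; apply/funext => x; rewrite -GR powR_mulrn// real_normK ?num_real.
have eI : Rint (fun x : T => `|complex.Im (anp s).[expi x] - c| `^ 2) =
    Rint (fun x : T => complex.Im G.[expi x] ^+ 2).
  by congr Rint; apply/funext => x; rewrite -GI powR_mulrn// real_normK ?num_real.
rewrite eR eI.
have : Rint (fun x : T => complex.Re G.[expi x] ^+ 2) = 2 * pi * complex.Re G`_0 ^+ 2 +
    Rint (fun x : T => complex.Im G.[expi x] ^+ 2).
  rewrite -e0 -h -RintD; [|exact: bm_Re_poly|exact: bmX].
  by congr Rint; apply/funext => x; rewrite e2 subrK.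
move=> ->; rewrite lerDr mulr_ge0 ?sqr_ge0//; exact: ltW (pi2_gt0 (R := R)).
Qed.

(** Up to e, the real part w is the difference of the positive functions (|w| + w)/2 and
    (|w| - w)/2; replacing |w| by a trigonometric polynomial makes conjugate_pos applicable
    to both. *)
Lemma conj_bound_lt2 p : 1 < p < 2 -> conj_bound p.
Proof.
move=> p12; have /andP[p1 p2] := p12.
have p0 : 0 <= p by lra.
have p1' : 1 <= p by lra.
have [K K0 hK] := conjugate_pos p12.
pose A : R := 2 `^ p; have A0 : 0 <= A by exact: powR_ge0.
exists (A * (2 * (K * A))); first by rewrite !mulr_ge0.
move=> s; pose w x := complex.Re (teval s (expi x)).
have [_ [M M0 wM]] := rtrig_bounded (rtrig_Re s).
have bw : bm (w : T -> R) by rewrite /w; split; [have [[]] := bdd_teval s|exists M].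
have bwp : bm (fun x : T => `|w x| `^ p) by apply: bm_powR => //; exact: bm_abs.
pose ims s' (x : T) := complex.Im (anp s').[expi x] - complex.Im (anp s')`_0.
have bims s' : bm (ims s').
  by apply: bmD; [exact: bm_Im_poly|exact: bm_cst].
have bimsp s' : bm (fun x : T => `|ims s' x| `^ p) by apply: bm_powR => //; exact: bm_abs.
have pos s' : (forall x : R, 0 < complex.Re (teval s' (expi x))) ->
    Rint (fun x : T => `|ims s' x| `^ p) <=
    K * Rint (fun x : T => complex.Re (teval s' (expi x)) `^ p).
  move=> pos; pose c := complex.Im (anp s')`_0.
  pose G : {poly C} := anp s' - (Complex 0 c)%:P.
  have GE (x : R) : G.[expi x] = (anp s').[expi x] - Complex 0 c by rewrite /G !hornerE.
  have GR (x : R) : complex.Re G.[expi x] = complex.Re (teval s' (expi x)).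
    by rewrite GE ReD /= oppr0 addr0 Re_anp.
  have G0 : G`_0 = ((complex.Re (anp s')`_0)%:C)%C.
    by rewrite /G coefB coefC eqxx /=; apply: complex_ext; rewrite ?ReD ?ImD /=; lra.
  have Gp (x : R) : 0 < complex.Re G.[expi x] by rewrite GR.
  have := hK G _ Gp G0.
  have -> : Rint (fun x : T => `|complex.Im G.[expi x]| `^ p) =
      Rint (fun x : T => `|ims s' x| `^ p).
    by congr Rint; apply/funext => x; rewrite GE ImD.
  have -> // : Rint (fun x : T => complex.Re G.[expi x] `^ p) =
      Rint (fun x : T => complex.Re (teval s' (expi x)) `^ p).
  by congr Rint; apply/funext => x; rewrite GR.
have pi0 := pi2_gt0 (R := R).
have main e : 0 < e <= 1 -> Rint (fun x : T => `|ims s x| `^ p) <=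
    A * (2 * (K * A)) * Rint (fun x : T => `|w x| `^ p) + A * (2 * (K * A)) * (2 * pi) * e.
  move=> /andP[e0 e1]; have e20 : 0 < e / 2 by lra.
  have [r [sr hr] rw] := rtrig_abs (rtrig_Re s) e20.
  (* s1 and s2 represent (r + w + e)/2 and (r - w + e)/2, with real parts in (0, |w| + e] *)
  pose s1 := [seq ((2^-1%:C)%C * a.1, a.2) | a <- sr ++ s] ++ [:: (((e / 2)%:C)%C, 0)].
  pose s2 := s1 ++ [seq (((-1)%:C)%C * a.1, a.2) | a <- s].
  have E1 (x : R) : complex.Re (teval s1 (expi x)) = (r x + w x) / 2 + e / 2.
    rewrite /s1 teval_cat teval_scale teval_cat /= hr teval_cons teval_nil expr0z mulr1 /=.
    by rewrite !ReD ReM ReD ImD /= /w; lra.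
  have E2 (x : R) : complex.Re (teval s2 (expi x)) = (r x - w x) / 2 + e / 2.
    by rewrite /s2 teval_cat teval_scale ReD E1 ReM /= mul0r subr0 -/(w x); lra.
  have rwx (x : R) : `|w x| - e / 2 <= r x <= `|w x| := rw x.
  have P1 (x : R) : 0 < complex.Re (teval s1 (expi x)).
    by rewrite E1; have /andP[] := rwx x; have := ler_norm (- w x); rewrite normrN; lra.
  have P2 (x : R) : 0 < complex.Re (teval s2 (expi x)).
    by rewrite E2; have /andP[] := rwx x; have := ler_norm (w x); lra.
  have U1 (x : R) : complex.Re (teval s1 (expi x)) <= `|w x| + e.
    by rewrite E1; have /andP[] := rwx x; have := ler_norm (w x); lra.
  have U2 (x : R) : complex.Re (teval s2 (expi x)) <= `|w x| + e.
    by rewrite E2; have /andP[] := rwx x; have := ler_norm (- w x); rewrite normrN; lra.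
  have J s' : (forall x : R, 0 < complex.Re (teval s' (expi x))) ->
     (forall x : R, complex.Re (teval s' (expi x)) <= `|w x| + e) ->
     Rint (fun x : T => `|ims s' x| `^ p) <=
       K * A * (Rint (fun x : T => `|w x| `^ p) + e * (2 * pi)).
    move=> P U; apply: le_trans (pos s' P) _; rewrite -mulrA; apply: ler_wpM2l => //.
    rewrite -Rint_cst -RintD//; last exact: bm_cst.
    have bs' : bm (fun x : T => `|w x| `^ p + e) by apply: bmD => //; exact: bm_cst.
    rewrite -RintZ//; apply: Rint_le => //.
    - apply: bm_powR => //; last by move=> x; exact: ltW.
      have [_ [M' _ M'h]] := rtrig_bounded (rtrig_Re s').
      by split; [have [[]] := bdd_teval s'|exists M'].
    - exact: bmZ.
    - move=> x; apply: le_trans (_ : (`|w x| + e) `^ p <= _).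
        by apply: ge0_ler_powR; rewrite ?nnegrE ?addr_ge0 ?(ltW e0) ?(ltW (P x)).
      apply: le_trans (powR_add_le p1' (normr_ge0 _) (ltW e0)) _.
      apply: ler_wpM2l => //; rewrite lerD2l; apply: ge1r_powR => //.
      by rewrite e0.
  have H1 := J s1 P1 U1; have H2 := J s2 P2 U2.
  have E (x : T) : ims s x = ims s1 x - ims s2 x.
    rewrite /ims.
    have -> : anp s2 = anp s1 + ((-1)%:C)%C *: anp s by rewrite /s2 anp_cat anp_scale.
    rewrite hornerD coefD hornerZ coefZ !ImD !ImM /= !mul0r !addr0 !mulN1r.
    move: (complex.Im (anp s).[expi x]) (complex.Im (anp s)`_0) => c d.
    move: (complex.Im (anp s1).[expi x]) (complex.Im (anp s1)`_0) => c1 d1.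
    by clear; ring.
  have pt (x : T) : `|ims s x| `^ p <= A * (`|ims s1 x| `^ p + `|ims s2 x| `^ p).
    rewrite E; apply: le_trans (powR_add_le p1' (normr_ge0 _) (normr_ge0 _)).
    by apply: ge0_ler_powR; rewrite ?nnegrE ?addr_ge0//; exact: ler_normB.
  have := Rint_le (bimsp s) (bmZ _ (bmD (bimsp s1) (bimsp s2))) pt.
  rewrite RintZ; last exact: bmD.
  rewrite RintD// => h; apply: le_trans h _; rewrite -!mulrA -mulrDr; apply: ler_wpM2l => //.
  apply: le_trans (lerD H1 H2) _; move: (Rint _) => I.
  by rewrite le_eqVlt; apply/orP; left; apply/eqP; ring.
rewrite -/(ims s) -/w.
set B := A * (2 * (K * A)); have B0 : 0 <= B by rewrite !mulr_ge0.
apply/ler_addgt0Pr => e e0.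
set D := B * (2 * pi) + 1; have D0 : 0 < D by rewrite ltr_wpDl// mulr_ge0// ltW.
pose e' := Num.min 1 (e / D).
have e'0 : 0 < e' <= 1 by rewrite /e' lt_min ltr01 divr_gt0//= ge_min lexx.
apply: le_trans (main _ e'0) _; rewrite lerD2l.
apply: le_trans (_ : D * e' <= _).
  by apply: ler_wpM2r; [case/andP: e'0 => /ltW|rewrite /D -/B lerDl].
apply: le_trans (_ : D * (e / D) <= _); last by rewrite mulrCA divff ?mulr1// gt_eqF.
by rewrite ler_pM2l// /e' ge_min lexx orbT.
Qed.

End RealConjugate.

(** * Boundedness of the Riesz projection *)

Section RieszProjection.
Context {R : realType}.
Local Notation C := R[i].
Local Notation F := (C -> C).
Local Notation T := (measurableTypeR R).
Local Notation mu := (@arc_length R).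

Lemma small_le (a b D : R) : (forall k, a <= b + D * 2^-1 ^+ k) -> a <= b.
Proof.
move=> h; apply/ler_addgt0Pr => e e0.
have D0 : 0 < `|D| + 1 by apply: ltr_wpDl.
have r1 : `|2^-1 : R| < 1 by rewrite ger0_norm ?invr_ge0// invf_lt1// ltr1n.
have e1 : 0 < e / (`|D| + 1) by rewrite divr_gt0.
have /cvgrPdist_lt/(_ _ e1)[N _ /(_ N (leqnn N))] := cvg_expr r1.
rewrite /= sub0r normrN ger0_norm ?exprn_ge0 ?invr_ge0// ltr_pdivlMr// => rN.
apply: le_trans (h N) _; rewrite lerD2l.
have r0 : 0 <= 2^-1 ^+ N :> R by rewrite exprn_ge0// invr_ge0.
by have := ler_norm D; nra.
Qed.

Lemma small_eq0 (z : C) (D : R) : (forall k, nc z <= D * 2^-1 ^+ k) -> z = 0.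
Proof.
move=> h; apply: Normc.eq0_normc; apply/eqP; rewrite eq_le normc_ge0 andbT.
by apply: (@small_le _ _ D) => k; rewrite add0r.
Qed.

Lemma nrm_Rint p (f : F) : 0 < p -> Lp p%:E f ->
  nrm p f `^ p = Rint (fun x => mag f x `^ p).
Proof. by move=> p0 Lf; rewrite /Rint /Rintegral -nrm_powR. Qed.

(** Integral estimates of p-th powers are turned into estimates of norms here. *)
Lemma nrm_le_of_powR p (K : R) (f g : F) : 0 < p -> 0 <= K ->
  nrm p f `^ p <= K * nrm p g `^ p -> nrm p f <= K `^ p^-1 * nrm p g.
Proof.
move=> p0 K0 h; have f0 := nrm_ge0 p f; have g0 := nrm_ge0 p g.
have e z : 0 <= z -> (z `^ p) `^ p^-1 = z by move=> z0; rewrite -powRrM divff ?gt_eqF// powRr1.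
rewrite -(e _ f0) -(e _ g0) -powRM ?powR_ge0//.
apply: ge0_ler_powR; rewrite ?nnegrE ?invr_ge0 ?(ltW p0) ?powR_ge0 ?mulr_ge0 ?powR_ge0//.
Qed.

Lemma bdd_horner (G : {poly C}) : @bdd R (fun t => G.[t]).
Proof.
have -> : (fun t : C => G.[t]) = teval (pseq G) by apply/funext => t; rewrite teval_pseq.
exact: bdd_teval.
Qed.

Lemma cmeas_ReIm (f : F) : cmeas f ->
  cmeas (fun t => ((complex.Re (f t))%:C)%C) /\ cmeas (fun t => ((complex.Im (f t))%:C)%C).
Proof. by move=> [mr mi]; split; split => //=; exact: measurable_cst. Qed.

(** On the circle the polynomial is Re + i (Im - mean) + i mean; the second term is covered
    by the conjugate function bound and the mean by the Fourier coefficient at 0. *)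
Lemma anp_bound p : 1 < p -> @conj_bound R p -> exists2 D, 0 <= D & forall s,
  nrm p (fun t => (anp s).[t]) <= D * nrm p (@teval R s).
Proof.
move=> p1 [K K0 hK]; have p0 : 0 < p by lra.
have p1' : 1 <= p by lra.
have [K1 K10 L1] := Lp_L1 p1.
have Lc (c : C) : Lp p%:E (fun=> c) /\ nrm p (fun=> c) = nc c * nrm p (fun=> (1 : C)).
  have L1' := bdd_Lp p1' (@bdd_cst R 1).
  have -> : (fun=> c) = (fun t : C => c * 1) by apply/funext => t; rewrite mulr1.
  exact: (LpZ c p0 L1').
pose W := nrm p (fun=> (1 : C)); have W0 : 0 <= W by exact: nrm_ge0.
exists (1 + K `^ p^-1 + 2 * K1 * W) => [|s].
  by rewrite !addr_ge0 ?powR_ge0// !mulr_ge0.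
pose u : F := teval s; have Lu : Lp p%:E u := Lp_teval s p1'.
have n0 := nrm_ge0 p u.
pose c := complex.Im (anp s)`_0.
have mA : cmeas (fun t => (anp s).[t]) := cmeas_poly (anp s).
pose RA : F := fun t => ((complex.Re (u t))%:C)%C.
pose IA : F := fun t => ((complex.Im (anp s).[t] - c)%:C)%C.
have [LR nR] : Lp p%:E RA /\ nrm p RA <= nrm p u.
  apply: Lp_le => //; first by have [] := cmeas_ReIm (Lp_cmeas Lu).
  by apply: aeW => x; rewrite /mag /RA normc_real; exact: normc_Re.
have magI x : mag IA x = `|complex.Im (anp s).[expi x] - c| by rewrite /mag /IA normc_real.
have LI : Lp p%:E IA.
  apply: bdd_Lp => //; have [M0 [M hM]] := bm_Im_poly (anp s).
  apply: (@bdd_intro _ _ (M + `|c|)).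
    split => /=; last exact: measurable_cst.
    by apply: measurable_funB; [exact: M0|exact: measurable_cst].
  by move=> x; rewrite magI; apply: le_trans (ler_normB _ _) _; rewrite lerD2r.
have nI : nrm p IA <= K `^ p^-1 * nrm p RA.
  apply: nrm_le_of_powR => //; rewrite !nrm_Rint//.
  have -> : Rint (fun x : T => mag IA x `^ p) =
     Rint (fun x : T => `|complex.Im (anp s).[expi x] - c| `^ p).
    by congr Rint; apply/funext => x; rewrite magI.
  apply: le_trans (hK s) _; rewrite le_eqVlt; apply/orP; left; apply/eqP; congr (_ * _).
  by congr Rint; apply/funext => x; rewrite /mag /RA normc_real.
have cb : `|c| <= 2 * (K1 * nrm p u).
  apply: le_trans (normc_Im _) _; rewrite anp0.
  have [Lu1 nu1] := L1 _ Lu; apply: le_trans (fourier_le 0 Lu1) _.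
  by rewrite ler_pM2l.
have [LiI niI] := LpZ (Complex 0 1) p0 LI.
have [Lc1 nc1] := Lc (Complex 0 c).
have [LS nS] := LpD p1' LR LiI.
have [LS2 nS2] := LpD p1' LS Lc1.
have E : circ_eq (fun t => RA t + Complex 0 1 * IA t + Complex 0 c) (fun t => (anp s).[t]).
  apply: aeW => x; rewrite /RA /IA; apply: complex_ext; rewrite ?ReD ?ImD ?ReM ?ImM /=.
    by rewrite -Re_anp; move: (complex.Re _) (complex.Im _) => a b; ring.
  by move: (complex.Im _) => b; ring.
have [_ ->] := Lp_ae p0 mA LS2 E.
apply: le_trans nS2 _.
have ni : nc (Complex 0 1 : C) = 1 by rewrite /nc expr0n expr1n add0r sqrtr1.
have ncc : nc (Complex 0 c : C) = `|c| by rewrite /nc expr0n add0r sqrtr_sqr.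
rewrite nc1 ncc -/W; rewrite niI ni mul1r in nS.
have h1 : `|c| * W <= 2 * (K1 * nrm p u) * W by apply: ler_wpM2r.
have h2 : K `^ p^-1 * nrm p RA <= K `^ p^-1 * nrm p u by apply: ler_wpM2l => //; exact: powR_ge0.
move: (nrm p (fun t => RA t + _)) nS => S nS.
move: (nrm p IA) (nrm p RA) (nrm p u) (K `^ p^-1) (`|c| * W) nS nI nR h1 h2.
by clear => *; lra.
Qed.

Definition tproj (s : seq (C * int)) := [seq ck <- s | 0 <= ck.2].

Definition proj_bound (p : R) := exists2 D, 0 <= D & forall s,
  nrm p (teval (tproj s)) <= D * nrm p (teval s).

(** Writing A s for the analytic completion, A s + i A (- i s) keeps twice the terms of
    nonnegative frequency and cancels the others, because A is only real linear. *)
Lemma tproj_anp s (x : R) : teval (tproj s) (expi x) =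
  2^-1 * ((anp s).[expi x] + Complex 0 1 * (anp [seq (Complex 0 (-1) * a.1, a.2) | a <- s]).[expi x]).
Proof.
have i2 : Complex 0 1 * Complex 0 1 = -1 :> C by apply: complex_ext; rewrite ?ReM ?ImM /=; lra.
have i3 : Complex 0 1 * Complex 0 (-1) = 1 :> C by apply: complex_ext; rewrite ?ReM ?ImM /=; lra.
have h2 : 2^-1 * (1 + 1) = 1 :> C by rewrite mulVf// pnatr_eq0.
elim: s => [|[c k] s IH].
  by rewrite /= /anp teval_nil !big_nil !horner0 mulr0 addr0 mulr0.
rewrite /tproj /= -/(tproj s) !anp_cons !hornerD !hornerZ !hornerXn /=.
case: ifPn => k0.
  rewrite teval_cons IH /=.
  have -> : expi x ^ k = expi x ^+ `|k| by case: k k0.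
  set e := expi x ^+ _; set a := _.[_]; set b := _.[_].
  have -> : 2^-1 * (c * e + a + Complex 0 1 * (Complex 0 (-1) * c * e + b)) =
    2^-1 * (1 + Complex 0 1 * Complex 0 (-1)) * c * e + 2^-1 * (a + Complex 0 1 * b) by ring.
  by rewrite i3 h2 mul1r.
rewrite IH; set e := expi x ^+ _; set a := _.[_]; set b := _.[_].
have -> : conjc (Complex 0 (-1) * c) = Complex 0 1 * conjc c.
  by rewrite conjcM /= opprK.
have -> : 2^-1 * (conjc c * e + a + Complex 0 1 * (Complex 0 1 * conjc c * e + b)) =
    2^-1 * (1 + Complex 0 1 * Complex 0 1) * conjc c * e + 2^-1 * (a + Complex 0 1 * b) by ring.
by rewrite i2 subrr mulr0 !mul0r add0r.
Qed.

Lemma proj_bound_le2 p : 1 < p <= 2 -> proj_bound p.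
Proof.
move=> /andP[p1 p2].
have cb : @conj_bound R p.
  move: p2; rewrite le_eqVlt => /orP[/eqP->|p2]; first exact: conj_bound2.
  by apply: conj_bound_lt2; rewrite p1.
have [D D0 hD] := anp_bound p1 cb.
have p0 : 0 < p by lra.
have p1' : 1 <= p by lra.
exists D => // s; pose s' := [seq (Complex 0 (-1) * a.1, a.2) | a <- s].
have Lu : Lp p%:E (teval s) := Lp_teval s p1'.
have nE : nrm p (teval s') = nrm p (teval s).
  have -> : teval s' = (fun t => Complex 0 (-1) * teval s t).
    by apply/funext => t; rewrite teval_scale.
  have [_ ->] := LpZ (Complex 0 (-1)) p0 Lu.
  by rewrite /nc expr0n sqrrN expr1n add0r sqrtr1 mul1r.
have LA := bdd_Lp p1' (bdd_horner (anp s)).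
have LB := bdd_Lp p1' (bdd_horner (anp s')).
have [LiB niB] := LpZ (Complex 0 1) p0 LB.
have [LS nS] := LpD p1' LA LiB.
have [L2 n2] := LpZ (2^-1 : C) p0 LS.
have E : circ_eq (fun t => 2^-1 * ((anp s).[t] + Complex 0 1 * (anp s').[t])) (teval (tproj s)).
  by apply: aeW => x; rewrite tproj_anp.
have [_ ->] := Lp_ae p0 (Lp_cmeas (Lp_teval (tproj s) p1')) L2 E.
have ni : nc (Complex 0 1 : C) = 1 by rewrite /nc expr0n expr1n add0r sqrtr1.
have n2' : nc (2^-1 : C) = 2^-1.
  have -> : (2^-1 : C) = ((2^-1 : R)%:C)%C by rewrite fmorphV rmorph_nat.
  by rewrite normc_real ger0_norm// invr_ge0.
rewrite n2 n2'; rewrite niB ni mul1r in nS.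
have h1 := hD s; have h2 := hD s'; rewrite nE in h2.
by lra.
Qed.

Lemma circ_int_fourier (f : F) : circ_int f = Complex (2 * pi) 0 * fourier f 0.
Proof.
rewrite /fourier mulrA divff ?pi2C_neq0// mul1r; apply: circ_int_ext => x.
by rewrite oppr0 expr0z mulr1.
Qed.

Lemma fourier_def (f : F) (n : int) :
  fourier f n = (Complex (2 * pi) 0)^-1 * circ_int (fun t => f t * t ^ (- n)).
Proof. by []. Qed.

Lemma circ_int_tproj s s' : circ_int (fun t => teval (tproj s) t * teval s' t) =
  circ_int (fun t => teval s t * teval [seq ck <- s' | (ck.2 : int) <= 0] t).
Proof.
have L1 (r : seq (C * int)) : Lp 1%:E (teval r) by exact: Lp_teval.
rewrite !circ_int_fourier !fourierM_teval// /tproj big_filter big_mkcond; congr (_ * _).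
apply: eq_bigr => -[c k] _ /=; rewrite sub0r !fourier_teval big_filter_cond.
case: ifPn => k0.
  by congr (_ * _); apply: eq_bigl => -[d l] /=; case: eqP => [->|]; rewrite ?andbF// andbT oppr_le0.
rewrite big_pred0 ?mulr0// => -[d l] /=; apply/negbTE/negP => /andP[l0 /eqP e].
by move: k0; rewrite e in l0; rewrite oppr_le0 in l0; rewrite l0.
Qed.

(** For p > 2 the adjoint of the projection is the projection onto frequencies n <= 0 on
    L^q with q < 2, which is conjugate to P under t -> t^-1. *)
Lemma proj_bound_gt1 p : 1 < p -> proj_bound p.
Proof.
move=> p1; have [p2|p2] := leP p 2; first by apply: proj_bound_le2; rewrite p1.
have p0 : 0 < p by lra.
have p1' : 1 <= p by lra.
pose q := (1 - p^-1)^-1.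
have pq : p^-1 + q^-1 = 1 by rewrite /q invrK addrC subrK.
have [q1 _ qp] := conj_exp_mul p1 pq.
have q0 : 0 < q by lra.
have q1' : 1 <= q by lra.
have q2 : q <= 2.
  have pi2 : p^-1 < 2^-1 by rewrite ltf_pV2 ?posrE.
  by rewrite -[leRHS]invrK /q lef_pV2 ?posrE ?invr_gt0//; lra.
have q12 : 1 < q <= 2 by rewrite q1.
have [D D0 hD] := proj_bound_le2 q12.
exists (2 * D); first by rewrite mulr_ge0.
move=> s; have Ls := Lp_teval s p1'.
apply: (converse_hoelder q1 qp) => //.
- by rewrite mulr_ge0 ?nrm_ge0// mulr_ge0.
- exact: Lp_teval.
move=> s'; rewrite circ_int_tproj.
pose s1 := [seq (a.1, - a.2) | a <- s'].
have tE (r : seq (C * int)) (x : R) : teval [seq (a.1, - a.2) | a <- r] (expi x)^-1 = teval r (expi x).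
  rewrite /teval big_map; apply: eq_bigr => -[c k] _ /=.
  by rewrite exprz_inv opprK.
have n1 : nrm q (teval s1) = nrm q (teval s').
  have [Lt <-] := Lp_tilde q0 (Lp_teval s1 q1').
  have e : circ_eq (circ_tilde (teval s1)) (teval s') by apply: aeW => x; rewrite /circ_tilde tE.
  by have [_ ->] := Lp_ae q0 (Lp_cmeas (Lp_teval s' q1')) Lt e.
pose s2 := [seq ck <- s' | (ck.2 : int) <= 0].
have s2E : tproj s1 = [seq (a.1, - a.2) | a <- s2].
  rewrite /tproj /s1 /s2 filter_map; congr map; apply: eq_filter => -[c k] /=.
  by rewrite oppr_ge0.
have n2 : nrm q (teval s2) = nrm q (teval (tproj s1)).
  have [Lt <-] := Lp_tilde q0 (Lp_teval (tproj s1) q1').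
  have e : circ_eq (circ_tilde (teval (tproj s1))) (teval s2).
    by apply: aeW => x; rewrite /circ_tilde s2E tE.
  exact: (Lp_ae q0 (Lp_cmeas (Lp_teval s2 q1')) Lt e).2.
have [L1 h1] := hoelder_circ p0 q0 pq Ls (Lp_teval s2 q1').
apply: le_trans (circ_int_le L1) _.
apply: le_trans (_ : 2 * (nrm p (teval s) * nrm q (teval s2)) <= _).
  by rewrite ler_pM2l.
have := hD s1; rewrite n1 -n2 => h2.
have : nrm p (teval s) * nrm q (teval s2) <= nrm p (teval s) * (D * nrm q (teval s')).
  by apply: ler_wpM2l => //; exact: nrm_ge0.
set x := nrm p _; set y := nrm q (teval s2); set z := nrm q _ => h.
have -> : 2 * D * x * z = 2 * (x * (D * z)) by ring.
by rewrite ler_pM2l.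
Qed.

(** Extension of a bounded map from a dense set, seen along one approximating sequence: u
    stands for the approximants of f and v for their images. The rate of approximation
    makes v a fast Cauchy sequence. *)
Lemma limit_extension p (D : R) (f : F) (u v : nat -> F) : 1 < p -> 0 <= D -> Lp p%:E f ->
  (forall k, Lp p%:E (u k)) -> (forall k, Lp p%:E (v k)) ->
  (forall k, nrm p (fun t => f t - u k t) <= 2^-1 ^+ k / (2 * (D + 1))) ->
  (forall k, nrm p (fun t => v k.+1 t - v k t) <= D * nrm p (fun t => u k.+1 t - u k t)) ->
  (forall k, nrm p (v k) <= D * nrm p (u k)) ->
  exists h, [/\ Lp p%:E h, forall k, nrm p (fun t => h t - v k t) <= 2 * 2^-1 ^+ k &
    nrm p h <= D * nrm p f].
Proof.
move=> p1 D0 Lf Lu Lv hu hv vb; have p0 : 0 < p by lra.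
have p1' : 1 <= p by lra.
pose e (k : nat) : R := 2^-1 ^+ k / (2 * (D + 1)).
have r0 k : 0 <= 2^-1 ^+ k :> R by rewrite exprn_ge0// invr_ge0.
have De k : D * e k <= 2^-1 ^+ k / 2.
  rewrite /e mulrA ler_pdivrMr; last lra.
  by have := r0 k; nra.
have e1 k : e k <= 2^-1 ^+ k.
  rewrite /e ler_pdivrMr; last lra.
  by have := r0 k; nra.
have Lfu k : Lp p%:E (fun t => f t - u k t) by have [] := LpB p1' Lf (Lu k).
have vstep k : nrm p (fun t => v k.+1 t - v k t) <= 2^-1 ^+ k.
  apply: le_trans (hv k) _.
  have -> : (fun t => u k.+1 t - u k t) = (fun t => (f t - u k t) - (f t - u k.+1 t)).
    by apply/funext => t; ring.
  have [_ h] := LpB p1' (Lfu k) (Lfu k.+1).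
  apply: le_trans (_ : D * (e k + e k.+1) <= _).
    by apply: ler_wpM2l => //; apply: le_trans h _; exact: lerD.
  rewrite mulrDr; apply: le_trans (lerD (De k) (De k.+1)) _.
  by rewrite exprS; have := r0 k; lra.
have [h Lh hvk] := Lp_complete p1' Lv vstep.
have Lhv k : Lp p%:E (fun t => h t - v k t) by have [] := LpB p1' Lh (Lv k).
exists h; split=> //; apply: (@small_le _ _ (D + 2)) => k.
have [_ h1] := LpD p1' (Lhv k) (Lv k).
have [LN nN] := LpN p0 (Lfu k); have [_ h2] := LpD p1' LN Lf.
have E1 : (fun t => h t - v k t + v k t) = h by apply/funext => t; rewrite subrK.
have E2 : (fun t => - (f t - u k t) + f t) = u k by apply/funext => t; rewrite opprB subrK.
rewrite E1 in h1; rewrite E2 nN in h2.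
have h3 : D * nrm p (u k) <= D * (2^-1 ^+ k + nrm p f).
  apply: ler_wpM2l => //; apply: le_trans h2 _; rewrite lerD2r.
  exact: le_trans (hu k) (e1 k).
by have := vb k; have := hvk k; lra.
Qed.

Lemma fourier_tproj (s : seq (C * int)) (n : int) : fourier (teval (tproj s)) n =
  if 0 <= n then fourier (teval s) n else 0.
Proof.
rewrite /tproj !fourier_teval big_filter_cond; case: ifPn => n0.
  by apply: eq_bigl => -[c l] /=; case: eqP => [->|]; rewrite ?andbF// n0.
rewrite big_pred0// => -[c l] /=; apply/negbTE/negP => /andP[l0 /eqP el].
by rewrite el (negbTE n0) in l0.
Qed.

(** M. Riesz's theorem: extend the projection from trigonometric polynomials by density,
    and pass to the limit in every Fourier coefficient. *)
Lemma riesz p : 1 < p -> exists2 D, 0 <= D & forall f : F, Lp p%:E f -> exists h : F,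
  [/\ Lp p%:E h, forall n, fourier h n = if 0 <= n then fourier f n else 0 &
      nrm p h <= D * nrm p f].
Proof.
move=> p1; have p1' : 1 <= p by lra.
have [D D0 hD] := proj_bound_gt1 p1; exists D => // f Lf.
have [K K0 hK] := Lp_L1 p1.
have r0 k : 0 < 2^-1 ^+ k :> R by rewrite exprn_gt0// invr_gt0.
have D1 : 0 < 2 * (D + 1) by lra.
have /choice[s hs] : forall k, exists s, nrm p (fun t => f t - teval s t) <= 2^-1 ^+ k / (2 * (D + 1)).
  by move=> k; apply: teval_dense => //; exact: divr_gt0.
have Ls k : Lp p%:E (teval (s k)) by exact: Lp_teval.
have Lv k : Lp p%:E (teval (tproj (s k))) by exact: Lp_teval.
have step k : nrm p (fun t => teval (tproj (s k.+1)) t - teval (tproj (s k)) t) <=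
    D * nrm p (fun t => teval (s k.+1) t - teval (s k) t).
  pose r := s k.+1 ++ [seq (-1 * a.1, a.2) | a <- s k].
  have -> : (fun t => teval (tproj (s k.+1)) t - teval (tproj (s k)) t) = teval (tproj r).
    apply/funext => t; rewrite /tproj /r filter_cat teval_cat filter_map.
    by rewrite -[in RHS]/(preim _ _) teval_scale mulN1r.
  have -> : (fun t => teval (s k.+1) t - teval (s k) t) = teval r.
    by apply/funext => t; rewrite /r teval_cat teval_scale mulN1r.
  exact: hD.
have [h [Lh hv nh]] := limit_extension p1 D0 Lf Ls Lv hs step (fun k => hD (s k)).
exists h; split=> // n; apply/eqP; rewrite -subr_eq0; apply/eqP.
have [Lh1 _] := hK _ Lh; have [Lf1 _] := hK _ Lf.
apply: (@small_eq0 _ (6 * K)) => k.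
have e1 : nrm p (fun t => f t - teval (s k) t) <= 2^-1 ^+ k.
  apply: le_trans (hs k) _; rewrite ler_pdivrMr//.
  by have := r0 k; nra.
have [Lv1 _] := hK _ (Lv k); have [Ls1 _] := hK _ (Ls k).
have [Lhv1 nhv1] := hK _ (LpB p1' Lh (Lv k)).1; have [Lfs1 nfs1] := hK _ (LpB p1' Lf (Ls k)).1.
have b1 : nc (fourier h n - fourier (teval (tproj (s k))) n) <= 2 * (K * (2 * 2^-1 ^+ k)).
  rewrite -fourierB//; apply: le_trans (fourier_le n Lhv1) _; rewrite ler_pM2l//.
  by apply: le_trans nhv1 _; exact: ler_wpM2l.
have b2 : nc (fourier f n - fourier (teval (s k)) n) <= 2 * (K * 2^-1 ^+ k).
  rewrite -fourierB//; apply: le_trans (fourier_le n Lfs1) _; rewrite ler_pM2l//.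
  by apply: le_trans nfs1 _; exact: ler_wpM2l.
have -> : fourier h n - (if 0 <= n then fourier f n else 0) =
  (fourier h n - fourier (teval (tproj (s k))) n) -
  (if 0 <= n then fourier f n - fourier (teval (s k)) n else 0).
  by rewrite fourier_tproj; case: ifP => _; ring.
apply: le_trans (normcD _ _) _; rewrite normc_opp.
have b3 : nc (if 0 <= n then fourier f n - fourier (teval (s k)) n else 0) <=
   2 * (K * 2^-1 ^+ k).
  by case: ifP => // _; rewrite Normc.normc0 mulr_ge0// mulr_ge0// ltW.
by lra.
Qed.

(** Any integrable function with the right coefficients will do, since the coefficients
    determine it. *)
Lemma projP_spec (f h : F) : Lp 1%:E h ->
  (forall n, fourier h n = if 0 <= n then fourier f n else 0) ->
  [/\ Lp 1%:E (projP f), circ_eq (projP f) h &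
     forall n, fourier (projP f) n = if 0 <= n then fourier f n else 0].
Proof.
move=> Lh hh.
have [L1 h1] : [set h : F | Lp 1%:E h /\
      forall n : int, fourier h n = if 0 <= n then fourier f n else 0] (projP f).
  by rewrite /projP; case: xgetP => // /(_ h) /= []; split.
by split=> //; apply: fourier_inj => // n; rewrite h1 hh.
Qed.

Lemma projP_bound p : 1 < p -> exists2 D, 0 <= D & forall f : F, Lp p%:E f ->
  [/\ Lp p%:E (projP f), forall n, fourier (projP f) n = (if 0 <= n then fourier f n else 0) &
      nrm p (projP f) <= D * nrm p f].
Proof.
move=> p1; have p0 : 0 < p by lra.
have [D D0 hD] := riesz p1; exists D => // f Lf.
have [h [Lh hh nh]] := hD f Lf.
have [K K0 hK] := Lp_L1 p1; have [Lh1 _] := hK _ Lh.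
have [L1 e h1] := projP_spec Lh1 hh.
by have [Lp' nE] := Lp_ae p0 (Lp_cmeas L1) Lh (circ_eq_sym e); rewrite nE.
Qed.

End RieszProjection.

(** * Frequencies of products *)

Opaque fourier circ_int nrm.

Section Spectrum.
Context {R : realType}.
Local Notation C := R[i].
Local Notation F := (C -> C).
Local Notation T := (measurableTypeR R).
Local Notation mu := (@arc_length R).
Implicit Types (f g h x z : F) (i j n k : int) (p q : R).

Definition spec_ge i f := forall n, n < i -> fourier f n = 0.
Definition spec_le i f := forall n, i < n -> fourier f n = 0.

Lemma Lp_Lp1 p f : 1 < p -> Lp p%:E f -> Lp 1%:E f.
Proof. by move=> p1 Lf; have [K _ /(_ f Lf)[]] := Lp_L1 p1. Qed.

Lemma fourier_le_nrm p : 1 < p -> exists2 K, 0 <= K &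
  forall f n, Lp p%:E f -> nc (fourier f n) <= K * nrm p f.
Proof.
move=> p1; have [K K0 hK] := Lp_L1 p1; exists (2 * K); first exact: mulr_ge0.
move=> f n Lf; have [L1 h] := hK f Lf.
by apply: le_trans (fourier_le n L1) _; rewrite -mulrA ler_pM2l.
Qed.

Lemma anp_teval s t : all (fun ck : C * int => 0 <= ck.2) s -> (anp s).[t] = teval s t.
Proof.
move=> s0; rewrite /anp /teval horner_sum.
apply: eq_big_seq => -[c k] /(allP s0) /= k0; rewrite k0 hornerZ hornerXn.
by case: k k0 => // m _; rewrite exprnP.
Qed.

(** Project the trigonometric approximants of f. *)
Lemma Hp_dense p f e : 1 < p -> Hp p f -> 0 < e ->
  exists u : {poly C}, nrm p (fun t => f t - u.[t]) <= e.
Proof.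
move=> p1 [Lf f0] e0; have p0 : 0 < p by lra.
have p1' : 1 <= p by lra.
have [D D0 hD] := projP_bound p1.
have e1 : 0 < e / (D + 1) by rewrite divr_gt0//; lra.
have [s hs] := teval_dense p1' Lf e1.
exists (anp (tproj s)).
have -> : (fun t => f t - (anp (tproj s)).[t]) = (fun t => f t - teval (tproj s) t).
  by apply/funext => t; rewrite anp_teval ?filter_all.
have Ls := Lp_teval s p1'.
have [Lfs _] := LpB p1' Lf Ls.
have [Lfp _] := LpB p1' Lf (Lp_teval (tproj s) p1').
have [LP hP nP] := hD _ Lfs.
have E : circ_eq (projP (fun t => f t - teval s t)) (fun t => f t - teval (tproj s) t).
  apply: fourier_inj; [exact: (Lp_Lp1 p1 LP)|exact: (Lp_Lp1 p1 Lfp)|].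
  have Lf1 := Lp_Lp1 p1 Lf.
  move=> n; rewrite hP !fourierB// ?fourier_tproj; try exact: Lp_teval.
  by case: ifPn => // n0; rewrite subr0 f0// ltNge.
rewrite (Lp_ae p0 (Lp_cmeas Lfp) LP E).2.
apply: le_trans nP _; apply: le_trans (_ : D * (e / (D + 1)) <= _).
  by apply: ler_wpM2l.
by rewrite mulrA ler_pdivrMr; lra.
Qed.

Lemma fourierM_poly (u : {poly C}) f n : Lp 1%:E f ->
  fourier (fun t => u.[t] * f t) n = \sum_(k < size u) u`_k * fourier f (n - k%:Z).
Proof.
move=> Lf; have -> : (fun t => u.[t] * f t) = (fun t => teval (pseq u) t * f t).
  by apply/funext => t; rewrite teval_pseq.
rewrite fourierM_teval// /pseq big_map /= -(big_mkord xpredT (fun k : nat => u`_k * fourier f (n - k%:Z))).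
by rewrite /index_iota subn0.
Qed.

(** For polynomial z only finitely many coefficients of x enter, all of them below i but
    one; both sides are continuous in z. *)
Lemma fourierM_Hp p q x z i : 1 < p -> p^-1 + q^-1 = 1 -> Lp p%:E x -> Hp q z ->
  spec_ge i x -> spec_ge i (fun t => x t * z t) /\
    fourier (fun t => x t * z t) i = fourier x i * fourier z 0.
Proof.
move=> p1 pq Lx Hz xi; have [Lz _] := Hz.
have [q1 _ _] := conj_exp_mul p1 pq.
have p0 : 0 < p by lra.
have q0 : 0 < q by lra.
have p1' : 1 <= p by lra.
have q1' : 1 <= q by lra.
have Lx1 := Lp_Lp1 p1 Lx; have Lz1 := Lp_Lp1 q1 Lz.
have [K K0 hK] := fourier_le_nrm q1.
pose D := 2 * nrm p x + nc (fourier x i) * K.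
have app n : n <= i -> forall e, 0 < e ->
    nc (fourier (fun t => x t * z t) n - (if n == i then fourier x i * fourier z 0 else 0)) <= D * e.
  move=> ni e e0; have [u hu] := Hp_dense q1 Hz e0.
  have Lu := bdd_Lp q1' (bdd_horner u).
  have [Lzu _] := LpB q1' Lz Lu.
  have [L1 n1] := hoelder_circ p0 q0 pq Lx Lzu.
  have [L2 _] := hoelder_circ p0 q0 pq Lx Lu.
  have E : fourier (fun t => x t * z t) n =
      fourier (fun t => x t * (z t - u.[t])) n + fourier (fun t => u.[t] * x t) n.
    rewrite -fourierD//; first by apply: fourier_ext => y; ring.
    by under eq_fun do rewrite mulrC.
  have Eu : fourier (fun t => u.[t] * x t) n = if n == i then fourier x i * fourier (fun t => u.[t]) 0 else 0.
    have -> : fourier (fun t => u.[t]) 0 = u`_0 := fourier_horner u 0.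
    rewrite fourierM_poly//.
    have [s0|s0] := posnP (size u).
      by rewrite s0 big_ord0 nth_default ?s0// mulr0 if_same.
    rewrite (bigD1 (Ordinal s0))//= big1 ?addr0.
      case: eqP => [->|/eqP nni]; first by rewrite mulrC.
      by rewrite xi ?mulr0// lt_neqAle nni.
    move=> k k0; rewrite xi ?mulr0//.
    have : (0 < k)%N by rewrite lt0n; apply: contra k0 => /eqP k0; apply/eqP/val_inj.
    by move: ni; clear; lia.
  rewrite E Eu; set A := fourier (fun t => x t * _) n.
  have bA : nc A <= 2 * nrm p x * e.
    apply: le_trans (fourier_le n L1) _; rewrite -mulrA ler_pM2l//.
    by apply: le_trans n1 _; apply: ler_wpM2l => //; exact: nrm_ge0.
  have bD : nc (fourier x i) * K * e >= 0 by rewrite !mulr_ge0 ?normc_ge0// ltW.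
  case: ifP => _; last first.
    by rewrite subr0 addr0; apply: le_trans bA _; rewrite /D [leRHS]mulrDl lerDl.
  have -> : A + fourier x i * fourier (fun t => u.[t]) 0 - fourier x i * fourier z 0 =
     A - fourier x i * fourier (fun t => z t - u.[t]) 0.
    by rewrite fourierB//; [ring|exact: (Lp_Lp1 q1 Lu)].
  have b2 : nc (fourier x i * fourier (fun t => z t - u.[t]) 0) <= nc (fourier x i) * K * e.
    rewrite Normc.normcM -[leRHS]mulrA; apply: ler_wpM2l; first exact: normc_ge0.
    by apply: le_trans (hK _ 0 Lzu) _; exact: ler_wpM2l.
  apply: le_trans (normcD _ _) _; rewrite normc_opp /D [leRHS]mulrDl.
  exact: lerD.
have lim n : n <= i ->
    fourier (fun t => x t * z t) n = if n == i then fourier x i * fourier z 0 else 0.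
  move=> ni; apply/eqP; rewrite -subr_eq0; apply/eqP.
  apply: (@small_eq0 _ _ D) => k.
  have e0 : 0 < 2^-1 ^+ k :> R by rewrite exprn_gt0// invr_gt0.
  exact: app ni _ e0.
split; last by rewrite lim ?eqxx.
by move=> n ni; rewrite lim ?(ltW ni)// lt_eqF.
Qed.

(** Lowest frequencies add and lowest coefficients multiply: the form in which analyticity
    is used throughout. *)
Lemma spec_geM p q x z i j : 1 < p -> p^-1 + q^-1 = 1 -> Lp p%:E x -> Lp q%:E z ->
  spec_ge i x -> spec_ge j z -> spec_ge (i + j) (fun t => x t * z t) /\
    fourier (fun t => x t * z t) (i + j) = fourier x i * fourier z j.
Proof.
move=> p1 pq Lx Lz xi zj; have [q1 _ _] := conj_exp_mul p1 pq.
have [Lz' _] := Lp_pow (- j) (ltW q1) Lz.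
have zE n : fourier (fun t => t ^ (- j) * z t) n = fourier z (n + j) by rewrite fourier_shift opprK.
have Hz' : Hp q (fun t => t ^ (- j) * z t).
  by split => // n n0; rewrite zE zj//; move: n0; clear; lia.
have [h1 h2] := fourierM_Hp p1 pq Lx Hz' xi.
have E n : fourier (fun t => x t * (t ^ (- j) * z t)) n = fourier (fun t => x t * z t) (n + j).
  rewrite -[j in RHS]opprK -fourier_shift; apply: fourier_ext => y; ring.
split; last by rewrite -E h2 zE add0r.
by move=> n nij; rewrite -[n](subrK j) -E h1//; move: nij; clear; lia.
Qed.

Lemma spec_leM p q x z i j : 1 < p -> p^-1 + q^-1 = 1 -> Lp p%:E x -> Lp q%:E z ->
  spec_le i x -> spec_le j z -> spec_le (i + j) (fun t => x t * z t) /\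
    fourier (fun t => x t * z t) (i + j) = fourier x i * fourier z j.
Proof.
move=> p1 pq Lx Lz xi zj; have [q1 _ _] := conj_exp_mul p1 pq.
have p0 : 0 < p by lra.
have q0 : 0 < q by lra.
have Lx1 := Lp_Lp1 p1 Lx; have Lz1 := Lp_Lp1 q1 Lz.
have [Lxz _] := hoelder_circ p0 q0 pq Lx Lz.
have xi' : spec_ge (- i) (circ_tilde x).
  by move=> n ni; rewrite fourier_tilde// xi//; move: ni; clear; lia.
have zj' : spec_ge (- j) (circ_tilde z).
  by move=> n nj; rewrite fourier_tilde// zj//; move: nj; clear; lia.
have [h1 h2] := spec_geM p1 pq (Lp_tilde p0 Lx).1 (Lp_tilde q0 Lz).1 xi' zj'.
have E n : fourier (fun t => x t * z t) n = fourier (fun t => circ_tilde x t * circ_tilde z t) (- n).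
  have -> : (fun t => circ_tilde x t * circ_tilde z t) = circ_tilde (fun t => x t * z t) by [].
  by rewrite fourier_tilde ?opprK.
split => [n nij|]; first by rewrite E h1//; move: nij; clear; lia.
by rewrite E opprD h2 !fourier_tilde// !opprK.
Qed.

Lemma spec_ge_le0 f i j : Lp 1%:E f -> spec_ge i f -> spec_le j f -> j < i -> circ_eq f (fun=> 0).
Proof.
move=> Lf fi fj ji; apply: fourier_inj0 => // n.
by case: (ltP n i) => ni; [exact: fi|apply: fj; exact: lt_le_trans ji ni].
Qed.

Lemma projP_Hp p f : 1 < p -> Lp p%:E f -> Hp p (projP f) /\
  forall n, 0 <= n -> fourier (projP f) n = fourier f n.
Proof.
move=> p1 Lf; have [D _ /(_ f Lf)[LP hP _]] := projP_bound p1.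
split; first by split=> // n n0; rewrite hP leNgt n0.
by move=> n n0; rewrite hP n0.
Qed.

Lemma projP_id p f : 1 < p -> Hp p f -> circ_eq (projP f) f.
Proof.
move=> p1 [Lf f0]; have [[LP P0] hP] := projP_Hp p1 Lf.
apply: fourier_inj; [exact: (Lp_Lp1 p1 LP)|exact: (Lp_Lp1 p1 Lf)|].
by move=> n; case: (ltP n 0) => n0; [rewrite P0// f0|rewrite hP].
Qed.

Lemma projQ_spec p f : 1 < p -> Lp p%:E f -> Lp p%:E (projQ f) /\ spec_le (-1) (projQ f).
Proof.
move=> p1 Lf; have [[LP P0] hP] := projP_Hp p1 Lf.
have [LQ _] := LpB (ltW p1) Lf LP; split => // n n0.
have n0' : 0 <= n by move: n0; clear; lia.
by rewrite /projQ (fourierB n (Lp_Lp1 p1 Lf) (Lp_Lp1 p1 LP)) hP// subrr.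
Qed.

(** The integrand has negative frequencies only, hence mean zero. *)
Lemma pairing0 p q x z : 1 < p -> p^-1 + q^-1 = 1 -> Lp p%:E x -> Hp q z ->
  spec_le (-1) x -> circ_int (fun t => x t * circ_conj z t) = 0.
Proof.
move=> p1 pq Lx [Lz z0] xm; have [q1 _ _] := conj_exp_mul p1 pq.
have q0 : 0 < q by lra.
have Lz1 := Lp_Lp1 q1 Lz.
have [Lc _] : Lp q%:E (circ_conj z) /\ nrm q (circ_conj z) = 1 * nrm q z.
  apply: Lp_scale => //; first by apply: cmeas_conj; exact: Lp_cmeas Lz.
  by move=> y; rewrite /mag normc_conj mul1r.
have cz : spec_le 0 (circ_conj z).
  by move=> n n0; rewrite fourier_conj// z0 ?conjc0// oppr_lt0.
have [h _] := spec_leM p1 pq Lx Lc xm cz.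
by rewrite circ_int_fourier h ?mulr0.
Qed.

End Spectrum.

(** * Wiener-Hopf factorizations and one-sided inverses *)

Section WienerHopf.
Context {R : realType}.
Local Notation C := R[i].
Local Notation F := (C -> C).
Local Notation T := (measurableTypeR R).
Local Notation mu := (@arc_length R).
Implicit Types (f g h x z : F) (i j n k : int) (p q : R).

Lemma ae_and (P Q : T -> Prop) : {ae mu, forall y, P y} -> {ae mu, forall y, Q y} ->
  {ae mu, forall y, P y /\ Q y}.
Proof. by apply: ae_imp2. Qed.

Lemma ae_absurd : {ae mu, forall x : T, False} -> False.
Proof.
move=> [N [mN N0 sub]].
have NT : N = setT by rewrite -subTset => x _; exact: sub.
move: N0; rewrite NT arc_lengthT => -[] /eqP.
by rewrite gt_eqF// pi2_gt0.
Qed.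

(** Equality, not only almost everywhere: P f is chosen by a property that depends on these
    coefficients alone. *)
Lemma projP_ext f g : (forall n, 0 <= n -> fourier f n = fourier g n) -> projP f = projP g.
Proof.
move=> fg; rewrite /projP; congr xget; apply/seteqP; split => h /= -[Lh hh];
  by split => // n; rewrite hh; case: ifP => // n0; rewrite fg.
Qed.

Lemma Hp_poly p (u : {poly C}) : 1 <= p -> @Hp R p (fun t => u.[t]).
Proof.
move=> p1; split; first by apply: bdd_Lp => //; exact: bdd_horner.
by move=> n n0; rewrite fourier_horner; case: n n0.
Qed.

Lemma HpD p (z : C) f g : 1 < p -> Hp p f -> Hp p g -> Hp p (fun t => z * f t + g t).
Proof.
move=> p1 [Lf f0] [Lg g0]; have p0 : 0 < p by lra.
have [Lzf _] := LpZ z p0 Lf; have [L _] := LpD (ltW p1) Lzf Lg; split => // n n0.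
rewrite fourierD; [|exact: (Lp_Lp1 p1 Lzf)|exact: (Lp_Lp1 p1 Lg)].
by rewrite (fourierZ _ _ (Lp_Lp1 p1 Lf)) f0// g0// mulr0 addr0.
Qed.

Lemma bounded_nrm p (B : F -> F) : bounded_linear_Hp p B ->
  exists2 M, 0 <= M & forall f, Hp p f -> nrm p (B f) <= M * nrm p f.
Proof.
move=> [BH _ [M hM]]; exists `|M| => // f Hf; have [Lf _] := Hf; have [LB _] := BH f Hf.
rewrite -lee_fin EFinM !nrmE//; apply: le_trans (hM f Hf) _.
rewrite -(nrmE Lf) -!EFinM lee_fin; apply: ler_wpM2r (ler_norm M); exact: nrm_ge0.
Qed.

Lemma conj_exponents p q : 1 < p -> p^-1 + q^-1 = 1 -> [/\ 1 < q, 0 < p, 0 < q & q^-1 + p^-1 = 1].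
Proof.
by move=> p1 pq; have [q1 _ qp] := conj_exp_mul p1 pq; split=> //; apply: lt_trans ltr01 _.
Qed.

Section Factorization.
Variables (p q : R) (g : F) (n : int) (gm gp : F).
Hypotheses (p1 : 1 < p) (pq : p^-1 + q^-1 = 1).
Hypothesis wh : wh_factorization p q g n gm gp.

Lemma wh_ae : {ae mu, forall y : T, [/\ g (expi y) = gm (expi y) * (expi y ^ n * gp (expi y)),
  gm (expi y) != 0 & gp (expi y) != 0]}.
Proof.
have [e [gp0 _ _] [gm0 _ _] _ _] := wh.
apply: ae_imp2 (ae_and e gm0) gp0 => y [ey my] py; split=> //; exact: ey.
Qed.

(** On polynomials u one has gm P(gm^-1 u) = u - gm Q(gm^-1 u), and the last term has only
    negative frequencies; density and boundedness give the general case. So B is a right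
    inverse of T(g t^-n). *)
Lemma wh_right B f : bdd g -> wh_extension p gm gp B -> Hp p f ->
  forall k, 0 <= k -> fourier (fun t => g t * t ^ (- n) * B f t) k = fourier f k.
Proof.
move=> bg [bB BE] Hf k k0; have [q1 p0 q0 qp] := conj_exponents p1 pq.
have [_ [_ [Lgp _] [Lgpi _]] [_ [Lgm gm0] [Lgmi gmi0]] _ _] := wh.
have [BH Blin _] := bB; have [M M0 hM] := bounded_nrm bB.
have Lf := Hf.1.
have bgn : bdd (fun t => g t * t ^ (- n)) by apply: bddM => //; exact: bdd_pow.
have [N N0 hN] := LpM_bdd (ltW p1) bgn.
have [K K0 hK] := fourier_le_nrm p1.
have polyE (u : {poly C}) :
    fourier (fun t => g t * t ^ (- n) * B (fun t => u.[t]) t) k = fourier (fun t => u.[t]) k.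
  have Hu := Hp_poly u (ltW p1); have [LBu _] := BH _ Hu.
  pose v : F := circ_mul (circ_inv gm) (fun t => u.[t]).
  have Lv : Lp q%:E v.
    have [N' _ /(_ _ Lgmi)[+ _]] := LpM_bdd (ltW q1) (bdd_horner u).
    by rewrite /v /circ_mul; under eq_fun do rewrite mulrC.
  have [LQ Q0] := projQ_spec q1 Lv.
  have [[LP _] _] := projP_Hp q1 Lv.
  have [L1 _] := hoelder_circ p0 q0 pq Lgm LQ.
  have [s0 _] := spec_leM p1 pq Lgm LQ gm0 Q0.
  have Lu := Hu.1.
  rewrite (@fourier_ae _ _ (fun t => u.[t] - gm t * projQ v t)).
  - rewrite fourierB//; last exact: (Lp_Lp1 p1 Lu).
    by rewrite s0 ?subr0//; move: k0; clear; lia.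
  - by apply: Lp_cmeas (hN _ LBu).1.
  - apply: cmeasD; first exact: Lp_cmeas Lu.
    by apply: cmeasN; exact: Lp_cmeas L1.
  - apply: ae_imp2 (wh_ae) (BE u) => y [-> gmy gpy] ->.
    have ey : expi y ^ n * expi y ^ (- n) = 1.
      by rewrite -expfzDr ?expi_neq0// subrr expr0z.
    rewrite /projQ /circ_mul /circ_inv /v.
    set w := projP _ _; set e := _ ^ n; set e' := _ ^ (- n) in ey *.
    have -> : gm (expi y) * (e * gp (expi y)) * e' * ((gp (expi y))^-1 * w) =
      (e * e') * gm (expi y) * w * (gp (expi y) / gp (expi y)) by ring.
    rewrite ey divff// mulr1 mul1r mulrBr /circ_mul /circ_inv mulVKf//.
    by rewrite opprB addrC subrK.
apply/eqP; rewrite -subr_eq0; apply/eqP.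
apply: (@small_eq0 _ _ (K * (N * M) + K)) => m.
have e0 : 0 < 2^-1 ^+ m :> R by rewrite exprn_gt0// invr_gt0.
have [u hu] := Hp_dense p1 Hf e0.
have Hu := Hp_poly u (ltW p1); have [LBu _] := BH _ Hu; have [LBf _] := BH _ Hf.
have [LGf _] := hN _ LBf; have [LGu _] := hN _ LBu.
have [Lfu _] := LpB (ltW p1) Lf Hu.1.
have Hd := HpD (-1) p1 Hu Hf; have [LBd _] := BH _ Hd.
have nd : nrm p (fun t => -1 * u.[t] + f t) <= 2^-1 ^+ m.
  have -> // : (fun t => -1 * u.[t] + f t) = (fun t => f t - u.[t]).
  by apply/funext => t; rewrite mulN1r addrC.
have [LBN _] := LpZ (-1) p0 LBu; have [LBs _] := LpD (ltW p1) LBN LBf.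
have nb : nrm p (fun t => -1 * B (fun t => u.[t]) t + B f t) <= M * 2^-1 ^+ m.
  rewrite (Lp_ae p0 (Lp_cmeas LBs) LBd (Blin (-1) _ _ Hu Hf)).2.
  by apply: le_trans (hM _ Hd) _; apply: ler_wpM2l.
have [LGd nGd] := hN _ LBs.
have -> : fourier (fun t => g t * t ^ (- n) * B f t) k - fourier f k =
   fourier (fun t => g t * t ^ (- n) * (-1 * B (fun t => u.[t]) t + B f t)) k -
   fourier (fun t => f t - u.[t]) k.
  rewrite (fourierB _ (Lp_Lp1 p1 Lf) (Lp_Lp1 p1 Hu.1)) -(polyE u).
  have -> : (fun t => g t * t ^ (- n) * (-1 * B (fun t => u.[t]) t + B f t)) =
    (fun t => g t * t ^ (- n) * B f t - g t * t ^ (- n) * B (fun t => u.[t]) t).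
    by apply/funext => t; ring.
  rewrite (fourierB _ (Lp_Lp1 p1 LGf) (Lp_Lp1 p1 LGu)).
  by rewrite opprB addrA subrK.
apply: le_trans (normcD _ _) _; rewrite normc_opp mulrDl; apply: lerD.
  apply: le_trans (hK _ k LGd) _; rewrite -mulrA; apply: ler_wpM2l => //.
  apply: le_trans nGd _; rewrite -mulrA; exact: ler_wpM2l.
by apply: le_trans (hK _ k Lfu) _; exact: ler_wpM2l.
Qed.

(** In t^n gp f = gm^-1 (g f) the left side has frequencies at least n and the right side
    negative ones, so both vanish. *)
Lemma wh_injective f : bdd g -> 0 <= n -> Hp p f ->
  (forall k, 0 <= k -> fourier (fun t => g t * f t) k = 0) -> circ_eq f (fun=> 0).
Proof.
move=> bg n0 [Lf f0] gf0; have [q1 p0 q0 qp] := conj_exponents p1 pq.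
have [_ [_ [Lgp gp0] [Lgpi _]] [_ [Lgm gm0] [Lgmi gmi0]] _ _] := wh.
have [N N0 hN] := LpM_bdd (ltW p1) bg; have [Lgf _] := hN _ Lf.
have gfm : spec_le (-1) (fun t => g t * f t).
  by move=> k k0; apply: gf0; move: k0; clear; lia.
have [s1 _] := spec_leM p1 pq Lgf Lgmi gfm gmi0.
have [L1 _] := hoelder_circ p0 q0 pq Lgf Lgmi.
have [Lnf _] := Lp_pow n (ltW p1) Lf.
have nf : spec_ge n (fun t => t ^ n * f t).
  by move=> k kn; rewrite fourier_shift f0//; move: kn; clear; lia.
have [s2 _] := spec_geM p1 pq Lnf Lgp nf gp0.
have [L2 _] := hoelder_circ p0 q0 pq Lnf Lgp.
have E : circ_eq (fun t => t ^ n * f t * gp t) (fun t => g t * f t * circ_inv gm t).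
  apply: ae_imp wh_ae => y [-> gmy gpy]; rewrite /circ_inv.
  set e := _ ^ n; set a := gm _ in gmy *; set b := gp _.
  have -> : a * (e * b) * f (expi y) / a = (e * f (expi y) * b) * (a / a) by ring.
  by rewrite divff// mulr1.
have s1' : spec_le (-1) (fun t => t ^ n * f t * gp t).
  move=> k k0; rewrite (fourier_ae _ (Lp_cmeas L2) (Lp_cmeas L1) E) s1//.
have z : circ_eq (fun t => t ^ n * f t * gp t) (fun=> 0).
  by apply: (spec_ge_le0 L2 s2 s1'); move: n0; clear; lia.
apply: ae_imp2 wh_ae z => y [_ _ gpy] /eqP; rewrite !mulf_eq0 (negbTE gpy) orbF.
by rewrite expfz_eq0 (negbTE (expi_neq0 _)) andbF /= => /eqP.
Qed.

(** The lowest coefficients of gp and gp^-1 multiply to 1. *)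
Lemma wh_coef0 : fourier gp 0 != 0.
Proof.
have [q1 p0 q0 qp] := conj_exponents p1 pq.
have [_ [_ [Lgp gp0] [Lgpi gpi0]] _ _ _] := wh.
have [_ h] := spec_geM p1 pq Lgpi Lgp gpi0 gp0.
have [L1 _] := hoelder_circ p0 q0 pq Lgpi Lgp.
have : fourier (fun t => circ_inv gp t * gp t) (0 + 0) = 1.
  rewrite (@fourier_ae _ _ (circ_pow 0)); first by rewrite fourier_pow.
  - exact: Lp_cmeas L1.
  - exact: cmeas_pow.
  - by apply: ae_imp wh_ae => y [_ _ gpy]; rewrite /circ_inv /circ_pow mulVf// expr0z.
rewrite h => h1; apply/eqP => g0; move: h1; rewrite g0 mulr0 => /eqP.
by rewrite eq_sym oner_eq0.
Qed.

End Factorization.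

(** If n < n', then t^(n' - n) gp' gp^-1 = gm gm'^-1 equates a function with positive
    frequencies only and one with nonpositive frequencies only, although neither side
    vanishes anywhere. *)
Lemma wh_index_le p q g n gm gp n' gm' gp' : 1 < p -> p^-1 + q^-1 = 1 ->
  wh_factorization p q g n gm gp -> wh_factorization p q g n' gm' gp' -> n' <= n.
Proof.
move=> p1 pq w w'; rewrite leNgt; apply/negP => nn'.
have [q1 p0 q0 qp] := conj_exponents p1 pq.
have [_ [_ _ [Lgpi gpi0]] [_ [Lgm gm0] _] _ _] := w.
have [_ [_ [Lgp gp0] _] [_ _ [Lgmi gmi0]] _ _] := w'.
have [s1 _] := spec_leM p1 pq Lgm Lgmi gm0 gmi0.
have [L1 _] := hoelder_circ p0 q0 pq Lgm Lgmi.
have [s2 _] := spec_geM p1 pq Lgpi Lgp gpi0 gp0.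
have [L2 _] := hoelder_circ p0 q0 pq Lgpi Lgp.
have [L3 _] := Lp_pow (n' - n) (lexx 1) L2.
have s3 : spec_ge (n' - n) (fun t => t ^ (n' - n) * (circ_inv gp t * gp' t)).
  by move=> k kn; rewrite fourier_shift s2//; move: kn; clear; lia.
have ae2 := ae_and (wh_ae w) (wh_ae w').
have E : circ_eq (fun t => t ^ (n' - n) * (circ_inv gp t * gp' t)) (fun t => gm t * circ_inv gm' t).
  apply: ae_imp ae2 => y [[g1 a0 b0] [g2 a'0 b'0]]; rewrite /circ_inv expfzDr ?expi_neq0//.
  rewrite g1 in g2.
  have en0 : expi y ^ n != 0 by rewrite expfz_eq0 (negbTE (expi_neq0 _)) andbF.
  have -> : expi y ^ (- n) = (expi y ^ n)^-1 by rewrite -invr_expz.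
  move: en0 g2 a0 b0 a'0 b'0; move: (expi y ^ n) (expi y ^ n') => e e'.
  move: (gm _) (gp _) (gm' _) (gp' _) => c d c' d' e0 g2 c0 d0 c'0 d'0.
  have -> : e' / e * (d^-1 * d') = c' * (e' * d') / (c' * e * d) by field; rewrite e0 d0 c'0.
  by rewrite -g2; field; rewrite e0 d0 c'0.
have s1' : spec_le 0 (fun t => t ^ (n' - n) * (circ_inv gp t * gp' t)).
  move=> k k0; rewrite (fourier_ae _ (Lp_cmeas L3) (Lp_cmeas L1) E) s1//.
have z : circ_eq (fun t => t ^ (n' - n) * (circ_inv gp t * gp' t)) (fun=> 0).
  by apply: (spec_ge_le0 L3 s3 s1'); rewrite subr_gt0.
apply: ae_absurd; apply: ae_imp2 ae2 z => y [[_ _ b0] [_ _ b'0]] /eqP.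
rewrite !mulf_eq0 (negbTE b'0) /circ_inv invr_eq0 (negbTE b0) !orbF.
by rewrite expfz_eq0 (negbTE (expi_neq0 _)) andbF.
Qed.

Lemma wh_index_unique p q g n gm gp n' gm' gp' : 1 < p -> p^-1 + q^-1 = 1 ->
  wh_factorization p q g n gm gp -> wh_factorization p q g n' gm' gp' -> n = n'.
Proof.
move=> p1 pq w w'; apply/eqP.
by rewrite eq_le (wh_index_le p1 pq w w') (wh_index_le p1 pq w' w).
Qed.

(** Let y = B f, so that T(g t^-n) y = f. Then gp y = gm^-1 f + (negative frequencies)
    shows that the first n coefficients of gp y, and so those of y, vanish together with
    those of gm^-1 f. Hence t^-n y is analytic and solves T(g) w = f. The factorization
    behind the chosen inverse may differ from the given one, but its index n is the same,
    and wh_right only involves n. *)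
Lemma Tlinv_solves p q g n gm gp f : 1 < p -> p^-1 + q^-1 = 1 -> bdd g ->
  wh_factorization p q g n gm gp -> 0 <= n -> Hp p f ->
  (forall j : nat, j%:Z < n -> fourier (fun t => circ_inv gm t * f t) j = 0) ->
  Hp p (Tlinv p q g f) /\
  forall k, 0 <= k -> fourier (fun t => g t * Tlinv p q g f t) k = fourier f k.
Proof.
move=> p1 pq bg w n0 Hf fj; have [q1 p0 q0 qp] := conj_exponents p1 pq.
rewrite /Tlinv; case: xgetP => [A _ [n' [gm' [gp' [B [_ w' eB ->]]]]]|]; last first.
  have [_ _ _ _ [B eB]] := w => h; exfalso.
  by apply: (h (fun f => toeplitz (circ_pow (- n)) (B f))); exists n, gm, gp, B.
have en := wh_index_unique p1 pq w' w; rewrite {}en in w' *.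
have [bB _] := eB; have [BH _ _] := bB; set y := B f.
have Hy : Hp p y := BH f Hf; have [Ly y0] := Hy; have [Lf f0] := Hf.
have yE k (k0 : 0 <= k) : fourier (fun t => g t * t ^ (- n) * y t) k = fourier f k.
  exact: (wh_right p1 pq w' bg eB Hf k0).
have [_ [_ [Lgp gp0] [Lgpi _]] [_ [Lgm gm0] [Lgmi gmi0]] _ _] := w.
have bgn : bdd (fun t => g t * t ^ (- n)) by apply: bddM => //; exact: bdd_pow.
have [N N0 hN] := LpM_bdd (ltW p1) bgn; have [Lgy _] := hN _ Ly.
(* the part of g t^-n y outside H^p *)
pose om : F := fun t => g t * t ^ (- n) * y t - f t.
have [Lom _] := LpB (ltW p1) Lgy Lf.
have om0 : spec_le (-1) om.
  move=> k k1; have k0 : 0 <= k by move: k1; clear; lia.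
  by rewrite /om (fourierB _ (Lp_Lp1 p1 Lgy) (Lp_Lp1 p1 Lf)) yE// subrr.
have [s0 _] := spec_leM p1 pq Lom Lgmi om0 gmi0.
have [Lom1 _] := hoelder_circ p0 q0 pq Lom Lgmi.
have [Lf1 _] := hoelder_circ p0 q0 pq Lf Lgmi.
have [Lyg _] := hoelder_circ p0 q0 pq Ly Lgp.
have [Lfo _] := LpD (lexx 1) Lf1 Lom1.
have E : circ_eq (fun t => y t * gp t) (fun t => f t * circ_inv gm t + om t * circ_inv gm t).
  apply: ae_imp (wh_ae w) => x [ge gmx gpx]; rewrite -mulrDl /om addrC subrK ge /circ_inv.
  have ey : expi x ^ n * expi x ^ (- n) = 1.
    by rewrite -expfzDr ?expi_neq0// subrr expr0z.
  move: ey gmx; move: (_ ^ n) (_ ^ (- n)) (gm _) (gp _) (y _) => e e' a b c ee a0.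
  have -> : a * (e * b) * e' * c / a = c * b * (e * e') * (a / a) by ring.
  by rewrite ee divff// !mulr1.
have ygE k : 0 <= k -> fourier (fun t => y t * gp t) k = fourier (fun t => circ_inv gm t * f t) k.
  move=> k0; rewrite (fourier_ae _ (Lp_cmeas Lyg) (Lp_cmeas Lfo) E) fourierD// [X in _ + X]s0.
    by rewrite addr0; apply: fourier_ext => x; rewrite mulrC.
  by move: k0; clear; lia.
have yn (m : nat) : m%:Z <= n -> spec_ge m%:Z y.
  elim: m => [|m IH] mn; first exact: y0.
  have mn' : m%:Z < n by move: mn; clear; lia.
  have ym := IH (ltW mn').
  have [_ h] := spec_geM p1 pq Ly Lgp ym gp0.
  rewrite addr0 ygE// fj// in h.
  move=> k km; case: (ltP k m%:Z) => k1; first exact: ym.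
  have -> : k = m%:Z by move: km k1; clear; lia.
  move/esym/eqP: h; rewrite mulf_eq0 (negbTE (wh_coef0 p1 pq w)) orbF => /eqP //.
have {}yn : spec_ge n y.
  by case: n n0 yn {w w' E yE om om0 s0 Lom Lom1 Lfo fj bgn N N0 hN Lgy} => // m _; apply.
have [Lyn _] := Lp_pow (- n) (ltW p1) Ly.
have Hyn : Hp p (fun t => t ^ (- n) * y t).
  split => // k k0; rewrite fourier_shift yn//; move: k0; clear; lia.
have [[LPy _] _] := projP_Hp p1 Ly.
have -> : toeplitz (circ_pow (- n)) y = projP (fun t => t ^ (- n) * y t).
  apply: projP_ext => k _; rewrite [LHS]fourier_shift fourier_shift.
  by apply: fourier_ae; [exact: Lp_cmeas LPy|exact: Lp_cmeas Ly|exact: projP_id p1 Hy].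
have [HP _] := projP_Hp p1 Lyn; split=> // k k0.
have [N' _ hN'] := LpM_bdd (ltW p1) bg.
rewrite -yE//; apply: fourier_ae.
- exact: Lp_cmeas (hN' _ HP.1).1.
- exact: Lp_cmeas Lgy.
- by apply: ae_imp (projP_id p1 Hyn) => x ->; rewrite mulrA.
Qed.

(** Here t^-n is analytic, so that T(t^-n) is a mere shift; the equation is recovered from
    wh_right by shifting back. *)
Lemma Trinv_spec p q g n gm gp f : 1 < p -> p^-1 + q^-1 = 1 -> bdd g ->
  wh_factorization p q g n gm gp -> n <= 0 -> Hp p f ->
  Hp p (Trinv p q g f) /\
  forall k, 0 <= k -> fourier (fun t => g t * Trinv p q g f t) k = fourier f k.
Proof.
move=> p1 pq bg w n0 Hf.
rewrite /Trinv; case: xgetP => [A _ [n' [gm' [gp' [B [n'0 w' eB ->]]]]]|]; last first.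
  have [_ _ _ _ [B eB]] := w => h; exfalso.
  by apply: (h (fun f => B (toeplitz (circ_pow (- n)) f))); exists n, gm, gp, B.
have [bB _] := eB; have [BH _ _] := bB; have [Lf f0] := Hf.
have [[LPf _] _] := projP_Hp p1 Lf.
have [Lnf _] := Lp_pow (- n') (ltW p1) LPf.
have [Hv vP] := projP_Hp p1 Lnf.
set v := toeplitz _ f; have vE : v = projP (fun t => t ^ (- n') * projP f t) by [].
rewrite vE; have HB := BH _ Hv; split=> // k k0.
have := wh_right p1 pq w' bg eB Hv (_ : 0 <= k - n').
rewrite vP ?subr_ge0 ?(le_trans n'0)// => /(_ isT).
rewrite fourier_shift opprK subrK.
rewrite (fourier_ae _ (Lp_cmeas LPf) (Lp_cmeas Lf) (projP_id p1 Hf)) => <-.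
set z := B _.
have -> : (fun t => g t * t ^ (- n') * z t) = (fun t => t ^ (- n') * (g t * z t)).
  by apply/funext => t; rewrite mulrA (mulrC (g t)).
by rewrite fourier_shift opprK subrK.
Qed.

End WienerHopf.

(** * The factorization of the adjoint symbol *)

Section Adjoint.
Context {R : realType}.
Local Notation C := R[i].
Local Notation F := (C -> C).
Local Notation T := (measurableTypeR R).
Local Notation mu := (@arc_length R).
Implicit Types (f g h x y z w : F) (i j n k : int) (p q : R).

Lemma Lp_conj p f : 0 < p -> Lp p%:E f ->
  Lp p%:E (circ_conj f) /\ nrm p (circ_conj f) = nrm p f.
Proof.
move=> p0 Lf; rewrite -[nrm p f]mul1r; apply: Lp_scale => //.
- by apply: cmeas_conj; exact: Lp_cmeas Lf.
- by move=> s; rewrite /mag normc_conj mul1r.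
Qed.

Lemma Hp_conj p f : 1 < p -> Hpbar p f -> Hp p (circ_conj f).
Proof.
move=> p1 [Lf f0]; have p0 : 0 < p by exact: lt_trans ltr01 p1.
split; first exact: (Lp_conj p0 Lf).1.
move=> n n0; rewrite (fourier_conj _ (Lp_Lp1 p1 Lf)) f0 ?conjc0//.
by rewrite oppr_gt0.
Qed.

Lemma Hpbar_conj p f : 1 < p -> Hp p f -> Hpbar p (circ_conj f).
Proof.
move=> p1 [Lf f0]; have p0 : 0 < p by exact: lt_trans ltr01 p1.
split; first exact: (Lp_conj p0 Lf).1.
move=> n n0; rewrite (fourier_conj _ (Lp_Lp1 p1 Lf)) f0 ?conjc0//.
by rewrite oppr_lt0.
Qed.

Lemma hoelder_conj p q x z : 1 < p -> p^-1 + q^-1 = 1 -> Lp p%:E x -> Lp q%:E z ->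
  Lp 1%:E (fun t => x t * circ_conj z t).
Proof.
move=> p1 pq Lx Lz; have [q1 p0 q0 qp] := conj_exponents p1 pq.
exact: (hoelder_circ p0 q0 pq Lx (Lp_conj q0 Lz).1).1.
Qed.

Lemma pairing_sym x z : Lp 1%:E (fun t => x t * circ_conj z t) ->
  circ_int (fun t => z t * circ_conj x t) = conjc (circ_int (fun t => x t * circ_conj z t)).
Proof.
move=> L; rewrite -circ_int_conj//; apply: circ_int_ext => s.
by rewrite /circ_conj conjcM conjcK mulrC.
Qed.

(** P is its own adjoint for the pairing of H^p with H^q. *)
Lemma pairing_projP p q x z : 1 < p -> p^-1 + q^-1 = 1 -> Lp p%:E x -> Hp q z ->
  circ_int (fun t => projP x t * circ_conj z t) = circ_int (fun t => x t * circ_conj z t).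
Proof.
move=> p1 pq Lx Hz; have [[LP _] _] := projP_Hp p1 Lx.
have [LQ Q0] := projQ_spec p1 Lx.
apply/eqP; rewrite eq_sym -subr_eq0 -(pairing0 p1 pq LQ Hz Q0); apply/eqP.
have L1 := hoelder_conj p1 pq LP Hz.1; have L2 := hoelder_conj p1 pq LQ Hz.1.
rewrite -[X in X - _ = _](_ : circ_int (fun t => projQ x t * circ_conj z t +
   projP x t * circ_conj z t) = _); first by rewrite circ_intD// addrK.
by apply: circ_int_ext => s; rewrite /projQ mulrBl subrK.
Qed.

Lemma pairing_projP_r p q x z : 1 < p -> p^-1 + q^-1 = 1 -> Hp p x -> Lp q%:E z ->
  circ_int (fun t => x t * circ_conj (projP z) t) = circ_int (fun t => x t * circ_conj z t).
Proof.
move=> p1 pq Hx Lz; have [q1 p0 q0 qp] := conj_exponents p1 pq.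
have [[LP _] _] := projP_Hp q1 Lz.
rewrite pairing_sym; last exact: (hoelder_conj q1 qp LP Hx.1).
rewrite (pairing_projP q1 qp Lz Hx) -pairing_sym//; exact: (hoelder_conj q1 qp Lz Hx.1).
Qed.

Lemma pairing_le p q x z : 1 < p -> p^-1 + q^-1 = 1 -> Lp p%:E x -> Lp q%:E z ->
  nc (circ_int (fun t => x t * circ_conj z t)) <= 2 * (nrm p x * nrm q z).
Proof.
move=> p1 pq Lx Lz; have [q1 p0 q0 qp] := conj_exponents p1 pq.
have [Lc nE] := Lp_conj q0 Lz; have [L1 h] := hoelder_circ p0 q0 pq Lx Lc.
apply: le_trans (circ_int_le L1) _; rewrite ler_pM2l//.
by rewrite -nE.
Qed.

Definition wh_poly gm gp (v : {poly C}) : F :=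
  circ_mul (circ_inv gp) (projP (circ_mul (circ_inv gm) (fun t => v.[t]))).

Lemma LpM_poly p f (u : {poly C}) : 1 <= p -> Lp p%:E f ->
  Lp p%:E (circ_mul f (fun t => u.[t])).
Proof.
move=> p1 Lf; have [N' _ /(_ _ Lf)[+ _]] := LpM_bdd p1 (bdd_horner u).
by rewrite /circ_mul; under eq_fun do rewrite mulrC.
Qed.

Section Extension.
Variables (p q K : R) (gm gp : F).
Hypotheses (p1 : 1 < p) (pq : p^-1 + q^-1 = 1) (K0 : 0 <= K).
Hypotheses (gp_neq0 : circ_neq0 gp) (Hgp : Hp q gp) (Lgmi : Lp q%:E (circ_inv gm)).
Hypothesis poly_bound : forall v : {poly C}, Hp p (wh_poly gm gp v) /\
  nrm p (wh_poly gm gp v) <= K * nrm p (fun t => v.[t]).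

(** The image w of f under the extension of gp^-1 P gm^-1 I: formally gp w = P(gm^-1 f), an
    identity between coefficients of integrable functions that makes sense for every f in
    H^p and determines w. Choosing w for each f therefore yields a linear operator. *)
Definition wh_rel f w := Hp p w /\ forall k, 0 <= k ->
  fourier (fun t => gp t * w t) k = fourier (fun t => circ_inv gm t * f t) k.

Lemma wh_rel_L1 w : Lp p%:E w -> Lp 1%:E (fun t => gp t * w t) /\
  nrm 1 (fun t => gp t * w t) <= nrm q gp * nrm p w.
Proof.
have [q1 p0 q0 qp] := conj_exponents p1 pq.
by move=> Lw; exact: hoelder_circ q0 p0 qp Hgp.1 Lw.
Qed.

Lemma wh_rel_L1' f : Lp p%:E f -> Lp 1%:E (fun t => circ_inv gm t * f t) /\
  nrm 1 (fun t => circ_inv gm t * f t) <= nrm q (circ_inv gm) * nrm p f.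
Proof.
have [q1 p0 q0 qp] := conj_exponents p1 pq.
by move=> Lw; exact: hoelder_circ q0 p0 qp Lgmi Lw.
Qed.

(** Both gp w and gp w' are analytic with the same coefficients, and gp does not vanish. *)
Lemma wh_rel_unique f w w' : wh_rel f w -> wh_rel f w' -> circ_eq w w'.
Proof.
move=> [[Lw w0] hw] [[Lw' w'0] hw']; have [q1 p0 q0 qp] := conj_exponents p1 pq.
have [L1 _] := wh_rel_L1 Lw; have [L2 _] := wh_rel_L1 Lw'.
have E : circ_eq (fun t => gp t * w t) (fun t => gp t * w' t).
  apply: fourier_inj => // k; case: (ltP k 0) => k0; last by rewrite hw// hw'.
  have [s1 _] := spec_geM q1 qp Hgp.1 Lw Hgp.2 w0.
  have [s2 _] := spec_geM q1 qp Hgp.1 Lw' Hgp.2 w'0.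
  by rewrite s1 ?s2.
apply: ae_imp2 gp_neq0 E => s gs; exact: mulfI.
Qed.

Lemma wh_relD (c : C) f w f' w' : Hp p f -> Hp p f' -> wh_rel f w -> wh_rel f' w' ->
  wh_rel (fun t => c * f t + f' t) (fun t => c * w t + w' t).
Proof.
move=> Hf Hf' [Hw hw] [Hw' hw']; split; first exact: HpD.
move=> k k0.
have [L1 _] := wh_rel_L1 Hw.1; have [L2 _] := wh_rel_L1 Hw'.1.
have [L3 _] := wh_rel_L1' Hf.1; have [L4 _] := wh_rel_L1' Hf'.1.
have lin (a b d : F) : Lp 1%:E (fun t => a t * b t) -> Lp 1%:E (fun t => a t * d t) ->
    fourier (fun t => a t * (c * b t + d t)) k =
    c * fourier (fun t => a t * b t) k + fourier (fun t => a t * d t) k.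
  move=> Lb Ld; have [Lcb _] := LpZ c ltr01 Lb.
  rewrite -(fourierZ c k Lb) -(fourierD k Lcb Ld).
  by apply: fourier_ext => s; ring.
by rewrite !lin// hw// hw'.
Qed.

Lemma wh_rel_poly (v : {poly C}) : wh_rel (fun t => v.[t]) (wh_poly gm gp v).
Proof.
have [q1 p0 q0 qp] := conj_exponents p1 pq.
have [Hv _] := poly_bound v; split=> // k k0.
have Lx := LpM_poly v (ltW q1) Lgmi.
have [[LP _] hP] := projP_Hp q1 Lx.
rewrite -[RHS](hP k k0); apply: fourier_ae.
- exact: Lp_cmeas (wh_rel_L1 Hv.1).1.
- exact: Lp_cmeas LP.
- by apply: ae_imp gp_neq0 => s gs; rewrite /wh_poly /circ_mul /circ_inv mulVKf.
Qed.

(** Images of approximating polynomials form a Cauchy sequence, and the defining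
    coefficient identity passes to the limit. *)
Lemma wh_rel_exists f : Hp p f -> exists2 w, wh_rel f w & nrm p w <= K * nrm p f.
Proof.
move=> Hf; have [q1 p0 q0 qp] := conj_exponents p1 pq.
have [Lf f0] := Hf; have p1' := ltW p1.
have r0 m : 0 < 2^-1 ^+ m :> R by rewrite exprn_gt0// invr_gt0.
have K1 : 0 < 2 * (K + 1) by rewrite mulr_gt0// ltr_wpDl.
have /choice[u hu] : forall m, exists u : {poly C},
    nrm p (fun t => f t - u.[t]) <= 2^-1 ^+ m / (2 * (K + 1)).
  by move=> m; apply: Hp_dense => //; exact: divr_gt0.
have Hu m := Hp_poly (u m) p1'; have Lu m := (Hu m).1.
pose v m := wh_poly gm gp (u m).
have Hv m : Hp p (v m) := (poly_bound (u m)).1; have Lv m := (Hv m).1.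
have step m : nrm p (fun t => v m.+1 t - v m t) <=
    K * nrm p (fun t => (u m.+1).[t] - (u m).[t]).
  have e1 : (fun t => (u m.+1).[t] - (u m).[t]) = (fun t => -1 * (u m).[t] + (u m.+1).[t]).
    by apply/funext => t; rewrite mulN1r addrC.
  have e2 : (fun t => v m.+1 t - v m t) = (fun t => -1 * v m t + v m.+1 t).
    by apply/funext => t; rewrite mulN1r addrC.
  have e3 : (fun t => -1 * (u m).[t] + (u m.+1).[t]) = (fun t => (u m.+1 - u m).[t]).
    by apply/funext => t; rewrite hornerD hornerN mulN1r addrC.
  have r1 := wh_relD (-1) (Hu m) (Hu m.+1) (wh_rel_poly (u m)) (wh_rel_poly (u m.+1)).
  have r2 := wh_rel_poly (u m.+1 - u m).
  rewrite e1 e2; rewrite e3 in r1 *.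
  have [Lw _] := r1.1; have [Lw' _] := r2.1.
  rewrite (Lp_ae p0 (Lp_cmeas Lw) Lw' (wh_rel_unique r2 r1)).2.
  exact: (poly_bound _).2.
have vb m : nrm p (v m) <= K * nrm p (fun t => (u m).[t]) := (poly_bound (u m)).2.
have [h [Lh hv nh]] := limit_extension p1 K0 Lf Lu Lv hu step vb.
have u1 m : nrm p (fun t => f t - (u m).[t]) <= 2^-1 ^+ m.
  apply: le_trans (hu m) _; rewrite ler_pdivrMr//.
  have : 0 <= K * 2^-1 ^+ m by rewrite mulr_ge0// ltW.
  by have := r0 m; move: (_ ^+ m) => r; lra.
have Lhv m := (LpB p1' Lh (Lv m)).1; have Lfu m := (LpB p1' Lf (Lu m)).1.
exists h => //; split; first split => // n n0.
  have [N N0 hN] := fourier_le_nrm p1.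
  apply: (@small_eq0 _ _ (N * 2)) => m.
  have -> : fourier h n = fourier (fun t => h t - v m t) n.
    by rewrite (fourierB n (Lp_Lp1 p1 Lh) (Lp_Lp1 p1 (Lv m))) (Hv m).2// subr0.
  apply: le_trans (hN _ n (Lhv m)) _; rewrite -mulrA; exact: ler_wpM2l.
move=> k k0; apply/eqP; rewrite -subr_eq0; apply/eqP.
apply: (@small_eq0 _ _ (4 * nrm q gp + 2 * nrm q (circ_inv gm))) => m.
have [_ hvk] := wh_rel_poly (u m); have {}hvk := hvk k k0.
have [L1 _] := wh_rel_L1 Lh; have [L2 _] := wh_rel_L1 (Lv m).
have [L3 _] := wh_rel_L1' Lf; have [L4 _] := wh_rel_L1' (Lu m).
have [L5 n5] := wh_rel_L1 (Lhv m); have [L6 n6] := wh_rel_L1' (Lfu m).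
have -> : fourier (fun t => gp t * h t) k - fourier (fun t => circ_inv gm t * f t) k =
    fourier (fun t => gp t * (h t - v m t)) k - fourier (fun t => circ_inv gm t * (f t - (u m).[t])) k.
  have -> : (fun t => gp t * (h t - v m t)) = (fun t => gp t * h t - gp t * v m t).
    by apply/funext => t; rewrite mulrBr.
  have -> : (fun t => circ_inv gm t * (f t - (u m).[t])) =
      (fun t => circ_inv gm t * f t - circ_inv gm t * (u m).[t]).
    by apply/funext => t; rewrite mulrBr.
  rewrite (fourierB k L1 L2) (fourierB k L3 L4) hvk.
  by rewrite opprB addrA subrK.
have b1 : nc (fourier (fun t => gp t * (h t - v m t)) k) <= 2 * (nrm q gp * (2 * 2^-1 ^+ m)).
  apply: le_trans (fourier_le k L5) _; rewrite ler_pM2l//; apply: le_trans n5 _.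
  by apply: ler_wpM2l => //; exact: nrm_ge0.
have b2 : nc (fourier (fun t => circ_inv gm t * (f t - (u m).[t])) k) <=
    2 * (nrm q (circ_inv gm) * 2^-1 ^+ m).
  apply: le_trans (fourier_le k L6) _; rewrite ler_pM2l//; apply: le_trans n6 _.
  by apply: ler_wpM2l => //; exact: nrm_ge0.
apply: le_trans (normcD _ _) _; rewrite normc_opp; apply: le_trans (lerD b1 b2) _.
by rewrite le_eqVlt; apply/orP; left; apply/eqP; ring.
Qed.

Lemma wh_extension_exists : exists B, wh_extension p gm gp B.
Proof.
have [q1 p0 q0 qp] := conj_exponents p1 pq.
pose B f := xget (fun=> 0) [set w | wh_rel f w].
have BE f : Hp p f -> wh_rel f (B f).
  move=> Hf; rewrite /B; case: xgetP => // h; have [w hw _] := wh_rel_exists Hf.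
  by case: (h w).
exists B; split; first split.
- by move=> f /BE[].
- move=> c f f' Hf Hf'; apply: (wh_rel_unique (BE _ (HpD c p1 Hf Hf'))).
  by apply: wh_relD => //; exact: BE.
- exists K => f Hf; have [w hw nw] := wh_rel_exists Hf.
  have HB := BE f Hf.
  rewrite -(nrmE HB.1.1) -(nrmE Hf.1) -EFinM lee_fin.
  by rewrite (Lp_ae p0 (Lp_cmeas HB.1.1) hw.1.1 (wh_rel_unique hw HB)).2.
- by move=> u; exact: (wh_rel_unique (BE _ (Hp_poly u (ltW p1))) (wh_rel_poly u)).
Qed.

End Extension.

Lemma finite_spec f (m : nat) : Lp 1%:E f -> spec_ge 0 f -> spec_le m%:Z f ->
  exists u : {poly C}, circ_eq f (fun t => u.[t]).
Proof.
move=> Lf f0 fm; exists (\poly_(i < m.+1) fourier f i%:Z); apply: fourier_inj => //.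
  by apply: bdd_Lp => //; exact: bdd_horner.
move=> n; rewrite fourier_horner; case: n => [n|n]; last by rewrite f0.
rewrite coef_poly; case: ltnP => // mn; apply: fm.
by move: mn; clear; lia.
Qed.

(** Conjugating g = gm t^n gp exchanges the roles of the factors; al normalizes the new
    minus factor. The operator conj(gm)^-1 P conj(gp)^-1 is the adjoint of gp^-1 P gm^-1
    for the pairing of H^p with H^q, whence its boundedness by converse_hoelder. *)
Lemma adjoint_factorization p q g n gm gp : 1 < p -> p^-1 + q^-1 = 1 ->
  wh_factorization p q g n gm gp ->
  exists gm' gp', wh_factorization q p (circ_conj g) (- n) gm' gp'.
Proof.
move=> p1 pq wh; have [q1 p0 q0 qp] := conj_exponents p1 pq.
have p1' := ltW p1; have q1' := ltW q1.
have [_ [_ Hgp Hgpi] [_ Hgm Hgmi] _ [B [bB BE]]] := wh.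
have [BH _ _] := bB; have [M M0 hM] := bounded_nrm bB.
pose al : C := conjc (fourier gp 0).
have al0 : al != 0 by rewrite conjc_eq0 (wh_coef0 p1 pq wh).
pose gm' : F := fun t => al^-1 * circ_conj gp t.
pose gp' : F := fun t => al * circ_conj gm t.
have gm'i : circ_inv gm' = (fun t => al * circ_conj (circ_inv gp) t).
  by apply/funext => t; rewrite /circ_inv /gm' invfM invrK /circ_conj conjcV.
have gp'i : circ_inv gp' = (fun t => al^-1 * circ_conj (circ_inv gm) t).
  by apply/funext => t; rewrite /circ_inv /gp' invfM /circ_conj conjcV.
have HZ r c f : 1 < r -> Hp r f -> Hp r (fun t => c * f t).
  move=> r1 [Lf f0]; have r0 := lt_trans ltr01 r1; split; first exact: (LpZ c r0 Lf).1.
  by move=> k k0; rewrite (fourierZ c k (Lp_Lp1 r1 Lf)) f0// mulr0.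
have HbarZ r c f : 1 < r -> Hpbar r f -> Hpbar r (fun t => c * f t).
  move=> r1 [Lf f0]; have r0 := lt_trans ltr01 r1; split; first exact: (LpZ c r0 Lf).1.
  by move=> k k0; rewrite (fourierZ c k (Lp_Lp1 r1 Lf)) f0// mulr0.
have Hgp' : Hp p gp' by apply: HZ => //; exact: Hp_conj.
have Hgp'i : Hp q (circ_inv gp') by rewrite gp'i; apply: HZ => //; exact: Hp_conj.
have Hgm' : Hpbar q gm' by apply: HbarZ => //; exact: Hpbar_conj.
have Hgm'i : Hpbar p (circ_inv gm') by rewrite gm'i; apply: HbarZ => //; exact: Hpbar_conj.
have gp'0 : circ_neq0 gp'.
  by apply: ae_imp (wh_ae wh) => s [_ gms _]; rewrite /gp' mulf_neq0// conjc_eq0.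
have gm'0 : circ_neq0 gm'.
  by apply: ae_imp (wh_ae wh) => s [_ _ gps]; rewrite /gm' mulf_neq0 ?invr_eq0// conjc_eq0.
exists gm', gp'; split=> //.
- apply: ae_imp (wh_ae wh) => s [gs _ _]; rewrite /circ_conj gs !conjcM /circ_mul /gm' /gp'.
  have -> : conjc (expi s ^ n) = circ_pow (- n) (expi s).
    by rewrite /circ_pow !expiXz conj_expi -expiN mulrNz mulNr.
  rewrite /circ_conj; move: (conjc _) (conjc _) (circ_pow _ _) => a b c.
  by rewrite [RHS](_ : _ = (al^-1 * al) * (b * (c * a))); [rewrite mulVf// mul1r|ring].
- rewrite (fourierZ _ _ (Lp_Lp1 q1 (Lp_conj q0 Hgp.1).1)) (fourier_conj _ (Lp_Lp1 q1 Hgp.1)).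
  by rewrite oppr0 mulVf.
have [D D0 hD] := projP_bound p1.
have K0 : 0 <= 2 * (M * D) by rewrite !mulr_ge0.
apply: (wh_extension_exists q1 qp K0) => //; first exact: Hgm'i.1.
move=> v; set Fv := wh_poly gm' gp' v.
have Lxv := LpM_poly v p1' Hgm'i.1.
set xv := circ_mul (circ_inv gm') _ in Lxv.
have [Hw wP] := projP_Hp p1 Lxv; have [LQ Q0] := projQ_spec p1 Lxv.
have Lv := (Hp_poly v q1').1.
have HF : Hp q Fv.
  have xv_le : spec_le (size v)%:Z xv.
    have vs : spec_le (size v)%:Z (fun t => v.[t]).
      move=> k; rewrite fourier_horner; case: k => // k kv; apply: nth_default.
      by apply: ltnW; rewrite -ltz_nat.
    have [+ _] := spec_leM p1 pq Hgm'i.1 Lv Hgm'i.2 vs.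
    by rewrite add0r.
  have w_le : spec_le (size v)%:Z (projP xv).
    by move=> k kv; rewrite wP ?xv_le//; move: kv; clear; lia.
  have [W hW] := finite_spec (Lp_Lp1 p1 Hw.1) Hw.2 w_le.
  have E : circ_eq (circ_mul (circ_inv gp') (fun t => W.[t])) Fv.
    by apply: ae_imp hW => s hs; rewrite /Fv /wh_poly /circ_mul hs.
  have mF : cmeas Fv.
    by apply: cmeas_circ_mul; [exact: Lp_cmeas Hgp'i.1|exact: Lp_cmeas Hw.1].
  have LW := LpM_poly W q1' Hgp'i.1.
  have [LF _] := Lp_ae q0 mF LW E; split => // k k0.
  rewrite -(fourier_ae k (Lp_cmeas LW) mF E).
  have [s0 _] := spec_geM q1 qp Hgp'i.1 (Hp_poly W p1').1 Hgp'i.2 (Hp_poly W p1').2.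
  by apply: s0; rewrite addr0.
split=> //.
(* the duality between B and the candidate extension, on polynomials *)
have adj (u : {poly C}) : circ_int (fun t => u.[t] * circ_conj Fv t) =
    circ_int (fun t => B (fun t => u.[t]) t * circ_conj (fun t => v.[t]) t).
  have Lr := LpM_poly u q1' Hgmi.1; set r := circ_mul (circ_inv gm) _ in Lr.
  have [HW _] := projP_Hp q1 Lr.
  have LBu := (BH _ (Hp_poly u p1')).1.
  have L1 := hoelder_conj q1 qp Lr Hw.1.
  have L2 := hoelder_conj p1 pq LBu Lv.
  have L3 := hoelder_conj q1 qp HW.1 Lxv.
  have -> : circ_int (fun t => u.[t] * circ_conj Fv t) =
      conjc al^-1 * circ_int (fun t => r t * circ_conj (projP xv) t).
    rewrite -circ_intZ//; apply: circ_int_ext => s.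
    rewrite /Fv /wh_poly /circ_mul gp'i -/xv /r /circ_mul /circ_conj !conjcM conjcK; ring.
  rewrite -(pairing_projP q1 qp Lr Hw) (pairing_projP_r q1 qp HW Lxv).
  rewrite -circ_intZ//; apply: circ_int_ae.
  - by apply: cmeasM; [exact: cmeas_cst|exact: Lp_cmeas L3].
  - exact: Lp_cmeas L2.
  apply: ae_imp (BE u) => s ->; rewrite -/r /xv /circ_mul gm'i /circ_conj !conjcM.
  rewrite (conjcK (circ_inv gp (expi s))) conjcV.
  have cal : conjc al != 0 by rewrite conjc_eq0.
  move: (conjc al) cal (projP r _) (circ_inv gp _) (conjc v.[_]) => a a0 b c d.
  by rewrite [LHS](_ : _ = (a^-1 * a) * (c * b * d)); [rewrite mulVf// mul1r|ring].
apply: (converse_hoelder p1 pq) => //.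
- by rewrite mulr_ge0// nrm_ge0.
- exact: HF.1.
move=> s; have Ls := Lp_teval s p1'.
have [Lu nu] := Lp_conj p0 Ls; set u' := circ_conj (teval s) in Lu nu.
have [HP _] := projP_Hp p1 Lu; have [_ _ nP] := hD _ Lu.
have [u hu] : exists u : {poly C}, circ_eq (projP u') (fun t => u.[t]).
  pose s' := [seq (conjc a.1, - a.2) | a <- s].
  have sE (y : R) : u' (expi y) = teval s' (expi y) by rewrite /s' teval_conj.
  exists (anp (tproj s')).
  have Lu1 := Lp_Lp1 p1 Lu.
  apply: fourier_inj; first exact: (Lp_Lp1 p1 HP.1).
    by apply: bdd_Lp => //; exact: bdd_horner.
  move=> k; have [_ -> _] := hD _ Lu.
  have -> : (fun t => (anp (tproj s')).[t]) = teval (tproj s').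
    by apply/funext => t; rewrite anp_teval ?filter_all.
  by rewrite fourier_tproj (fourier_ext k sE).
have L1 := hoelder_conj p1 pq Lu HF.1.
have LBu := (BH _ (Hp_poly u p1')).1.
have -> : circ_int (fun t => Fv t * teval s t) = conjc (circ_int (fun t => u' t * circ_conj Fv t)).
  rewrite -circ_int_conj//; apply: circ_int_ext => y.
  by rewrite /u' /circ_conj conjcM !conjcK mulrC.
rewrite normc_conj -(pairing_projP p1 pq Lu HF).
have -> : circ_int (fun t => projP u' t * circ_conj Fv t) =
    circ_int (fun t => u.[t] * circ_conj Fv t).
  apply: circ_int_ae.
  - exact: Lp_cmeas (hoelder_conj p1 pq HP.1 HF.1).
  - exact: Lp_cmeas (hoelder_conj p1 pq (Hp_poly u p1').1 HF.1).
  - by apply: ae_imp hu => y hy; rewrite hy.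
rewrite adj; apply: le_trans (pairing_le p1 pq LBu Lv) _.
have nu' : nrm p (fun t => u.[t]) <= D * nrm p (teval s).
  by rewrite (Lp_ae p0 (Lp_cmeas (Hp_poly u p1').1) HP.1 hu).2 -nu.
have b1 : nrm p (B (fun t => u.[t])) <= M * (D * nrm p (teval s)).
  by apply: le_trans (hM _ (Hp_poly u p1')) _; exact: ler_wpM2l.
have V0 := nrm_ge0 q (fun t => v.[t]).
move: (nrm q (fun t => v.[t])) (nrm p (teval s)) (nrm p (B _)) V0 b1 => V S N V0 b1.
have -> : 2 * (M * D) * V * S = 2 * (M * (D * S) * V) by ring.
by rewrite ler_pM2l//; exact: ler_wpM2r.
Qed.

End Adjoint.

(** * Toeplitz plus Hankel operators with matching symbols *)

Section MatchingPair.
Context {R : realType}.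
Local Notation C := R[i].
Local Notation F := (C -> C).
Local Notation T := (measurableTypeR R).
Local Notation mu := (@arc_length R).
Implicit Types (f g h : F) (i j n k : int) (p q : R).

Lemma conj_pow_nat f (j : nat) (y : R) :
  circ_conj (fun s => circ_conj f s * s ^+ j) (expi y) = f (expi y) * expi y ^ (- j%:Z).
Proof.
by rewrite /circ_conj conjcM conjcK exprnP !expiXz conj_expi -expiN mulrNz mulNr.
Qed.

Lemma fourier_pairing f g (j : nat) (e : F) :
  (forall y : R, circ_conj e (expi y) = g (expi y) * expi y ^ (- j%:Z)) ->
  fourier (fun t => g t * f t) j = (Complex (2 * pi) 0)^-1 * circ_int (fun t => f t * circ_conj e t).
Proof.
move=> he; rewrite fourier_def; congr (_ * _); apply: circ_int_ext => y.
by rewrite he mulrA (mulrC (f _)).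
Qed.

Lemma bdd_conj g : bdd g -> bdd (circ_conj g).
Proof.
move=> [mg [M M0 gM]]; split; first exact: cmeas_conj.
by exists M => //; apply: ae_imp gM => y; rewrite /mag normc_conj.
Qed.

Lemma Lp_bddM p g f : 1 <= p -> bdd g -> Lp p%:E f -> Lp p%:E (circ_mul g f).
Proof. by move=> p1 bg Lf; have [M _ /(_ _ Lf)[]] := LpM_bdd p1 bg. Qed.

Lemma toeplitz_Hp p g f : 1 < p -> bdd g -> Hp p f ->
  Hp p (toeplitz g f) /\ toeplitz g f = projP (circ_mul g f).
Proof.
move=> p1 bg Hf; have [[LP _] _] := projP_Hp p1 Hf.1.
have LM := Lp_bddM (ltW p1) bg Hf.1.
have E : toeplitz g f = projP (circ_mul g f).
  apply: projP_ext => k _; apply: fourier_ae.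
  - exact: Lp_cmeas (Lp_bddM (ltW p1) bg LP).
  - exact: Lp_cmeas LM.
  - by apply: ae_imp (projP_id p1 Hf) => y e; rewrite /circ_mul e.
by rewrite E; have [] := projP_Hp p1 LM.
Qed.

Lemma spec_flipJ_Hp p f : 1 < p -> Hp p f -> spec_le (-1) (flipJ f).
Proof.
move=> p1 Hf k k1; rewrite (fourier_flipJ _ (Lp_Lp1 p1 Hf.1)) Hf.2//.
by move: k1; clear; lia.
Qed.

Lemma flipJ_Hp p f : 1 < p -> Lp p%:E f -> spec_le (-1) f -> Hp p (flipJ f).
Proof.
move=> p1 Lf fm; split; first exact: (Lp_flipJ (ltW p1) Lf).1.
move=> k k0; rewrite (fourier_flipJ _ (Lp_Lp1 p1 Lf)) fm//.
by move: k0; clear; lia.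
Qed.

(** J maps H^p into negative frequencies, so that the projection Q in H(b) acts as the
    identity. *)
Lemma fourier_T_plus_H p (a b phi : F) k : 1 < p -> bdd a -> bdd b -> Hp p phi ->
  Lp p%:E (fun t => toeplitz a phi t + hankel b phi t) /\
  fourier (fun t => toeplitz a phi t + hankel b phi t) k =
    if 0 <= k then fourier (fun t => a t * phi t + b t * flipJ phi t) k else 0.
Proof.
move=> p1 ba bb Hphi; have p1' := ltW p1.
have [[LT T0] TE] := toeplitz_Hp p1 ba Hphi.
have [LJ _] := Lp_flipJ p1' Hphi.1.
have JQ : circ_eq (projQ (flipJ phi)) (flipJ phi).
  have [[LP P0] PE] := projP_Hp p1 LJ.
  have Jm := spec_flipJ_Hp p1 Hphi.
  have z : circ_eq (projP (flipJ phi)) (fun=> 0).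
    apply: fourier_inj0; first exact: (Lp_Lp1 p1 LP).
    move=> m; case: (ltP m 0) => m0; first exact: P0.
    by rewrite PE// Jm//; move: m0; clear; lia.
  by apply: ae_imp z => y e; rewrite /projQ e subr0.
have [LQ _] := projQ_spec p1 LJ.
have Lb := Lp_bddM p1' bb LQ; have [[LH H0] HE] := projP_Hp p1 Lb.
have La := Lp_bddM p1' ba Hphi.1; have LbJ := Lp_bddM p1' bb LJ.
have [LS _] := LpD p1' LT LH; split => //.
rewrite (fourierD k (Lp_Lp1 p1 LT) (Lp_Lp1 p1 LH)).
case: ifPn => k0; last by rewrite -ltNge in k0; rewrite T0// H0// addr0.
rewrite (fourierD k (Lp_Lp1 p1 La) (Lp_Lp1 p1 LbJ)) TE (projP_Hp p1 La).2// HE//.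
congr (_ + _); apply: fourier_ae.
- exact: Lp_cmeas Lb.
- exact: Lp_cmeas LbJ.
- by apply: ae_imp JQ => y e; rewrite /circ_mul e.
Qed.

Lemma pairing_mul (r f g : F) : circ_int (fun t => circ_mul r f t * circ_conj g t) =
  circ_int (fun t => f t * circ_conj (circ_mul (circ_conj r) g) t).
Proof.
by apply: circ_int_ext => y; rewrite /circ_mul /circ_conj conjcM conjcK mulrCA mulrA.
Qed.

(** The coefficient is the pairing of T(r) g with conj(cm)^-1 t^j. Moving T(r) to the other
    side gives the pairing of g with E, and E = T(conj d) A where A is the right inverse
    applied to E; moving T(conj d) back turns g into T(d) g = f. *)
Lemma cokernel_condition p q (d r cm f g : F) n gm gp (j : nat) :
  1 < p -> p^-1 + q^-1 = 1 -> bdd d -> bdd r -> Hpbar q (circ_inv cm) ->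
  wh_factorization p q d n gm gp -> 0 <= n -> Hp p f -> Hp p g ->
  (forall k, 0 <= k -> fourier (fun t => d t * g t) k = fourier f k) ->
  circ_int (fun t => Trinv q p (circ_conj d) (toeplitz (circ_conj r)
     (fun s => circ_conj (circ_inv cm) s * s ^+ j)) t * circ_conj f t) = 0 ->
  fourier (fun t => circ_inv cm t * toeplitz r g t) j = 0.
Proof.
move=> p1 pq bd br Hcm wh n0 Hf Hg dg; have [q1 p0 q0 qp] := conj_exponents p1 pq.
have p1' := ltW p1; have q1' := ltW q1.
set e : F := fun s => circ_conj (circ_inv cm) s * s ^+ j.
have He : Hp q e.
  have [Lc c0] := Hp_conj q1 Hcm; have [Lr _] := Lp_powr j%:Z q1' Lc.
  have -> : e = (fun t => t ^ j%:Z * circ_conj (circ_inv cm) t).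
    by apply/funext => t; rewrite /e mulrC exprnP.
  split; first exact: (Lp_pow j%:Z q1' Lc).1.
  by move=> k k0; rewrite fourier_shift c0//; move: k0; clear; lia.
have [HE EE] := toeplitz_Hp q1 (bdd_conj br) He; set E := toeplitz _ e in HE EE *.
have [gm' [gp' wh']] := adjoint_factorization p1 pq wh.
have nn : - n <= 0 by rewrite oppr_le0.
have [HA AE] := Trinv_spec q1 qp (bdd_conj bd) wh' nn HE.
set A := Trinv _ _ _ _ in HA AE *.
have [_ TE] := toeplitz_Hp p1 br Hg.
have Lrg := Lp_bddM p1' br Hg.1; have Ldg := Lp_bddM p1' bd Hg.1.
have Lre := Lp_bddM q1' (bdd_conj br) He.1; have LdA := Lp_bddM q1' (bdd_conj bd) HA.1.
move=> Af; rewrite (@fourier_pairing _ _ _ e); last first.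
  by move=> y; rewrite /e conj_pow_nat.
rewrite TE (pairing_projP p1 pq Lrg He).
rewrite pairing_mul -(pairing_projP_r p1 pq Hg Lre) -EE.
have -> : circ_int (fun t => g t * circ_conj E t) =
    circ_int (fun t => g t * circ_conj (projP (circ_mul (circ_conj d) A)) t).
  have [HPd PdE] := projP_Hp q1 LdA.
  apply: circ_int_ae.
  - exact: Lp_cmeas (hoelder_conj p1 pq Hg.1 HE.1).
  - exact: Lp_cmeas (hoelder_conj p1 pq Hg.1 HPd.1).
  have EA : circ_eq E (projP (circ_mul (circ_conj d) A)).
    apply: fourier_inj; [exact: (Lp_Lp1 q1 HE.1)|exact: (Lp_Lp1 q1 HPd.1)|].
    move=> k; case: (ltP k 0) => k0; first by rewrite HE.2// HPd.2.
    by rewrite PdE// AE.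
  by apply: ae_imp EA => y ey; rewrite /circ_conj ey.
rewrite (pairing_projP_r p1 pq Hg LdA) -pairing_mul -(pairing_projP p1 pq Ldg HA).
have [HPd PdE] := projP_Hp p1 Ldg.
have -> : circ_int (fun t => projP (circ_mul d g) t * circ_conj A t) =
    circ_int (fun t => f t * circ_conj A t).
  apply: circ_int_ae.
  - exact: Lp_cmeas (hoelder_conj p1 pq HPd.1 HA.1).
  - exact: Lp_cmeas (hoelder_conj p1 pq Hf.1 HA.1).
  have Ef : circ_eq (projP (circ_mul d g)) f.
    apply: fourier_inj; [exact: (Lp_Lp1 p1 HPd.1)|exact: (Lp_Lp1 p1 Hf.1)|].
    move=> k; case: (ltP k 0) => k0; first by rewrite HPd.2// Hf.2.
    by rewrite PdE// dg.
  by apply: ae_imp Ef => y ey; rewrite ey.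
rewrite pairing_sym; last exact: (hoelder_conj q1 qp HA.1 Hf.1).
by rewrite Af conjc0 mulr0.
Qed.

Section Pair.
Variables (a b : F).
Hypothesis mab : matching_pair a b.

(** The matching relation carries invertibility from a to b. *)
Lemma matching_ae : {ae mu, forall y : T, [/\ a (expi y) != 0, circ_tilde a (expi y) != 0,
  b (expi y) != 0, circ_tilde b (expi y) != 0 &
  a (expi y) * circ_tilde a (expi y) = b (expi y) * circ_tilde b (expi y)]}.
Proof.
have [[_ a0 _] _ e] := mab.
have a0' : {ae mu, forall y : T, circ_tilde a (expi y) != 0}.
  by apply: ae_imp (ae_refl a0) => y; rewrite circ_tilde_refl.
apply: ae_imp2 (ae_and a0 a0') e => y [h1 h2]; rewrite /circ_mul => h3.
have : b (expi y) * circ_tilde b (expi y) != 0 by rewrite -h3 mulf_neq0.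
by rewrite mulf_eq0 negb_or => /andP[h4 h5]; split.
Qed.

Lemma matching_bdd : [/\ bdd a, bdd b, bdd (circ_inv (circ_tilde a)), bdd (sub_c a b) &
  bdd (sub_d a b)].
Proof.
have [[La a0 Lai] Lb e] := mab.
have ba := Linf_bdd La; have bai := Linf_bdd Lai; have bb := Linf_bdd Lb.
have bati : bdd (circ_inv (circ_tilde a)) := bdd_tilde bai.
have bbi : bdd (circ_inv b).
  have bp : bdd (fun t => circ_tilde b t * (circ_inv a t * circ_inv (circ_tilde a) t)).
    by apply: bddM; [exact: bdd_tilde|exact: bddM].
  split; first by apply: cmeas_inv; case: bb.
  have [_ [M M0 hM]] := bp; exists M => //.
  apply: ae_imp2 matching_ae hM => y [h1 h2 h3 h4 h5].
  suff -> : mag (fun t => circ_tilde b t * (circ_inv a t * circ_inv (circ_tilde a) t)) y =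
    mag (circ_inv b) y by [].
  rewrite /mag /circ_inv; congr nc; rewrite -invfM h5 invfM mulrCA divff ?mulr1//.
by split=> //; exact: bddM.
Qed.

(** J(a phi + b J phi) = a~ J phi + b~ phi, where x~ is x(1/t), and a a~ = b b~. *)
Lemma sub_d_flipJ (phi : F) : circ_eq
  (flipJ (fun t => a t * phi t + b t * flipJ phi t))
  (fun t => (sub_d a b t)^-1 * (a t * phi t + b t * flipJ phi t)).
Proof.
apply: ae_imp matching_ae => y [h1 h2 h3 h4 h5].
have e1 : flipJ (fun t => a t * phi t + b t * flipJ phi t) (expi y) =
    circ_tilde a (expi y) * flipJ phi (expi y) + circ_tilde b (expi y) * phi (expi y).
  rewrite -(flipJ_flipJ phi) /flipJ /circ_tilde invrK; ring.
rewrite e1 /sub_d /circ_mul /circ_inv invfM invrK.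
move: h2 h3 h5; move: (circ_tilde a _) (circ_tilde b _) (a _) (b _) (phi _) (flipJ phi _).
move=> a' b' x z u v a'0 z0 h5.
have -> : z^-1 * a' * (x * u + z * v) = z^-1 * (x * a') * u + a' * (z^-1 * z) * v by ring.
by rewrite h5 mulrA mulVf// mul1r mulr1 addrC.
Qed.

(** As c h and a~^-1 g have the same projection, phi = h - J(c h - a~^-1 g), where the
    bracket has negative frequencies only. The matching relation then gives a phi + b J phi
    = J g + d g, and P kills J g. *)
Lemma T_plus_H_solution p f g h : 1 < p -> Hp p f -> Hp p g -> Hp p h ->
  (forall k, 0 <= k -> fourier (fun t => sub_d a b t * g t) k = fourier f k) ->
  (forall k, 0 <= k -> fourier (circ_mul (sub_c a b) h) k =
     fourier (circ_mul (circ_inv (circ_tilde a)) g) k) ->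
  let phi := fun t => h t - flipJ (projQ (circ_mul (sub_c a b) h)) t
                          + flipJ (projQ (circ_mul (circ_inv (circ_tilde a)) g)) t in
  Hp p phi /\ circ_eq (fun t => toeplitz a phi t + hankel b phi t) f.
Proof.
move=> p1 Hf Hg Hh dg ch phi; have p1' := ltW p1.
have [ba bb br bc bd] := matching_bdd.
set c := sub_c a b in bc ch phi *; set r := circ_inv (circ_tilde a) in br ch phi *.
have Lch := Lp_bddM p1' bc Hh.1; have Lrg := Lp_bddM p1' br Hg.1.
have Ldg := Lp_bddM p1' bd Hg.1.
pose w : F := fun t => circ_mul c h t - circ_mul r g t.
have [Lw _] := LpB p1' Lch Lrg.
have w0 : spec_le (-1) w.
  move=> k k1; have k0 : 0 <= k by move: k1; clear; lia.
  by rewrite (fourierB k (Lp_Lp1 p1 Lch) (Lp_Lp1 p1 Lrg)) ch// subrr.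
have phiE : phi = (fun t => -1 * flipJ w t + h t).
  apply/funext => t; rewrite /phi /projQ (projP_ext ch) /flipJ /w.
  by move: (circ_mul c h _) (circ_mul r g _) (projP _ _) => u v z; ring.
have Hphi : Hp p phi by rewrite phiE; apply: HpD => //; exact: flipJ_Hp.
split=> //.
have LJg := (Lp_flipJ p1' Hg.1).1.
have E : circ_eq (fun t => a t * phi t + b t * flipJ phi t) (fun t => flipJ g t + circ_mul (sub_d a b) g t).
  apply: ae_imp matching_ae => y [h1 h2 h3 h4 h5].
  have Jw : flipJ w (expi y) = circ_tilde c (expi y) * flipJ h (expi y) -
      (a (expi y))^-1 * flipJ g (expi y).
    rewrite /w /flipJ mulrBr; congr (_ - _); first exact: mulrCA.
    by rewrite /circ_mul /r /circ_inv /circ_tilde invrK mulrCA.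
  have Jphi : flipJ phi (expi y) = flipJ h (expi y) - w (expi y).
    rewrite -(flipJ_flipJ w) phiE /flipJ mulrDr mulN1r mulrN; exact: addrC.
  rewrite Jphi phiE Jw /w /circ_mul /c /r /sub_c /sub_d /circ_mul /circ_inv.
  have -> : circ_tilde (fun t => a t * (b t)^-1) (expi y) =
     circ_tilde a (expi y) / circ_tilde b (expi y) by [].
  move: (flipJ g _) (flipJ h _) (g _) (h _) h1 h2 h3 h4 h5.
  move: (a _) (b _) (circ_tilde a _) (circ_tilde b _) => x z x' z' Jg Jh u v x0 x'0 z0 z'0 e.
  have ez : x * x' / z' = z by rewrite e mulfK.
  have -> : x * (-1 * (x' / z' * Jh - x^-1 * Jg) + v) + z * (Jh - (x / z * v - x'^-1 * u)) =
     (z - x * x' / z') * Jh + (x / x) * Jg + (1 - z / z) * x * v + z / x' * u by ring.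
  by rewrite ez !divff// !subrr !mul0r mul1r add0r addr0.
have LSum k := fourier_T_plus_H k p1 ba bb Hphi.
have La := Lp_bddM p1' ba Hphi.1; have LbJ := Lp_bddM p1' bb (Lp_flipJ p1' Hphi.1).1.
apply: fourier_inj; [exact: (Lp_Lp1 p1 (LSum 0).1)|exact: (Lp_Lp1 p1 Hf.1)|].
move=> k; rewrite (LSum k).2; case: ifPn => k0; last by rewrite Hf.2// ltNge.
rewrite (fourier_ae k (Lp_cmeas (LpD p1' La LbJ).1) (Lp_cmeas (LpD p1' LJg Ldg).1) E).
rewrite (fourierD k (Lp_Lp1 p1 LJg) (Lp_Lp1 p1 Ldg)).
by rewrite (spec_flipJ_Hp p1 Hg) ?add0r ?dg//; move: k0; clear; lia.
Qed.

(** If psi = a phi + b J phi has negative frequencies only, then J psi lies in H^p and psi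
    = d J psi; so psi = 0 by injectivity of T(d), and then c phi = - J phi has negative
    frequencies, so phi = 0 by injectivity of T(c). *)
Lemma T_plus_H_injective p q nc cm cp nd dm dp (phi : F) : 1 < p -> p^-1 + q^-1 = 1 ->
  wh_factorization p q (sub_c a b) nc cm cp -> 0 <= nc ->
  wh_factorization p q (sub_d a b) nd dm dp -> 0 <= nd -> Hp p phi ->
  (forall k, 0 <= k -> fourier (fun t => a t * phi t + b t * flipJ phi t) k = 0) ->
  circ_eq phi (fun=> 0).
Proof.
move=> p1 pq wc nc0 wd nd0 Hphi psi0; have p1' := ltW p1.
have [ba bb br bc bd] := matching_bdd.
have LJ := (Lp_flipJ p1' Hphi.1).1.
have La := Lp_bddM p1' ba Hphi.1; have LbJ := Lp_bddM p1' bb LJ.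
set psi : F := fun t => a t * phi t + b t * flipJ phi t in psi0.
have Lpsi : Lp p%:E psi := (LpD p1' La LbJ).1.
have psim : spec_le (-1) psi by move=> k k1; apply: psi0; move: k1; clear; lia.
have Heta := flipJ_Hp p1 Lpsi psim.
have Ldeta := Lp_bddM p1' bd Heta.1.
have deta : circ_eq (circ_mul (sub_d a b) (flipJ psi)) psi.
  apply: ae_imp2 matching_ae (sub_d_flipJ phi) => y [h1 h2 h3 h4 h5] e.
  rewrite /circ_mul e mulVKf// /sub_d /circ_mul /circ_inv mulf_neq0// invr_eq0//.
have eta0 : circ_eq (flipJ psi) (fun=> 0).
  apply: (wh_injective p1 pq wd bd nd0 Heta) => k k0.
  by rewrite (fourier_ae k (Lp_cmeas Ldeta) (Lp_cmeas Lpsi) deta) psi0.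
have Lc := Lp_bddM p1' bc Hphi.1; have [LN _] := LpN (lt_trans ltr01 p1) LJ.
apply: (wh_injective p1 pq wc bc nc0 Hphi) => k k0.
have E : circ_eq (circ_mul (sub_c a b) phi) (fun t => - flipJ phi t).
  apply: ae_imp2 (ae_and matching_ae deta) eta0 => y [[h1 h2 h3 h4 h5] e1] e2.
  rewrite /circ_mul e2 mulr0 in e1; move/esym: e1; rewrite /psi /sub_c /circ_mul /circ_inv.
  move: h3; move: (a _) (b _) (phi _) (flipJ phi _) => x z u v z0 /eqP.
  rewrite addr_eq0 => /eqP e; rewrite mulrAC e mulNr mulrAC divff// mul1r//.
rewrite (fourier_ae k (Lp_cmeas Lc) (Lp_cmeas LN) E) (fourierN k (Lp_Lp1 p1 LJ)).
by rewrite (spec_flipJ_Hp p1 Hphi) ?oppr0//; move: k0; clear; lia.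
Qed.

End Pair.

End MatchingPair.

(** * The theorem *)

Theorem theorem3p3 (R : realType) (p q : R) (a b : R[i] -> R[i])
    (kc kd : int) (cm cp dm dp f : R[i] -> R[i]) :
  1 < p -> p^-1 + q^-1 = 1 ->
  matching_pair a b ->
  fredholm_index p (toeplitz (sub_c a b)) kc -> kc <= 0 ->
  fredholm_index p (toeplitz (sub_d a b)) kd -> kd <= 0 ->
  wh_factorization p q (sub_c a b) (- kc) cm cp ->
  wh_factorization p q (sub_d a b) (- kd) dm dp ->
  Hp p f ->
  (forall j : nat, j%:Z <= - kd - 1 ->
    circ_int (fun t => circ_conj (circ_inv dm) t * t ^+ j * circ_conj f t) = 0) ->
  (forall j : nat, j%:Z <= - kc - 1 ->
    circ_int (fun t =>
      Trinv q p (circ_conj (sub_d a b))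
        (toeplitz (circ_conj (circ_inv (circ_tilde a)))
          (fun s => circ_conj (circ_inv cm) s * s ^+ j)) t * circ_conj f t) = 0) ->
  let g := Tlinv p q (sub_d a b) f in
  let h := Tlinv p q (sub_c a b) (toeplitz (circ_inv (circ_tilde a)) g) in
  let solves (phi : R[i] -> R[i]) :=
    Hp p phi /\ circ_eq (fun t => toeplitz a phi t + hankel b phi t) f in
  exists phi0 : R[i] -> R[i],
    [/\ solves phi0,
        forall phi, solves phi -> circ_eq phi phi0
      & circ_eq phi0 (fun t =>
          h t - flipJ (projQ (circ_mul (sub_c a b) h)) t
              + flipJ (projQ (circ_mul (circ_inv (circ_tilde a)) g)) t)].
Proof.
move=> p1 pq mab _ kc0 _ kd0 wc wd Hf cond1 cond2 g h solves.
have [ba bb br bc bd] := matching_bdd mab; have p1' := ltW p1.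
have [q1 p0 q0 qp] := conj_exponents p1 pq.
have [nc0 nd0] : 0 <= - kc /\ 0 <= - kd by rewrite !oppr_ge0.
have [_ _ [_ _ Hcmi] _ _] := wc; have [_ _ [_ _ Hdmi] _ _] := wd.
have [Hg dg] : Hp p g /\ forall k, 0 <= k ->
    fourier (fun t => sub_d a b t * g t) k = fourier f k.
  apply: (Tlinv_solves p1 pq bd wd nd0 Hf) => j jn.
  rewrite (@fourier_pairing _ _ _ _ (fun t => circ_conj (circ_inv dm) t * t ^+ j)); last first.
    by move=> y; rewrite conj_pow_nat.
  have Le : Lp q%:E (fun t => circ_conj (circ_inv dm) t * t ^+ j).
    exact: (Lp_powr j%:Z (ltW q1) (Lp_conj q0 Hdmi.1).1).1.
  rewrite pairing_sym; last exact: (hoelder_conj q1 qp Le Hf.1).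
  by rewrite cond1 ?conjc0 ?mulr0//; move: jn; clear; lia.
have [HT TE] := toeplitz_Hp p1 br Hg; have Lrg := Lp_bddM p1' br Hg.1.
have [Hh ch] : Hp p h /\ forall k, 0 <= k -> fourier (fun t => sub_c a b t * h t) k =
    fourier (toeplitz (circ_inv (circ_tilde a)) g) k.
  apply: (Tlinv_solves p1 pq bc wc nc0 HT) => j jn.
  apply: (cokernel_condition p1 pq bd br Hcmi wd nd0 Hf Hg dg).
  by apply: cond2; move: jn; clear; lia.
have {}ch k : 0 <= k -> fourier (circ_mul (sub_c a b) h) k =
    fourier (circ_mul (circ_inv (circ_tilde a)) g) k.
  by move=> k0; rewrite [LHS]ch// TE (projP_Hp p1 Lrg).2.
have [Hphi0 sol0] := T_plus_H_solution mab p1 Hf Hg Hh dg ch.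
set phi0 := (fun t => h t - _ t + _ t) in Hphi0 sol0.
exists phi0; split; [by []| |exact: circ_eq_refl].
move=> phi [Hphi sol].
have coefs (u : R[i] -> R[i]) k : Hp p u ->
    circ_eq (fun t => toeplitz a u t + hankel b u t) f -> 0 <= k ->
    fourier (fun t => a t * u t + b t * flipJ u t) k = fourier f k.
  move=> Hu su k0; have [Lu] := fourier_T_plus_H k p1 ba bb Hu; rewrite k0 => <-.
  by rewrite (fourier_ae k (Lp_cmeas Lu) (Lp_cmeas Hf.1) su).
have Hd := HpD (-1) p1 Hphi0 Hphi.
suff z : circ_eq (fun t => -1 * phi0 t + phi t) (fun=> 0).
  by apply: ae_imp z => y /eqP; rewrite mulN1r addrC subr_eq0 => /eqP.
apply: (T_plus_H_injective mab p1 pq wc nc0 wd nd0 Hd) => k k0.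
have LS (u : R[i] -> R[i]) (Hu : Hp p u) : Lp p%:E (fun t => a t * u t + b t * flipJ u t).
  exact: (LpD p1' (Lp_bddM p1' ba Hu.1) (Lp_bddM p1' bb (Lp_flipJ p1' Hu.1).1)).1.
have -> : (fun t => a t * (-1 * phi0 t + phi t) + b t * flipJ (fun t => -1 * phi0 t + phi t) t) =
    (fun t => (a t * phi t + b t * flipJ phi t) - (a t * phi0 t + b t * flipJ phi0 t)).
  by apply/funext => t; rewrite /flipJ; move: (phi0 t) (phi0 _) (phi _) (phi _) => *; ring.
rewrite (fourierB k (Lp_Lp1 p1 (LS _ Hphi)) (Lp_Lp1 p1 (LS _ Hphi0))).
by rewrite !coefs// subrr.
Qed.
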